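(* Let $M$ be an $n$-dimensional $C^1$ manifold equipped with its Borel $\sigma$-algebra, and let $\Phi^t:M\to M$ $(t\in\mathbb{R})$ be a $C^1$ flow generated by a vector field $V$, with an ergodic invariant probability measure $\mu$ whose support $X\subset M$ is compact. Let $z:X\to S^1$ be a non-constant $C(X)$ or $L^2(\mu)$ Koopman eigenfunction with eigenfrequency $\omega$, let $\mathcal L_1=z^{-1}(1)$, and let $R=\Phi^{2\pi/\omega}:\mathcal L_1\to\mathcal L_1$, equipped with the conditional measure $\mu|\mathcal L_1$. Suppose the quasiperiodicity dimension $\dim_{\mathcal D}$ is finite, i.e. $\mathcal D$ is generated by $\dim_{\mathcal D}$ independent eigenfunctions $z_1,\ldots,z_{\dim_{\mathcal D}}$ for some $\dim_{\mathcal D}\ge1$. Then: (i) The discrete subspace of $R:\mathcal L_1\to\mathcal L_1$ is generated by $\dim_{\mathcal D}-1$ eigenfunctions. If moreover $\dim_{\mathcal D}=1$, then: (ii) $R:\mathcal L_1\to\mathcal L_1$ has no (non-trivial) eigenfunctions and hence is weakly mixing. (iii) $U^t|\mathcal D^\perp$ is strongly (resp. weakly) mixing if and only if $R$ is strongly (resp. weakly) mixing, in which case these two systems have the same rates of mixing.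
   Context: $S^1$ is the unit circle in $\mathbb{C}$, $\iota=\sqrt{-1}$, $U^tf=f\circ\Phi^t$ is the Koopman group on $L^2(\mu)$. A $C(X)$ (resp. $L^2(\mu)$) Koopman eigenfunction with eigenfrequency $\omega$ is a function $z$ in that space with $z\circ\Phi^t=e^{\iota\omega t}z$ for all $t$, everywhere on $X$ (resp. $\mu$-a.e.). $\mathcal D\subset L^2(\mu)$ is the closed span of all $L^2(\mu)$ eigenfunctions (including constants), and $\mathcal D^\perp$ is its orthogonal complement. The discrete subspace of $R$ is likewise the closed span in $L^2(\mu|\mathcal L_1)$ of the eigenfunctions of $f\mapsto f\circ R$. Eigenfunctions are independent if no nontrivial integer linear combination of their eigenfrequencies vanishes; $\mathcal D$ is generated by independent eigenfunctions $z_1,\ldots,z_m$ if every eigenfrequency is an integer linear combination of their eigenfrequencies, and $m=\dim_{\mathcal D}$ is the quasiperiodicity dimension. For $R$, ''generated by $k$ eigenfunctions'' means every eigenvalue of $R$ is a product of integer powers of $k$ eigenvalues of $R$. $\mu|\mathcal L_1$ is the conditional probability measure on $\mathcal L_1$ from the disintegration of $\mu$ with respect to the partition of $X$ into level sets of $z$. Mixing: $f$ is strongly mixing if $\lim_{t\to\infty}\langle U^tf,g\rangle=0$ for all $g$, and weakly mixing if $\lim_{T\to\infty}\frac1T\int_0^T|\langle U^tf,g\rangle|\,dt=0$ for all $g$. $U^t|\mathcal D^\perp$ is strongly/weakly mixing if every $f\in\mathcal D^\perp$ is; $R$ is strongly/weakly mixing if every $f\in L^2(\mu|\mathcal L_1)$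 orthogonal to constants is, with $U^t$ replaced by the powers $f\mapsto f\circ R^n$, $n\in\mathbb{N}$, and integrals by sums. A function $\alpha>0$ with $\alpha(t)\to0$ as $t\to\infty$ is a rate of (strong) mixing if $|\langle U^tf,g\rangle|=O(\alpha(t))$ as $t\to\infty$ for all $f,g$ in the relevant space; rates of weak mixing are defined similarly for the averages.
   Formalization: The eigenfrequency ω is assumed not to be a proper integer multiple of another eigenfrequency (otherwise the claim fails, e.g. z = z_1² for a circle rotation), and μ|L_1 is taken from the version of the disintegration that is carried along by the flow. *)

(* Defs.v *)
From HB Require Import structures.
From mathcomp Require Import all_boot all_order all_algebra.
From mathcomp Require Import all_classical all_reals all_analysis.
From mathcomp Require Import measurable_realfun complex.
Set Implicit Arguments.
Unset Strict Implicit.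
Unset Printing Implicit Defensive.
Import Order.TTheory GRing.Theory Num.Theory.
Import numFieldNormedType.Exports.
Import ComplexField.Normc.
Local Open Scope classical_set_scope.
Local Open Scope ring_scope.
Local Open Scope complex_scope.

Section Manifold.
Context {R : realType}.

(* Meaningful for [U] open, the only way it is used.  In finite dimension,
   continuity of ['d f] is continuity in every direction. *)
Definition C1_on {V W : normedModType R} (U : set V) (f : V -> W) : Prop :=
  forall x, U x ->
    differentiable f x /\ forall v, {for x, continuous (fun y => 'd f y v)}.

(* [chart i] and [chart_inv i] are total; only their values on [chart_dom i],
   resp. on its image, are relevant. *)
Record C1_atlas (M : topologicalType) (n : nat) := C1Atlas {
  chart_index : Type ;
  chart_dom : chart_index -> set M ;
  chart : chart_index -> M -> 'rV[R]_n ;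
  chart_inv : chart_index -> 'rV[R]_n -> M ;
  chart_dom_open : forall i, open (chart_dom i) ;
  chart_cover : forall x, exists i, chart_dom i x ;
  chart_image_open : forall i, open (chart i @` chart_dom i) ;
  chart_cont : forall i x, chart_dom i x -> {for x, continuous (chart i)} ;
  chartK : forall i x, chart_dom i x -> chart_inv i (chart i x) = x ;
  chart_inv_cont : forall i u, (chart i @` chart_dom i) u ->
    {for u, continuous (chart_inv i)} ;
  chart_transition : forall i j,
    C1_on (chart i @` (chart_dom i `&` chart_dom j))
          (chart j \o chart_inv i) }.

Definition C1_manifold (M : topologicalType) (n : nat) (A : C1_atlas M n) :=
  hausdorff_space M /\ @second_countable M.

(* The tangent vector at [x] is given by its components in every chart around
   [x], which correspond to each other under the differentials of the
   transition maps. *)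
Record vector_field (M : topologicalType) (n : nat) (A : C1_atlas M n) :=
  VectorField {
    vf_comp :> chart_index A -> M -> 'rV[R]_n ;
    vf_compat : forall i j x, chart_dom i x -> chart_dom j x ->
      vf_comp j x = 'd (chart j \o chart_inv i) (chart i x) (vf_comp i x) }.

Record C1_flow (M : topologicalType) (n : nat) (A : C1_atlas M n)
    (Phi : R -> M -> M) : Prop := C1Flow {
  flow0 : forall x, Phi 0 x = x ;
  flowD : forall s t x, Phi (s + t) x = Phi s (Phi t x) ;
  flow_cont : continuous (fun p : R * M => Phi p.1 p.2) ;
  flow_C1 : forall i j : chart_index A,
    C1_on [set p : R * 'rV[R]_n | (chart i @` chart_dom i) p.2 /\
             chart_dom j (Phi p.1 (chart_inv i p.2))]
          (fun p : R * 'rV[R]_n => chart j (Phi p.1 (chart_inv i p.2))) }.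

Definition generated_by (M : topologicalType) (n : nat) (A : C1_atlas M n)
    (Phi : R -> M -> M) (V : vector_field A) : Prop :=
  forall (i : chart_index A) (t : R) (x : M), chart_dom i (Phi t x) ->
    is_derive t (1 : R) (fun s : R => chart i (Phi s x)) (V i (Phi t x)).

End Manifold.

Notation borel M := (g_sigma_algebraType (@open M)).

Definition measure_support {R : realType} {M : ptopologicalType}
    (mu : set (borel M) -> \bar R) : set M :=
  [set x | forall U : set M, open U -> U x -> (0 < mu U)%E].

Definition cis {R : realType} (theta : R) : R[i] := cos theta +i* sin theta.

Section SquareIntegrable.
Context {R : realType} {d : measure_display} {T : measurableType d}.
Variable mu : {measure set T -> \bar R}.

Definition in_L2 (f : T -> R[i]) : Prop :=
  [/\ measurable_fun setT (fun x => complex.Re (f x)),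
      measurable_fun setT (fun x => complex.Im (f x)) &
      (\int[mu]_x ((normc (f x)) ^+ 2)%:E < +oo)%E].

Definition inner (f g : T -> R[i]) : R[i] :=
  (\int[mu]_x complex.Re (f x * (g x)^*)) +i* (\int[mu]_x complex.Im (f x * (g x)^*)).

Definition ae_constant (f : T -> R[i]) : Prop :=
  exists c : R[i], {ae mu, forall x, f x = c}.

Definition closed_span (E : set (T -> R[i])) : set (T -> R[i]) :=
  [set f | in_L2 f /\ forall eps : R, 0 < eps ->
     exists (k : nat) (c : 'I_k -> R[i]) (h : 'I_k -> T -> R[i]),
       (forall i, E (h i)) /\
       (\int[mu]_x ((normc (f x - \sum_(i < k) c i * h i x)%R) ^+ 2)%:E
          < (eps ^+ 2)%:E)%E].

Definition orthocompl (E : set (T -> R[i])) : set (T -> R[i]) :=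
  [set f | in_L2 f /\ forall g, E g -> inner f g = 0].

(* [|<f o S, g>|] *)
Definition corr (S : T -> T) (f g : T -> R[i]) : R :=
  normc (inner (f \o S) g).

End SquareIntegrable.

Section RatesOfMixing.
Context {R : realType}.

Definition rate_function (alpha : R -> R) : Prop :=
  (forall t, 0 < alpha t) /\ alpha t @[t --> +oo] --> 0.

End RatesOfMixing.

Section FlowKoopman.
Context {R : realType} {d : measure_display} {T : measurableType d}.
Variables (mu : {measure set T -> \bar R}) (Phi : R -> T -> T).

Definition ergodic_invariant : Prop :=
  (forall t A, measurable A -> mu (Phi t @^-1` A) = mu A) /\
  (forall A, measurable A -> (forall t, Phi t @^-1` A = A) ->
     mu A = 0%E \/ mu A = 1%E).

Definition L2_eigenfunction (w : R) (f : T -> R[i]) : Prop :=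
  [/\ in_L2 mu f, ~ {ae mu, forall x, f x = 0} &
      forall t, {ae mu, forall x, f (Phi t x) = cis (w * t) * f x}].

Definition eigenfrequency (w : R) : Prop := exists f, L2_eigenfunction w f.

Definition flow_discrete : set (T -> R[i]) :=
  closed_span mu [set f | exists w, L2_eigenfunction w f].

Definition independent_frequencies (m : nat) (w : 'I_m -> R) : Prop :=
  forall a : 'I_m -> int,
    \sum_(i < m) (a i)%:~R * w i = 0 -> forall i, a i = 0.

Definition generated_by_independent (m : nat) (w : 'I_m -> R)
    (zs : 'I_m -> T -> R[i]) : Prop :=
  [/\ forall i, L2_eigenfunction (w i) (zs i),
      independent_frequencies w &
      forall w', eigenfrequency w' ->
        exists a : 'I_m -> int, w' = \sum_(i < m) (a i)%:~R * w i].

(* [w] is not a proper integer multiple of another eigenfrequency.  If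
   [w = k * w'] with [|k| >= 2] and [f] is an eigenfunction of frequency [w'],
   then [f] restricts to an eigenfunction of [Phi (2 * pi / w)] on the level
   sets of an eigenfunction of frequency [w], with eigenvalue the nontrivial
   root of unity [cis (2 * pi / k)]. *)
Definition primitive_frequency (w : R) : Prop :=
  forall (w' : R) (k : int),
    eigenfrequency w' -> w = k%:~R * w' -> `|k|%N = 1%N.

Definition flow_average (f g : T -> R[i]) (tau : R) : R :=
  tau^-1 * \int[lebesgue_measure]_(t in `[0, tau]) corr mu (Phi t) f g.

Definition flow_strongly_mixing (E : set (T -> R[i])) : Prop :=
  forall f g, E f -> in_L2 mu g ->
    corr mu (Phi t) f g @[t --> +oo] --> 0.

Definition flow_weakly_mixing (E : set (T -> R[i])) : Prop :=
  forall f g, E f -> in_L2 mu g ->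
    flow_average f g tau @[tau --> +oo] --> 0.

Definition flow_strong_rate (E : set (T -> R[i])) (alpha : R -> R) : Prop :=
  forall f g, E f -> E g ->
    exists C : R, \forall t \near +oo, corr mu (Phi t) f g <= C * alpha t.

Definition flow_weak_rate (E : set (T -> R[i])) (alpha : R -> R) : Prop :=
  forall f g, E f -> E g ->
    exists C : R, \forall tau \near +oo, flow_average f g tau <= C * alpha tau.

End FlowKoopman.

Section MapKoopman.
Context {R : realType} {d : measure_display} {T : measurableType d}.
Variables (nu : {measure set T -> \bar R}) (S : T -> T).

Definition map_eigenfunction (c : R[i]) (f : T -> R[i]) : Prop :=
  [/\ in_L2 nu f, ~ {ae nu, forall x, f x = 0} &
      {ae nu, forall x, f (S x) = c * f x}].

Definition map_generated_by (k : nat) : Prop :=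
  exists (lam : 'I_k -> R[i]) (h : 'I_k -> T -> R[i]),
    (forall i, map_eigenfunction (lam i) (h i)) /\
    forall c f, map_eigenfunction c f ->
      exists a : 'I_k -> int, c = \prod_(i < k) lam i ^ a i.

Definition mean_zero : set (T -> R[i]) :=
  orthocompl nu [set g | exists c : R[i], g = cst c].

Definition map_average (f g : T -> R[i]) (N : nat) : R :=
  N%:R^-1 * \sum_(n < N) corr nu (iter n S) f g.

Definition map_strongly_mixing : Prop :=
  forall f g, mean_zero f -> in_L2 nu g ->
    corr nu (iter n S) f g @[n --> \oo] --> 0.

Definition map_weakly_mixing : Prop :=
  forall f g, mean_zero f -> in_L2 nu g ->
    map_average f g N @[N --> \oo] --> 0.

Definition map_strong_rate (beta : nat -> R) : Prop :=
  forall f g, mean_zero f -> mean_zero g ->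
    exists C : R, \forall n \near \oo, corr nu (iter n S) f g <= C * beta n.

Definition map_weak_rate (beta : nat -> R) : Prop :=
  forall f g, mean_zero f -> mean_zero g ->
    exists C : R, \forall N \near \oo, map_average f g N <= C * beta N.

End MapKoopman.

Section LevelSets.
Context {R : realType} {M : ptopologicalType}.
Variables (mu : probability (borel M) R) (Phi : R -> M -> M).

Local Notation X := (measure_support mu).

Definition C_eigenfunction (w : R) (z : M -> R[i]) : Prop :=
  [/\ {within X, continuous (fun x => complex.Re (z x))},
      {within X, continuous (fun x => complex.Im (z x))} &
      forall t x, X x -> z (Phi t x) = cis (w * t) * z x].

(* A circle-valued [z : X -> S^1] is represented by a total function on [M].
   "Non-constant" is understood in the space of which [z] is an element. *)
Definition nonconstant_koopman_eigenfunction (w : R) (z : M -> R[i]) : Prop :=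
  (forall x, X x -> normc (z x) = 1) /\
  ((C_eigenfunction w z /\ exists x y, [/\ X x, X y & z x <> z y]) \/
   (L2_eigenfunction mu Phi w z /\ ~ ae_constant mu z)).

Definition level_set (z : M -> R[i]) (s : R[i]) : set M :=
  X `&` [set x | z x = s].

(* The disintegration of [mu] over the level sets of [z] (indexed by the points
   of the circle, parametrized by the angle for measurability).  The integral
   is that of [s |-> kappa s A] against the push-forward of [mu] by [z].
   A disintegration alone is determined only up to a null set of values [s],
   so that the measure on the single level set [s = 1], a null set of [X],
   would be arbitrary; the last two clauses select the version for which
   [kappa s] is carried along by the flow for every [s], which pins down
   [kappa 1], and ask that it sits on the level set of [1].  The measures
   [kappa s] are measures on [M], and [L^2(kappa 1)] is the [L^2] space of the
   level set. *)
Definition flow_disintegration (w : R) (z : M -> R[i])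
    (kappa : R[i] -> probability (borel M) R) : Prop :=
  [/\ forall A : set (borel M), measurable A ->
        measurable_fun setT (fun theta : R => kappa (cis theta) A),
      forall A : set (borel M), measurable A ->
        mu A = (\int[mu]_(x in X) kappa (z x) A)%E,
      {ae mu, forall x, kappa (z x) (level_set z (z x)) = 1%E},
      forall (t : R) (s : R[i]) (A : set (borel M)), normc s = 1 ->
        measurable A -> kappa (cis (w * t) * s) A = kappa s (Phi t @^-1` A) &
      kappa 1 (level_set z 1) = 1%E].

End LevelSets.

(* Main.v *)
Require Import Defs.
From HB Require Import structures.
From mathcomp Require Import all_boot all_order all_algebra.
From mathcomp Require Import all_classical all_reals all_analysis.
From mathcomp Require Import measurable_realfun complex.
From mathcomp Require Import ring lra.
Set Implicit Arguments.
Unset Strict Implicit.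
Unset Printing Implicit Defensive.
Import Order.TTheory GRing.Theory Num.Theory.
Import numFieldNormedType.Exports.
Local Open Scope classical_set_scope.
Local Open Scope ring_scope.
Import ComplexField.Normc.

(** The level set is null for [mu], while eigenfunctions of the flow satisfy their equations only
    almost everywhere, so they cannot be restricted to the level set itself. This is why translates
    appear: Fubini in the coordinates (height, base point) supplies a time [s] such that
    [u \o Phi s] is an eigenfunction for the measure on the base.

    The period [2 pi / omega] has the sign of [omega]. The arguments are carried out for the
    positive period [P] and passed to the inverse map at the end: eigenvalues are inverted, and
    correlations exchange their two arguments.

    Part (ii) takes the place of an argument with spectral measures: that a measure without atoms
    has Fourier coefficients tending to 0 in mean becomes a statement about finite Fourier sums over
    roots of unity and the mean ergodic theorem.

    Mixing is tested with one function in [Dperp] and the other arbitrary. The approximation by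
    products therefore happens in the whole of L^2, and a separate argument shows that the part
    depending on the height alone is orthogonal to [Dperp]. *)

(* An eigenfunction [z] of frequency [omega] exhibits the flow as the suspension, with
   constant roof [P = 2 pi / |omega|], of the map [S = Phi P] on the level set [z = 1]: the
   height [tau x] is read off [z x = cis (omega * tau x)], the base point of [x] is
   [Phi (- tau x) x], and the disintegration of [mu] makes height and base point independent.

   (i) If [f o S = cis (a P) f], then [cis (a tau x) f (base x)] is an eigenfunction of the
   flow of frequency [a], and conversely eigenfunctions of the flow restrict to almost every
   translate of the level set. So the eigenvalues of [S] are the [cis (a P)] for [a] in the
   group of frequencies; [omega] has trivial image and, being primitive, is part of a basis.

   (ii) The correlations of an isometry without eigenvectors tend to 0 in mean.

   (iii) For [m = 1] the discrete subspace consists of the functions of the height, and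
   [Dperp] is spanned by the products [1_E (tau x) f (base x)] with [f] of mean zero. For these,
   the correlation at time [n P + r] is a combination of those of [f] under [S^n] and [S^(n+1)].
   As for rates, by Baire category no rate can hold for all pairs of functions unless the space
   is trivial, so that a rate on either side makes all correlations vanish on both. *)

(** * The complex exponential *)

Section Cis.
Context {R : realType}.
Implicit Types (a b : R) (x y : R[i]).

Lemma eq_complexP x y : complex.Re x = complex.Re y ->
  complex.Im x = complex.Im y -> x = y.
Proof. by case: x y => [a b] [c d] /= -> ->. Qed.

Lemma ReD x y : complex.Re (x + y) = complex.Re x + complex.Re y.
Proof. by case: x y => [a b] [c d]. Qed.

Lemma ImD x y : complex.Im (x + y) = complex.Im x + complex.Im y.
Proof. by case: x y => [a b] [c d]. Qed.

Lemma ReN x : complex.Re (- x) = - complex.Re x.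
Proof. by case: x. Qed.

Lemma ImN x : complex.Im (- x) = - complex.Im x.
Proof. by case: x. Qed.

Lemma ReM x y : complex.Re (x * y) =
  complex.Re x * complex.Re y - complex.Im x * complex.Im y.
Proof. by case: x y => [a b] [c d]. Qed.

Lemma ImM x y : complex.Im (x * y) =
  complex.Re x * complex.Im y + complex.Im x * complex.Re y.
Proof. by case: x y => [a b] [c d]. Qed.

Lemma ReJ x : complex.Re (x^*)%C = complex.Re x.
Proof. by case: x. Qed.

Lemma ImJ x : complex.Im (x^*)%C = - complex.Im x.
Proof. by case: x. Qed.

Definition ReImE := (ReD, ImD, ReN, ImN, ReM, ImM, ReJ, ImJ).

Lemma Re_sum (I : Type) (s : seq I) (P : pred I) (F : I -> R[i]) :
  complex.Re (\sum_(i <- s | P i) F i) = \sum_(i <- s | P i) complex.Re (F i).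
Proof.
by elim/big_rec2: _ => // i y1 y2 _ <-; rewrite ReD.
Qed.

Lemma ReMn x n : complex.Re (x *+ n) = complex.Re x *+ n.
Proof. by elim: n => // n ih; rewrite !mulrS ReD ih. Qed.

Lemma ReMnat x n : complex.Re (n%:R * x) = n%:R * complex.Re x.
Proof. by rewrite !mulr_natl ReMn. Qed.

Lemma ReZ a x : complex.Re (a%:C%C * x) = a * complex.Re x.
Proof. by rewrite ReM /= mul0r subr0. Qed.

Lemma normc_ge0 x : 0 <= normc x.
Proof. by case: x => a b; rewrite sqrtr_ge0. Qed.

Lemma normc_sqr x : normc x ^+ 2 = complex.Re x ^+ 2 + complex.Im x ^+ 2.
Proof. by case: x => a b /=; rewrite sqr_sqrtr// addr_ge0// sqr_ge0. Qed.

Lemma normcJ x : normc (x^*)%C = normc x.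
Proof. by case: x => a b /=; rewrite sqrrN. Qed.

Lemma normcD x y : normc (x + y) <= normc x + normc y.
Proof. exact: le_normcD. Qed.

Lemma normcN' x : normc (- x) = normc x.
Proof. by case: x => a b /=; rewrite !sqrrN. Qed.

Lemma normcB x y : normc (x - y) <= normc x + normc y.
Proof. by rewrite (le_trans (normcD _ _))// normcN'. Qed.

Lemma normc_Re x : `|complex.Re x| <= normc x.
Proof.
by rewrite -ler_sqr ?nnegrE ?normc_ge0// normc_sqr real_normK ?num_real// lerDl sqr_ge0.
Qed.

Lemma normc_Im x : `|complex.Im x| <= normc x.
Proof.
by rewrite -ler_sqr ?nnegrE ?normc_ge0// normc_sqr real_normK ?num_real// lerDr sqr_ge0.
Qed.

Lemma normc_real a : normc (a%:C)%C = `|a|.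
Proof. by rewrite /= expr0n addr0 sqrtr_sqr. Qed.

Lemma normc_nat n : normc (n%:R : R[i]) = n%:R.
Proof. by rewrite -[n%:R](rmorph_nat (real_complex R)) normc_real normr_nat. Qed.

Lemma mulcJ x : (x * x^*)%C = ((normc x ^+ 2)%:C)%C.
Proof. by rewrite normc_sqr; apply: eq_complexP; rewrite !ReImE/=; lra. Qed.

Lemma cisD a b : cis (a + b) = cis a * cis b.
Proof. by apply: eq_complexP; rewrite !ReImE/= ?cosD ?sinD; lra. Qed.

Lemma cis0 : cis (0 : R) = 1.
Proof. by rewrite /cis cos0 sin0. Qed.

Lemma cisN a : cis (- a) = (cis a)^*%C.
Proof. by rewrite /cis cosN sinN. Qed.

Lemma normc_cis a : normc (cis a) = 1.
Proof. by rewrite /= cos2Dsin2 sqrtr1. Qed.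

Lemma cis_neq0 a : cis a != 0.
Proof.
apply/eqP => h; have := normc_cis a; rewrite h normc0 => /eqP.
by rewrite eq_sym oner_eq0.
Qed.

Lemma cisV a : cis (- a) = (cis a)^-1.
Proof.
apply: (mulfI (cis_neq0 a)); rewrite divff ?cis_neq0// -cisD subrr cis0 //.
Qed.

Lemma cisMn a n : cis (n%:R * a) = cis a ^+ n.
Proof.
by elim: n => [|n ih]; rewrite ?mul0r ?cis0 ?expr0// exprS -ih -natr1 -cisD;
  congr cis; lra.
Qed.

Lemma cisMz a (k : int) : cis (k%:~R * a) = cis a ^ k.
Proof.
case: k => n; first by rewrite -exprnP -cisMn.
by rewrite NegzE -exprnN -cisMn -cisV; congr cis; rewrite rmorphN/= mulNr.
Qed.

Lemma cis2pi : cis (pi *+ 2 : R) = 1.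
Proof. by rewrite /cis cos2pi sin2pi. Qed.

Lemma cis_2piz (k : int) : cis (k%:~R * (pi *+ 2) : R) = 1.
Proof. by rewrite cisMz cis2pi exp1rz. Qed.

(** The half-angle formula [1 - cos a = 2 sin (a / 2) ^ 2] reduces this to positivity of the sine on
    the open interval from 0 to pi. *)
Lemma cis_eq1 a : 0 < a < pi *+ 2 -> cis a != 1.
Proof.
move=> /andP[a0 a2]; apply/eqP => -[h _].
have : 0 < sin (a / 2) by apply: sin_gt0_pi; rewrite divr_gt0//=; lra.
have : cos a = 1 - sin (a / 2) ^+ 2 *+ 2.
  have -> : a = (a / 2) *+ 2 by rewrite -mulr_natr mulfVK.
  rewrite cos_mulr2n -[(a / 2) *+ 2]mulr_natr mulfVK//.
  by have := cos2Dsin2 (a / 2); lra.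
rewrite h => h1 h2; have : 0 < sin (a / 2) ^+ 2 by rewrite exprn_gt0.
lra.
Qed.

(** The mean value theorem is applied to cosine and sine separately, which gives the constant sqrt
    2, rounded up to 2. *)
Lemma cis_lipschitz a b : normc (cis a - cis b) <= 2 * `|a - b|.
Proof.
have lip (f g : R -> R) : (forall t : R, is_derive t (1 : R) f (g t)) ->
    (forall t, `|g t| <= 1) -> `|f a - f b| <= `|a - b|.
  move=> df g1; wlog ab : a b / a < b.
    move=> h; have [|ba|->] := ltgtP a b; first exact: h.
    - by rewrite distrC [leRHS]distrC h.
    - by rewrite !subrr normr0.
  have fc : {within `[a, b], continuous f}.
    apply: continuous_subspaceT => x.
    by apply/differentiable_continuous/derivable1_diffP; have [] := df x.
  have [c _ fE] := MVT ab (fun (t : R) _ => df t) fc.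
  by rewrite distrC [leRHS]distrC fE normrM ler_piMl.
have h1 : `|cos a - cos b| <= `|a - b|.
  by apply: (lip cos (fun t : R => - sin t)) => t; rewrite normrN sin_max.
have h2 : `|sin a - sin b| <= `|a - b|.
  by apply: (lip sin cos) => t; rewrite cos_max.
rewrite -ler_sqr ?nnegrE ?normc_ge0 ?mulr_ge0// normc_sqr /=.
have := lerD (lerXn2r 2 (normr_ge0 _) (normr_ge0 _) h1) (lerXn2r 2 (normr_ge0 _) (normr_ge0 _) h2).
rewrite !real_normK ?num_real// exprMn real_normK ?num_real//.
have := sqr_ge0 (a - b); lra.
Qed.

(** Orthogonality of the characters of the cyclic group of order [Q]. *)
Lemma cis_root_sum (Q m n : nat) : (m < Q)%N -> (n < Q)%N ->
  \sum_(j < Q) (cis (pi *+ 2 * j%:R / Q%:R : R) ^+ m *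
                (cis (pi *+ 2 * j%:R / Q%:R) ^+ n)^*%C) =
  if m == n then Q%:R else 0.
Proof.
have pi2 : (0 : R) < pi *+ 2 by rewrite pmulrn_lgt0// pi_gt0.
have Jsum (F : 'I_Q -> R[i]) : (\sum_j F j)^*%C = \sum_j (F j)^*%C.
  by rewrite (big_morph (@conjc R) (id1 := 0) (op1 := +%R))//; [exact: rmorphD|rewrite conjc0].
wlog nm : m n / (n <= m)%N.
  move=> h mQ nQ; have [nm|mn] := leqP n m; first exact: h.
  rewrite -[LHS]conjcK Jsum; under eq_bigr do rewrite rmorphM/= conjcK mulrC.
  rewrite h// 1?ltnW// eq_sym; case: eqP => _; rewrite ?conjc_nat ?conjc0//.
move=> mQ nQ; have Q0 : (0 < Q)%N by exact: leq_ltn_trans mQ.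
have Q0' : (Q%:R : R) != 0 by rewrite pnatr_eq0 -lt0n.
pose z : R[i] := cis ((m - n)%:R * (pi *+ 2 / Q%:R)).
have E (j : nat) : cis (pi *+ 2 * j%:R / Q%:R : R) ^+ m *
    (cis (pi *+ 2 * j%:R / Q%:R) ^+ n)^*%C = z ^+ j.
  rewrite -!cisMn -cisN -cisD /z natrB//; congr cis; field; exact: Q0'.
under eq_bigr do rewrite E.
case: eqP => [mn|/eqP mn].
  rewrite /z mn subnn mul0r cis0; under eq_bigr do rewrite expr1n.
  by rewrite sumr_const card_ord.
have z1 : z != 1.
  have mn' : (0 < m - n)%N by rewrite subn_gt0 ltn_neqAle eq_sym mn.
  apply: cis_eq1; rewrite mulr_gt0 ?ltr0n ?divr_gt0 ?ltr0n//=.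
  rewrite mulrCA gtr_pMr// ltr_pdivrMr ?ltr0n// mul1r ltr_nat.
  by rewrite (leq_ltn_trans _ mQ)// leq_subr.
(* Multiplied by [z - 1], the geometric sum becomes [z ^+ Q - 1], and [z] is a [Q]-th root of
   unity. *)
apply: (mulfI (_ : z - 1 != 0)); first by rewrite subr_eq0.
rewrite mulr0 -subrX1 /z -!cisMn.
rewrite (_ : Q%:R * _ = (m - n)%:R * (pi *+ 2)); last by field; exact: Q0'.
by rewrite cisMn cis2pi expr1n subrr.
Qed.

End Cis.

Lemma cvg0P {R : realType} (u : nat -> R) :
  u n @[n --> \oo] --> (0 : R) <->
  forall e, 0 < e -> exists N, forall n, (N <= n)%N -> `|u n| <= e.
Proof.
split=> [/cvgrPdist_le h e e0|h].
  have [N _ hN] := h e e0; exists N => n Nn.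
  by have := hN n Nn; rewrite /= sub0r normrN.
apply/cvgrPdist_le => e e0; have [N hN] := h e e0.
by exists N => // n Nn /=; rewrite sub0r normrN hN.
Qed.

(** * Semi-Hilbert spaces and their isometries *)

Section SemiHilbert.
Context {R : realType} {V : lmodType R[i]}.
Implicit Types (H : set V) (ip : V -> V -> R[i]).

Definition hnorm ip (u : V) : R := Num.sqrt (complex.Re (ip u u)).

(* [ip] may be degenerate: square integrable functions are not identified when
   they agree almost everywhere, so [hnorm] is only a seminorm on the set [H]. *)
Record semi_hilbert H ip : Prop := SemiHilbert {
  sh0 : H 0 ;
  shD : forall u v, H u -> H v -> H (u + v) ;
  shZ : forall a u, H u -> H (a *: u) ;
  ipDl : forall u v w, H u -> H v -> H w -> ip (u + v) w = ip u w + ip v w ;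
  ipZl : forall a u w, H u -> H w -> ip (a *: u) w = a * ip u w ;
  ipC : forall u v, H u -> H v -> ip v u = (ip u v)^*%C ;
  Re_ip_ge0 : forall u, H u -> 0 <= complex.Re (ip u u) ;
  sh_complete : forall u_ : nat -> V, (forall n, H (u_ n)) ->
    (forall e : R, 0 < e -> exists N, forall m n, (N <= m)%N -> (N <= n)%N ->
       hnorm ip (u_ m - u_ n) <= e) ->
    exists2 v, H v & forall e : R, 0 < e -> exists N, forall n, (N <= n)%N ->
       hnorm ip (u_ n - v) <= e }.

Record isometry H ip (U : V -> V) : Prop := Isometry {
  isoH : forall u, H u -> H (U u) ;
  isoL : forall a u v, U (a *: u + v) = a *: U u + U v ;
  isoI : forall u v, H u -> H v -> ip (U u) (U v) = ip u v }.

Section Theory.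
Variables (H : set V) (ip : V -> V -> R[i]).
Hypothesis sh : semi_hilbert H ip.
Local Notation hn := (hnorm ip).

Lemma shN u : H u -> H (- u).
Proof. by rewrite -scaleN1r => Hu; apply: (shZ sh). Qed.

Lemma shB u v : H u -> H v -> H (u - v).
Proof. by move=> Hu Hv; apply: (shD sh) => //; apply: shN. Qed.

Lemma sh_sum (I : Type) (s : seq I) (P : pred I) (F : I -> V) :
  (forall i, H (F i)) -> H (\sum_(i <- s | P i) F i).
Proof. by move=> HF; apply: big_ind => [|u v Hu Hv|i _]; [exact: (sh0 sh)|exact: (shD sh)|]. Qed.

Lemma ip0l w : H w -> ip 0 w = 0.
Proof. by move=> Hw; have := ipZl sh 0 (sh0 sh) Hw; rewrite scale0r mul0r. Qed.

Lemma ipNl u w : H u -> H w -> ip (- u) w = - ip u w.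
Proof. by move=> Hu Hw; rewrite -scaleN1r (ipZl sh)// mulN1r. Qed.

Lemma ipDr u v w : H u -> H v -> H w -> ip w (u + v) = ip w u + ip w v.
Proof.
move=> Hu Hv Hw; rewrite (ipC sh) ?(ipDl sh)//; last exact: (shD sh).
by rewrite rmorphD/= -!(ipC sh).
Qed.

Lemma ipZr a u w : H u -> H w -> ip w (a *: u) = a^*%C * ip w u.
Proof.
move=> Hu Hw; rewrite (ipC sh) ?(ipZl sh)//; last exact: (shZ sh).
by rewrite rmorphM/= -(ipC sh).
Qed.

Lemma ipNr u w : H u -> H w -> ip w (- u) = - ip w u.
Proof. by move=> Hu Hw; rewrite -scaleN1r ipZr// rmorphN rmorph1 mulN1r. Qed.

Lemma ip_suml (I : Type) (s : seq I) (P : pred I) (F : I -> V) w :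
  (forall i, H (F i)) -> H w ->
  ip (\sum_(i <- s | P i) F i) w = \sum_(i <- s | P i) ip (F i) w.
Proof.
move=> HF Hw; elim: s => [|i s ih]; first by rewrite !big_nil ip0l.
by rewrite !big_cons; case: ifP => // _; rewrite (ipDl sh) ?ih//; apply: sh_sum.
Qed.

Lemma ip_sumr (I : Type) (s : seq I) (P : pred I) (F : I -> V) w :
  (forall i, H (F i)) -> H w ->
  ip w (\sum_(i <- s | P i) F i) = \sum_(i <- s | P i) ip w (F i).
Proof.
move=> HF Hw; elim: s => [|i s ih].
  by rewrite !big_nil (ipC sh (sh0 sh) Hw) ip0l// conjc0.
by rewrite !big_cons; case: ifP => // _; rewrite ipDr ?ih//; apply: sh_sum.
Qed.

Lemma hnorm_ge0 u : 0 <= hn u. Proof. exact: sqrtr_ge0. Qed.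

Lemma hnorm_sqr u : H u -> hn u ^+ 2 = complex.Re (ip u u).
Proof. by move=> Hu; rewrite sqr_sqrtr// (Re_ip_ge0 sh). Qed.

Lemma ipE u : H u -> ip u u = ((hn u ^+ 2)%:C)%C.
Proof.
move=> Hu; apply: eq_complexP; rewrite /= ?hnorm_sqr//.
by have := congr1 (@complex.Im R) (ipC sh Hu Hu); rewrite ImJ => h; lra.
Qed.

Lemma hnorm0 : hn 0 = 0.
Proof. by rewrite /hnorm ip0l ?sqrtr0//; exact: (sh0 sh). Qed.

Lemma hnormZ a u : H u -> hn (a *: u) = normc a * hn u.
Proof.
move=> Hu; have Hau : H (a *: u) by exact: (shZ sh).
apply/eqP; rewrite -(eqrXn2 (n := 2)) ?hnorm_ge0 ?mulr_ge0 ?normc_ge0 ?hnorm_ge0//.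
rewrite hnorm_sqr// (ipZl sh)// ipZr// mulrA mulcJ ipE//.
by rewrite exprMn ReM /= !mulr0 subr0.
Qed.

Lemma hnormN u : H u -> hn (- u) = hn u.
Proof. by move=> Hu; rewrite -scaleN1r hnormZ// normcN' normc1 mul1r. Qed.

Lemma hnormBC u v : H u -> H v -> hn (u - v) = hn (v - u).
Proof. by move=> Hu Hv; rewrite -hnormN ?opprB//; apply: shB. Qed.

Lemma hnorm_sqrD u v : H u -> H v ->
  hn (u + v) ^+ 2 = hn u ^+ 2 + hn v ^+ 2 + 2 * complex.Re (ip u v).
Proof.
move=> Hu Hv; have Huv : H (u + v) by exact: (shD sh).
rewrite !hnorm_sqr// (ipDl sh)// !ipDr// !ReD (ipC sh Hu Hv) ReJ; lra.
Qed.

Lemma parallelogram u v : H u -> H v ->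
  hn (u + v) ^+ 2 + hn (u - v) ^+ 2 = 2 * hn u ^+ 2 + 2 * hn v ^+ 2.
Proof.
move=> Hu Hv; have HNv := shN Hv.
by rewrite (hnorm_sqrD Hu Hv) (hnorm_sqrD Hu HNv) hnormN// ipNr// ReN; lra.
Qed.

Lemma cauchy_schwarz u v : H u -> H v -> normc (ip u v) <= hn u * hn v.
Proof.
move=> Hu Hv; set c := ip u v.
(* Expansion of the squared norm of [u - t c v] as a quadratic in the real parameter [t]. *)
have key (t : R) : 0 <= hn u ^+ 2 + t ^+ 2 * (normc c ^+ 2 * hn v ^+ 2)
     - 2 * t * normc c ^+ 2.
  have : 0 <= hn (u + (- (t%:C)%C * c) *: v) ^+ 2 by rewrite sqr_ge0.
  have Hcv : H ((- (t%:C)%C * c) *: v) by exact: (shZ sh).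
  rewrite hnorm_sqrD// hnormZ// ipZr// normcM normcN' normc_real exprMn.
  rewrite exprMn real_normK ?num_real// -/c.
  have -> : complex.Re ((- (t%:C)%C * c)^*%C * c) = - t * normc c ^+ 2.
    by rewrite normc_sqr !ReImE/=; ring.
  lra.
have [c0|c0] := eqVneq (normc c) 0.
  by rewrite c0 mulr_ge0// hnorm_ge0.
have c2 : 0 < normc c ^+ 2 by rewrite exprn_gt0// lt_def c0 normc_ge0.
rewrite -ler_sqr ?nnegrE ?normc_ge0 ?mulr_ge0 ?hnorm_ge0// exprMn.
have [v0|v0] := eqVneq (hn v) 0.
  (* As [hn] is only a seminorm, [hn v = 0] does not give [c = 0] at once. The quadratic is then
     affine in [t], and this [t] makes it equal to -1. *)
  have := key ((hn u ^+ 2 + 1) / (2 * normc c ^+ 2)).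
  rewrite v0 expr0n/= !mulr0 addr0.
  have -> : 2 * ((hn u ^+ 2 + 1) / (2 * normc c ^+ 2)) * normc c ^+ 2 = hn u ^+ 2 + 1.
    by field; exact: c0.
  lra.
have v2 : 0 < hn v ^+ 2 by rewrite exprn_gt0// lt_def v0 hnorm_ge0.
have := key (hn v ^+ 2)^-1.
have -> : ((hn v ^+ 2)^-1) ^+ 2 * (normc c ^+ 2 * hn v ^+ 2) = normc c ^+ 2 / hn v ^+ 2.
  by field; exact: v0.
have -> : 2 * (hn v ^+ 2)^-1 * normc c ^+ 2 = 2 * (normc c ^+ 2 / hn v ^+ 2).
  by field; exact: v0.
move=> h; have : normc c ^+ 2 / hn v ^+ 2 <= hn u ^+ 2 by lra.
by rewrite ler_pdivrMr.
Qed.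

Lemma ler_hnormD u v : H u -> H v -> hn (u + v) <= hn u + hn v.
Proof.
move=> Hu Hv.
rewrite -ler_sqr ?nnegrE ?addr_ge0 ?hnorm_ge0// hnorm_sqrD//.
have := le_trans (normc_Re _) (cauchy_schwarz Hu Hv).
move/ler_normlP => [_ h]; nra.
Qed.

Lemma ler_hnormB u v : H u -> H v -> hn (u - v) <= hn u + hn v.
Proof. by move=> Hu Hv; rewrite (le_trans (ler_hnormD Hu (shN Hv)))// hnormN. Qed.

Lemma hnorm_dist u v : H u -> H v -> hn u - hn v <= hn (u - v).
Proof.
move=> Hu Hv; have := ler_hnormD (shB Hu Hv) Hv.
by rewrite subrK; lra.
Qed.

Lemma hnorm_sum (I : Type) (s : seq I) (P : pred I) (F : I -> V) :
  (forall i, H (F i)) ->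
  hn (\sum_(i <- s | P i) F i) <= \sum_(i <- s | P i) hn (F i).
Proof.
move=> HF; elim: s => [|i s ih]; first by rewrite !big_nil hnorm0.
rewrite !big_cons; case: ifP => // _.
by rewrite (le_trans (ler_hnormD (HF i) (sh_sum _ _ HF)))// lerD2l.
Qed.

End Theory.

Section IsometryTheory.
Variables (H : set V) (ip : V -> V -> R[i]) (U : V -> V).
Hypotheses (sh : semi_hilbert H ip) (iU : isometry H ip U).
Local Notation hn := (hnorm ip).

Lemma isoD u v : U (u + v) = U u + U v.
Proof. by rewrite -[u in LHS]scale1r (isoL iU) scale1r. Qed.

Lemma iso0 : U 0 = 0.
Proof. by by apply: (addrI (U 0)); rewrite -isoD !addr0. Qed.

Lemma isoZ a u : U (a *: u) = a *: U u.
Proof. by rewrite -[a *: u]addr0 (isoL iU) iso0 addr0. Qed.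

Lemma isoB u v : U (u - v) = U u - U v.
Proof. by rewrite isoD -scaleN1r isoZ scaleN1r. Qed.

Lemma iso_sum (I : Type) (s : seq I) (P : pred I) (F : I -> V) :
  U (\sum_(i <- s | P i) F i) = \sum_(i <- s | P i) U (F i).
Proof. exact: (big_morph U isoD iso0). Qed.

Lemma hnorm_iso u : H u -> hn (U u) = hn u.
Proof. by move=> Hu; rewrite /hnorm (isoI iU). Qed.

Lemma iso_iter n : isometry H ip (iter n U).
Proof.
elim: n => [|n [h1 h2 h3]]; first by split.
split=> [u Hu|a u v|u v Hu Hv] /=; first exact/(isoH iU)/h1.
  by rewrite h2 (isoL iU).
by rewrite (isoI iU) ?h3//; apply: h1.
Qed.

Lemma iso_scale (c : R[i]) : normc c = 1 -> isometry H ip (fun u => c *: U u).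
Proof.
move=> c1; split=> [u Hu|a u v|u v Hu Hv].
- exact/(shZ sh)/(isoH iU).
- by rewrite (isoL iU) scalerDr !scalerA mulrC.
- have Hn w : H w -> H (U w) by exact: (isoH iU).
  have HZ w : H w -> H (c *: U w) by move=> /Hn; exact: (shZ sh).
  rewrite (ipZl sh) ?(ipZr sh) ?(isoI iU)//; try exact: Hn.
  - by rewrite mulrA mulcJ c1 expr1n mul1r.
  - exact: HZ.
Qed.

Lemma iter_scale (c : R[i]) n u :
  iter n (fun u => c *: U u) u = c ^+ n *: iter n U u.
Proof.
elim: n => [|n ih]; first by rewrite scale1r.
by rewrite !iterS ih isoZ scalerA exprS.
Qed.

End IsometryTheory.
End SemiHilbert.

(** * Weak mixing of isometries without eigenvectors *)

Section Twist.
Context {R : realType} {V : lmodType R[i]}.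
Variables (H : set V) (ip : V -> V -> R[i]) (U : V -> V).
Hypotheses (sh : semi_hilbert H ip) (iU : isometry H ip U).
Local Notation hn := (hnorm ip).

(** Two readings are used: the Fourier sum of the orbit of [f] at frequency [theta], and the partial
    sum of the orbit of [f] under the isometry [cis (- theta) U]. *)
Definition twist (theta : R) N (f : V) : V :=
  \sum_(n < N) cis (- theta) ^+ n *: iter n U f.

Variables (f : V) (Hf : H f).

Local Notation a := (fun n k : nat => ip (iter n U f) (iter k U f)).
Local Notation root Q j := (pi *+ 2 * j%:R / Q%:R : R).

Let HU n : H (iter n U f). Proof. exact: (isoH (iso_iter iU n)). Qed.

Let HZ c n : H (c *: iter n U f). Proof. exact: (shZ sh). Qed.

Lemma twist_in theta N : H (twist theta N f).
Proof. by apply: (sh_sum sh). Qed.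

Lemma twist_ip theta N : ip (twist theta N f) (twist theta N f) =
  \sum_(n < N) \sum_(k < N) cis theta ^+ k * (cis theta ^+ n)^*%C * a n k.
Proof.
rewrite (ip_suml sh) //; last exact: twist_in.
apply: eq_bigr => n _; rewrite (ip_sumr sh) //.
apply: eq_bigr => k _; rewrite (ipZl sh) // (ipZr sh) //.
by rewrite cisN -!rmorphXn/= conjcK mulrA [X in X * _]mulrC.
Qed.

Lemma corr_shift j n k : a (n + j)%N (k + j)%N = a n k.
Proof. by rewrite ![(_ + j)%N]addnC !iterD (isoI (iso_iter iU j)). Qed.

(** By [corr_shift], [a n k] depends only on [n - k]. The hypothesis says that [n' - k'] is the
    opposite difference, and exchanging the arguments of [ip] conjugates. *)
Lemma corr_conj n k n' k' : (k + k' = n + n')%N -> a n' k' = (a n k)^*%C.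
Proof.
wlog nk : n k n' k' / (n <= k)%N.
  move=> h e; have [nk|kn] := leqP n k; first exact: h.
  by rewrite (ipC sh (HU k') (HU n')) (h k n k' n') ?(ltnW kn)// -(ipC sh).
move=> e; rewrite -(subnK nk).
have -> : (n' = (k - n) + k')%N.
  by apply/eqP; rewrite -(eqn_add2l n) -e addnA subnKC.
have := corr_shift k' (k - n) 0; have := corr_shift n 0 (k - n).
by rewrite !add0n => -> ->; rewrite -(ipC sh)//; exact: (HU 0).
Qed.

(** Summation over the [Q]-th roots of unity kills the off-diagonal terms, since exponents below
    [N <= Q] are distinct modulo [Q]. *)
Lemma twist_parseval Q N : (N <= Q)%N ->
  \sum_(j < Q) hn (twist (root Q j) N f) ^+ 2 = Q%:R * N%:R * hn f ^+ 2.
Proof.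
move=> NQ; under eq_bigr do rewrite (hnorm_sqr sh (twist_in _ _)).
rewrite -Re_sum; under eq_bigr do rewrite twist_ip.
rewrite exchange_big/=.
under eq_bigr => n _.
  rewrite exchange_big/=.
  under eq_bigr => k _.
    rewrite -mulr_suml.
    have -> : \sum_(j < Q) cis (root Q j) ^+ k * ((cis (root Q j) ^+ n)^*)%C =
       if (k : nat) == n then Q%:R else 0 :> R[i].
      by apply: cis_root_sum; exact: leq_trans (ltn_ord _) NQ.
    over.
  rewrite (bigD1 n)//= eqxx big1 ?addr0; last first.
    by move=> k kn; rewrite (_ : (k : nat) == n = false) ?mul0r//; exact/negbTE.
  have -> : a n n = a 0%N 0%N by rewrite -(corr_shift n 0 0).
  over.
rewrite sumr_const card_ord /= (ipE sh)// -mulr_natl.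
by rewrite ReMn mulr1 ReMnat -mulr_natl /=; ring.
Qed.

(** In the expanded product only the quadruples with [k + k' = n + n'] survive, all exponents being
    below [3 * N]. On those [corr_conj] turns [a n k * a n' k'] into a squared modulus. The second
    sum has length [2 * N] so that each pair [(n, k)] is counted at least [N] times. *)
Lemma twist_fourth Q N : (3 * N <= Q)%N ->
  Q%:R * N%:R * \sum_(n < N) \sum_(k < N) normc (a n k) ^+ 2 <=
  \sum_(j < Q) hn (twist (root Q j) N f) ^+ 2 * hn (twist (root Q j) (2 * N) f) ^+ 2.
Proof.
move=> NQ.
have QN n k : (n < N)%N -> (k < 2 * N)%N -> (n + k < Q)%N.
  by move=> nN kN; rewrite (leq_trans _ NQ)// -addSn mulSn leq_add// ltnW.
have -> : \sum_(j < Q) hn (twist (root Q j) N f) ^+ 2 *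
    hn (twist (root Q j) (2 * N) f) ^+ 2 =
  \sum_(n < N) \sum_(k < N) \sum_(n' < 2 * N) \sum_(k' < 2 * N)
    (if (k + k' == n + n')%N then Q%:R * normc (a n k) ^+ 2 else 0).
  transitivity (complex.Re (\sum_(j < Q)
     ip (twist (root Q j) N f) (twist (root Q j) N f) *
     ip (twist (root Q j) (2 * N) f) (twist (root Q j) (2 * N) f))).
    rewrite Re_sum; apply: eq_bigr => j _.
    by rewrite !(ipE sh) ?ReZ//; exact: twist_in.
  under eq_bigr do rewrite !twist_ip big_distrl/=.
  rewrite exchange_big Re_sum /=; apply: eq_bigr => n _.
  under eq_bigr do rewrite big_distrl/=.
  rewrite exchange_big Re_sum /=; apply: eq_bigr => k _.
  under eq_bigr do rewrite big_distrr/=.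
  rewrite exchange_big Re_sum /=; apply: eq_bigr => n' _.
  under eq_bigr do rewrite big_distrr/=.
  rewrite exchange_big Re_sum /=; apply: eq_bigr => k' _.
  transitivity (complex.Re ((\sum_(j < Q) cis (root Q j) ^+ (k + k')%N *
      (cis (root Q j) ^+ (n + n')%N)^*%C) * (a n k * a n' k'))).
    rewrite mulr_suml; congr complex.Re; apply: eq_bigr => j _.
    by rewrite !exprD rmorphM/=; ring.
  rewrite cis_root_sum ?QN//; case: eqP => [e|_]; last by rewrite mul0r.
  by rewrite (corr_conj e) mulcJ ReMnat.
rewrite mulr_sumr; apply: ler_sum => n _; rewrite mulr_sumr; apply: ler_sum => k _.
rewrite pair_big/= -big_mkcond/= sumr_const -[leRHS]mulr_natl.
rewrite [leLHS](_ : _ = N%:R * (Q%:R * normc (a n k) ^+ 2)); last by ring.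
have x0 : 0 <= Q%:R * normc (a n k) ^+ 2 by rewrite mulr_ge0// exprn_ge0// normc_ge0.
rewrite ler_wpM2r// ler_nat.
have kN (j i : 'I_N) : (i + j < 2 * N)%N by rewrite mul2n -addnn -addSn leq_add// ltnW.
(* The solutions [n' = j + k], [k' = j + n], one for each [j < N]. *)
pose h (j : 'I_N) := (Ordinal (kN j k), Ordinal (kN j n)).
have hi : injective h by move=> i j [/addnI/ord_inj].
rewrite -[N in (N <= _)%N]card_ord -(card_codom hi); apply: subset_leq_card.
apply/fintype.subsetP => p /codomP[j ->]; rewrite unfold_in /=.
by apply/eqnP; rewrite addnCA.
Qed.

(** Duality: the sum on the left is the inner product with [g] of the combination [h] of the [U^n f]
    whose coefficients are the conjugate correlations, and the norm of [h] is controlled by the Gram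
    matrix of the [U^n f]. *)
Lemma corr_sqr_sum g N : H g ->
  (\sum_(n < N) normc (ip (iter n U f) g) ^+ 2) ^+ 2 <=
  hn g ^+ 4 * \sum_(n < N) \sum_(k < N) normc (a n k) ^+ 2.
Proof.
move=> Hg; set S := \sum_(n < N) normc (ip _ g) ^+ 2.
set A := \sum_(n < N) _.
pose c n := ip (iter n U f) g.
pose h := \sum_(n < N) (c n)^*%C *: iter n U f.
have Hh : H h by apply: (sh_sum sh).
have S0 : 0 <= S by apply: sumr_ge0 => n _; rewrite sqr_ge0.
have A0 : 0 <= A by apply: sumr_ge0 => n _; apply: sumr_ge0 => k _; rewrite sqr_ge0.
have hg : complex.Re (ip h g) = S.
  rewrite (ip_suml sh)// Re_sum; apply: eq_bigr => n _.
  by rewrite (ipZl sh)// mulrC -/(c n) mulcJ.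
have h1 : S <= hn h * hn g.
  by rewrite -hg (le_trans (ler_norm _))// (le_trans (normc_Re _))// (cauchy_schwarz sh).
(* Cauchy-Schwarz for the double sum in additive form. The choice [t = 1 / hn g ^ 2] made below lets
   the term in [S ^ 2] be absorbed on the left. *)
have h2 (t : R) : 0 < t -> hn h ^+ 2 <= (t * S ^+ 2 + A / t) / 2.
  move=> t0; rewrite (hnorm_sqr sh)// (ip_suml sh)// Re_sum.
  have -> : t * S ^+ 2 + A / t = \sum_(n < N) \sum_(k < N)
     (t * (normc (c n) ^+ 2 * normc (c k) ^+ 2) + normc (a n k) ^+ 2 / t).
    rewrite expr2 [X in t * X]big_distrlr/= mulr_sumr mulr_suml -big_split/=.
    by apply: eq_bigr => n _; rewrite mulr_sumr mulr_suml -big_split/=.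
  rewrite mulr_suml; apply: ler_sum => n _.
  rewrite (ip_sumr sh)// Re_sum mulr_suml; apply: ler_sum => k _.
  rewrite (ipZl sh)// (ipZr sh)// conjcK.
  apply: (le_trans (ler_norm _)); apply: (le_trans (normc_Re _)).
  rewrite !normcM normcJ.
  set x := normc (c n); set y := normc (c k); set z := normc _.
  rewrite ler_pdivlMr//.
  have -> : t * (x ^+ 2 * y ^+ 2) + z ^+ 2 / t =
     x * (y * z) * 2 + t * (x * y - z / t) ^+ 2 by field; rewrite gt_eqF.
  by rewrite lerDl mulr_ge0 ?sqr_ge0// ltW.
have [g0|g0] := eqVneq (hn g) 0.
  by move: h1; rewrite g0 mulr0 => h1; rewrite (_ : S = 0) ?expr0n ?mul0r//; lra.
have G0 : 0 < hn g ^+ 2 by rewrite exprn_gt0// lt_def g0 hnorm_ge0.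
have := h2 (hn g ^+ 2)^-1; rewrite invr_gt0 => /(_ G0); rewrite invrK.
have : S ^+ 2 <= hn h ^+ 2 * hn g ^+ 2.
  by rewrite -exprMn ler_sqr// nnegrE// mulr_ge0// hnorm_ge0.
set G := hn g ^+ 2 in G0 *; move=> h3 h4.
rewrite (_ : 4 = 2 * 2)%N// exprM -/G.
have : S ^+ 2 <= (G^-1 * S ^+ 2 + A * G) / 2 * G.
  by rewrite (le_trans h3)// ler_wpM2r// ltW.
rewrite (_ : (G^-1 * S ^+ 2 + A * G) / 2 * G = (S ^+ 2 + A * G ^+ 2) / 2); last first.
  by field; rewrite gt_eqF.
by rewrite mulrC; lra.
Qed.

(** In the fourth moment the factor of length [2 * N] is bounded by [M], and what is left is the
    Parseval sum of the other factor. *)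
Lemma corr_twist g N M : H g ->
  (forall theta, 0 <= theta <= pi *+ 2 -> hn (twist theta (2 * N) f) ^+ 2 <= M) ->
  (\sum_(n < N) normc (ip (iter n U f) g) ^+ 2) ^+ 2 <= hn g ^+ 4 * (M * hn f ^+ 2).
Proof.
move=> Hg hM; have [->|N0] := posnP N.
  rewrite big_ord0 expr0n/= mulr_ge0 ?exprn_ge0 ?hnorm_ge0// mulr_ge0 ?sqr_ge0//.
  by rewrite (le_trans _ (hM 0 _)) ?sqr_ge0// lexx mulrn_wge0// pi_ge0.
rewrite (le_trans (corr_sqr_sum _ Hg))// ler_wpM2l ?exprn_ge0 ?hnorm_ge0//.
have Q0 : (0 < 3 * N)%N by rewrite muln_gt0.
rewrite -(ler_pM2l (_ : 0 < (3 * N)%:R * N%:R :> R)); last by rewrite mulr_gt0 ?ltr0n.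
rewrite (le_trans (twist_fourth (leqnn _)))//.
apply: (@le_trans _ _ (\sum_(j < 3 * N) hn (twist (root (3 * N) j) N f) ^+ 2 * M)).
  apply: ler_sum => j _; rewrite ler_wpM2l ?sqr_ge0//; apply: hM.
  have pi2 : 0 <= pi *+ 2 :> R by rewrite mulrn_wge0// pi_ge0.
  apply/andP; split; first by rewrite divr_ge0// mulr_ge0.
  by rewrite ler_pdivrMr ?ltr0n// ler_wpM2l// ler_nat ltnW.
rewrite -mulr_suml twist_parseval; last by rewrite leq_pmull.
by rewrite [leLHS](_ : _ = (3 * N)%:R * N%:R * (M * hn f ^+ 2))//; ring.
Qed.

End Twist.

(** * The mean ergodic theorem along dyadic times *)

Section MeanErgodic.
Context {R : realType} {V : lmodType R[i]}.
Variables (H : set V) (ip : V -> V -> R[i]).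
Hypothesis sh : semi_hilbert H ip.
Local Notation hn := (hnorm ip).

Definition psum (W : V -> V) N (u : V) := \sum_(n < N) iter n W u.

Section Psum.
Variable W : V -> V.
Hypothesis iW : isometry H ip W.

Let HW n u : H u -> H (iter n W u). Proof. exact: (isoH (iso_iter iW n)). Qed.

Lemma psum_in N u : H u -> H (psum W N u).
Proof. by move=> Hu; apply: (sh_sum sh) => n; exact: HW. Qed.

Lemma psumD N u v : psum W N (u + v) = psum W N u + psum W N v.
Proof. by rewrite /psum -big_split; apply: eq_bigr => n _; exact: (isoD (iso_iter iW n)). Qed.

Lemma psumZ N a u : psum W N (a *: u) = a *: psum W N u.
Proof. by rewrite /psum scaler_sumr; apply: eq_bigr => n _; exact: (isoZ (iso_iter iW n)). Qed.

Lemma psumB N u v : psum W N (u - v) = psum W N u - psum W N v.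
Proof. by rewrite psumD -scaleN1r psumZ scaleN1r. Qed.

Lemma psum_iso N u : psum W N (W u) = psum W N u + (iter N W u - u).
Proof.
rewrite /psum; elim: N => [|N ih]; first by rewrite !big_ord0 /= subrr addr0.
rewrite !big_ord_recr /= ih -iterSr iterS -!addrA.
by congr (_ + _); congr (_ + _); rewrite addrC.
Qed.

Lemma hnorm_psum N u : H u -> hn (psum W N u) <= N%:R * hn u.
Proof.
move=> Hu; apply: le_trans (hnorm_sum sh _ _ _) _; first by move=> i; exact: HW.
rewrite (eq_bigr (fun=> hn u)) => [|n _]; last by rewrite (hnorm_iso (iso_iter iW n)).
by rewrite sumr_const card_ord mulr_natl.
Qed.

(** The second half of the sum is the image of the first under an isometry. Hence the norms of the
    dyadic means decrease, which is the monotonicity used in [twist_uniform]. *)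
Lemma hnorm_psum_double k u : H u ->
  hn (psum W (2 ^ k.+1) u) <= 2 * hn (psum W (2 ^ k) u).
Proof.
move=> Hu; have Hp := psum_in (2 ^ k) Hu.
rewrite expnS mul2n -addnn {1}/psum big_split_ord/=.
have -> : \sum_(i < 2 ^ k) iter (2 ^ k + i) W u = iter (2 ^ k) W (psum W (2 ^ k) u).
  rewrite /psum (iso_sum (iso_iter iW _)); apply: eq_bigr => i _.
  by rewrite iterD.
rewrite (le_trans (ler_hnormD sh _ _))//; first exact: HW.
by rewrite (hnorm_iso (iso_iter iW _))// -/(psum _ _ _); lra.
Qed.

Lemma hnorm_psum_mono k l u : H u -> (k <= l)%N ->
  hn (psum W (2 ^ l) u) / (2 ^ l)%:R <= hn (psum W (2 ^ k) u) / (2 ^ k)%:R.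
Proof.
move=> Hu /subnK <-; elim: (l - k)%N => //= j ih; apply: le_trans ih.
rewrite addSn expnS natrM invfM mulrA ler_wpM2r ?invr_ge0//.
by rewrite ler_pdivrMr// mulrC -expnS hnorm_psum_double.
Qed.

End Psum.

(* The set [K] of vectors with the same asymptotic means as [f] is convex and
   invariant, and its element of least norm is fixed by [W]. *)
Lemma mean_ergodic (W : V -> V) (f : V) : isometry H ip W -> H f ->
  (forall h, H h -> hn (W h - h) = 0 -> hn h = 0) ->
  forall e, 0 < e -> exists k, hn (psum W (2 ^ k) f) <= e * (2 ^ k)%:R.
Proof.
move=> iW Hf noinv e e0; apply/not_existsP => he.
have {}he k : e * (2 ^ k)%:R <= hn (psum W (2 ^ k) f).
  by have /negP := he k; rewrite -ltNge => /ltW.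
have p2 k : (0 : R) < (2 ^ k)%:R by rewrite ltr0n expn_gt0.
pose K v := H v /\ forall d, 0 < d -> exists N, forall k, (N <= k)%N ->
  hn (psum W (2 ^ k) (v - f)) <= d * (2 ^ k)%:R.
have HWv v : H v -> H (W v) by exact: (isoH iW).
have eK v : K v -> e <= hn v.
  move=> [Hv hv]; apply/ler_addgt0Pr => d d0; have [N /(_ N (leqnn _)) h] := hv d d0.
  rewrite -(ler_pM2r (p2 N)) (le_trans (he N))// mulrDl.
  have Hp u : H u -> H (psum W (2 ^ N) u) by exact: psum_in.
  rewrite psumB// in h.
  have := hnorm_dist sh (Hp _ Hf) (Hp _ Hv); rewrite (hnormBC sh (Hp _ Hf) (Hp _ Hv)).
  by have := hnorm_psum iW (2 ^ N) Hv; lra.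
have Kf : K f.
  split=> // d d0; exists 0%N => k _; rewrite subrr.
  by rewrite (le_trans (hnorm_psum iW _ (sh0 sh)))// (hnorm0 sh)// mulr0 mulr_ge0 ?ltW.
have KW v : K v -> K (W v).
  move=> [Hv hv]; split=> [|d d0]; first exact: HWv.
  have [N hN] := hv (d / 2) ltac:(by rewrite divr_gt0).
  (* Replacing [v] by [W v] changes the sums by the boundary term [W^(2^k) v - v], of norm at most
     [2 * hn v], which is negligible against [2 ^ k]. *)
  have [N' hN'] : exists N', 2 * hn v <= (d / 2) * (2 ^ N')%:R.
    pose t := 2 * hn v / (d / 2); have t0 : 0 <= t by rewrite divr_ge0 ?mulr_ge0 ?hnorm_ge0 ?divr_ge0 ?ltW.
    exists (Num.truncn t).+1; rewrite -ler_pdivrMl ?divr_gt0// mulrC -/t.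
    rewrite (le_trans (ltW (Num.Theory.truncnS_gt t)))// ler_nat ltnW// ltn_expl//.
  exists (maxn N N') => k; rewrite geq_max => /andP[Nk N'k].
  rewrite addrC psumD// psum_iso// addrA -psumD// [_ + v]addrC.
  have Hd : H (iter (2 ^ k) W v) by exact: (isoH (iso_iter iW _)).
  have Hvf : H (v - f) by exact: (shB sh).
  have Hd' : H (iter (2 ^ k) W v - v) by exact: (shB sh).
  rewrite (le_trans (ler_hnormD sh (psum_in iW _ Hvf) Hd'))//.
  have h1 := hN k Nk; have h2 := ler_hnormB sh Hd Hv.
  rewrite (hnorm_iso (iso_iter iW _))// in h2.
  have h3 : (d / 2) * (2 ^ N')%:R <= (d / 2) * (2 ^ k)%:R.
    by rewrite ler_pM2l ?divr_gt0// ler_nat leq_pexp2l.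
  lra.
have Kmid u v : K u -> K v -> K ((2^-1 : R[i]) *: (u + v)).
  move=> [Hu hu] [Hv hv]; have Huv : H (u + v) by exact: (shD sh).
  split=> [|d d0]; first exact: (shZ sh).
  have [N hN] := hu d d0; have [N' hN'] := hv d d0.
  exists (maxn N N') => k; rewrite geq_max => /andP[/hN h1 /hN' h2].
  have -> : 2^-1 *: (u + v) - f = 2^-1 *: ((u - f) + (v - f)).
    rewrite addrACA -opprD scalerBr; congr (_ - _).
    by rewrite -mulr2n -[f *+ 2]scaler_nat scalerA mulVf ?scale1r ?pnatr_eq0.
  have Hp w : H w -> H (psum W (2 ^ k) (w - f)) by move=> Hw; apply: psum_in => //; exact: (shB sh).
  rewrite psumZ// psumD// (hnormZ sh); last by apply: (shD sh); exact: Hp.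
  have -> : normc (2^-1 : R[i]) = 2^-1 by rewrite normcV normc_nat.
  rewrite mulrC ler_pdivrMr// (le_trans (ler_hnormD sh (Hp _ Hu) (Hp _ Hv)))//; lra.
pose E := [set hn v | v in K].
have E0 : has_inf E.
  by split; [exists (hn f); exists f|exists e => _ [v Kv <-]; exact: eK].
pose d := inf E.
have dK v : K v -> d <= hn v by move=> Kv; apply: ge_inf => //; [case: E0|exists v].
have d0 : e <= d by apply: lb_le_inf; [case: E0|move=> _ [v Kv <-]; exact: eK].
have near_ex eta : 0 < eta -> exists v, K v /\ hn v <= d + eta.
  by move=> eta0; have [_ [v Kv <-] /ltW] := inf_adherent eta0 E0; exists v.
have close eps : 0 < eps -> exists2 eta, 0 < eta & forall u v, K u -> K v ->
    hn u <= d + eta -> hn v <= d + eta -> hn (u - v) <= eps.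
  (* Midpoints stay in [K], so the parallelogram law gives [|u - v|^2 <= 4 (d + eta)^2 - 4 d^2 <=
     eta (8 d + 4)] as soon as [eta <= 1]. *)
  move=> eps0; have dd : 0 < 8 * d + 4 by lra.
  exists (Num.min 1 (eps ^+ 2 / (8 * d + 4))); first by rewrite lt_min ltr01 divr_gt0 ?exprn_gt0.
  set eta := Num.min _ _ => u v Ku Kv hu hv.
  have eta0 : 0 < eta by rewrite lt_min ltr01 divr_gt0 ?exprn_gt0.
  have eta1 : eta <= 1 by rewrite ge_min lexx.
  have etad : eta * (8 * d + 4) <= eps ^+ 2.
    by rewrite -ler_pdivlMr// ge_min lexx orbT.
  have Hu := Ku.1; have Hv := Kv.1.
  rewrite -ler_sqr ?nnegrE ?hnorm_ge0//; last exact: ltW.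
  have := parallelogram sh Hu Hv; have := dK _ (Kmid _ _ Ku Kv).
  rewrite (hnormZ sh); last exact: (shD sh).
  have -> : normc (2^-1 : R[i]) = 2^-1 by rewrite normcV normc_nat.
  move=> h1 h2; have h3 : (2 * d) ^+ 2 <= hn (u + v) ^+ 2.
    by rewrite ler_sqr ?nnegrE ?hnorm_ge0; lra.
  have h4 w : hn w <= d + eta -> hn w ^+ 2 <= (d + eta) ^+ 2.
    by move=> hw; apply: lerXn2r; rewrite ?nnegrE ?hnorm_ge0//; lra.
  have := h4 _ hu; have := h4 _ hv; nra.
have [v_ v_P] := choice (fun n : nat => near_ex n.+1%:R^-1 ltac:(by rewrite invr_gt0)).
have vK n : K (v_ n) := (v_P n).1.
have vd n eta : 0 < eta -> (Num.truncn eta^-1 <= n)%N -> hn (v_ n) <= d + eta.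
  move=> eta0 hn'; rewrite (le_trans (v_P n).2)// lerD2l.
  rewrite -[leRHS]invrK lef_pV2 ?posrE ?invr_gt0// (le_trans (ltW (truncnS_gt _)))//.
  by rewrite ler_nat.
have [h Hh limh] : exists2 v, H v & forall e : R, 0 < e -> exists N, forall n,
    (N <= n)%N -> hn (v_ n - v) <= e.
  apply: (sh_complete sh) => [n|eps eps0]; first exact: (vK n).1.
  have [eta eta0 heta] := close _ eps0.
  by exists (Num.truncn eta^-1) => m n hm hn'; apply: heta => //; exact: vd.
have hd : e <= hn h.
  apply/ler_addgt0Pr => eps eps0; have [N /(_ N (leqnn _)) hN] := limh _ eps0.
  have := hnorm_dist sh (vK N).1 Hh; have := dK _ (vK N); lra.
(* The minimiser [h] has norm at least [e], so being fixed contradicts [noinv]. It is fixed because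
   [W (v_ n)] is again an almost minimal element of [K], hence close to [v_ n]. *)
suff /noinv : hn (W h - h) = 0 by move=> /(_ Hh) h0; move: hd; rewrite h0; lra.
apply/eqP; rewrite eq_le hnorm_ge0 andbT; apply/ler_addgt0Pr => eps eps0; rewrite add0r.
have eps3 : 0 < eps / 3 by rewrite divr_gt0.
have [N hN] := limh _ eps3; have [eta eta0 heta] := close _ eps3.
pose n := maxn N (Num.truncn eta^-1).
have hn1 : hn (v_ n - h) <= eps / 3 by apply: hN; exact: leq_maxl.
have vn := vd n eta eta0 (leq_maxr _ _).
have hn2 : hn (W (v_ n) - v_ n) <= eps / 3.
  by apply: heta => //; [exact: KW|rewrite (hnorm_iso iW)//; exact: (vK n).1].
have Hv := (vK n).1; have HWn := HWv _ Hv; have HWh := HWv _ Hh.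
have -> : W h - h = W (h - v_ n) + ((W (v_ n) - v_ n) + (v_ n - h)).
  by rewrite (isoB iW) (addrA (_ - _) (v_ n)) subrK addrA subrK.
have H1 : H (h - v_ n) by exact: (shB sh).
have H2 : H (W (v_ n) - v_ n) by exact: (shB sh).
have H3 : H (v_ n - h) by exact: (shB sh).
have := ler_hnormD sh (HWv _ H1) (shD sh H2 H3).
have := ler_hnormD sh H2 H3.
rewrite (hnorm_iso iW H1) (hnormBC sh Hh Hv); lra.
Qed.

End MeanErgodic.

(** * Uniformity in the angle and decay of the mean correlations *)

Section WeakMixing.
Context {R : realType} {V : lmodType R[i]}.
Variables (H : set V) (ip : V -> V -> R[i]) (U : V -> V).
Hypotheses (sh : semi_hilbert H ip) (iU : isometry H ip U).
Local Notation hn := (hnorm ip).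

Lemma twist_psum theta N f :
  twist U theta N f = psum (fun u => cis (- theta) *: U u) N f.
Proof. by apply: eq_bigr => n _; rewrite (iter_scale iU). Qed.

Lemma iso_twist theta : isometry H ip (fun u => cis (- theta) *: U u).
Proof. by apply: iso_scale => //; exact: normc_cis. Qed.

Lemma twist_lipschitz theta theta' N f : H f ->
  hn (twist U theta N f - twist U theta' N f) <=
    2 * N%:R ^+ 2 * `|theta - theta'| * hn f.
Proof.
move=> Hf; rewrite /twist -sumrB.
have HU n : H (iter n U f) by exact: (isoH (iso_iter iU n)).
under eq_bigr do rewrite -scalerBl.
apply: le_trans (hnorm_sum sh _ _ _) _; first by move=> n; exact: (shZ sh).
rewrite (_ : 2 * _ ^+ 2 * _ * _ = \sum_(n < N) (2 * N%:R * `|theta - theta'| * hn f)).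
  apply: ler_sum => n _; rewrite (hnormZ sh)// (hnorm_iso (iso_iter iU n))//.
  rewrite ler_wpM2r ?hnorm_ge0// -!cisMn (le_trans (cis_lipschitz _ _))//.
  rewrite -mulrA ler_pM2l// -mulrBr normrM normr_nat ler_pM ?ler_nat 1?ltnW//.
  by rewrite opprK addrC distrC.
by rewrite sumr_const card_ord -[RHS]mulr_natl; ring.
Qed.

(** Bad angles [t K] for every [K] would accumulate at some [l]. The mean at [l] is small for one
    [k]; by the Lipschitz bound it is small near [l] for the same [k], and by monotonicity for all
    later ones. *)
Lemma twist_uniform f : H f ->
  (forall theta, forall e, 0 < e -> exists k,
     hn (twist U theta (2 ^ k) f) <= e * (2 ^ k)%:R) ->
  forall e, 0 < e -> exists K, forall k theta, (K <= k)%N ->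
    0 <= theta <= pi *+ 2 -> hn (twist U theta (2 ^ k) f) <= e * (2 ^ k)%:R.
Proof.
move=> Hf hpt e e0; apply/not_existsP => hK.
have p2 k : (0 : R) < (2 ^ k)%:R by rewrite ltr0n expn_gt0.
have mono k l theta : (k <= l)%N ->
    hn (twist U theta (2 ^ l) f) / (2 ^ l)%:R <= hn (twist U theta (2 ^ k) f) / (2 ^ k)%:R.
  by move=> kl; rewrite !twist_psum; apply: (hnorm_psum_mono sh (iso_twist _)).
have /choice[t tP] : forall K : nat, exists theta : R, 0 <= theta <= pi *+ 2 /\
    e * (2 ^ K)%:R < hn (twist U theta (2 ^ K) f).
  move=> K; have /existsNP[k /existsNP[theta]] := hK K.
  move=> /not_implyP[Kk /not_implyP[th /negP]]; rewrite -ltNge => h.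
  exists theta; split=> //; rewrite -ltr_pdivlMr// (lt_le_trans _ (mono _ _ _ Kk))//.
  by rewrite ltr_pdivlMr.
have [|s s_incr cs] := @bolzano_weierstrass R t.
  exists (pi *+ 2); split; first exact: num_real.
  move=> x hx n _; have [/andP[t0 t1] _] := tP n.
  by rewrite /= ger0_norm// (le_trans t1)// ltW.
have [k hk] := hpt (lim (t (s n) @[n --> \oo])) (e / 2) (divr_gt0 e0 (ltr0Sn _ 1)).
move: cs; set l := lim _ in hk *.
(* Within distance [d] of [l] the Lipschitz bound costs at most the remaining [e / 2 * 2 ^ k]. The
   [+ 1] covers the case [hn f = 0]. *)
pose d := e / 2 * (2 ^ k)%:R / (2 * (2 ^ k)%:R ^+ 2 * (hn f + 1)).
have hf1 : 0 < hn f + 1 by rewrite ltr_wpDl// hnorm_ge0.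
have d0 : 0 < d.
  by rewrite divr_gt0 ?mulr_gt0 ?divr_gt0 ?exprn_gt0.
move=> /cvgrPdist_lt /(_ d d0) [N _ hN].
have := hN (maxn N k) (leq_maxl _ _); rewrite /= -/l; set n := maxn N k.
move=> hn1; have sk : (k <= s n)%N.
  have ge_s i : (i <= s i)%N.
    elim: i => // i ih; apply: leq_ltn_trans ih _.
    by have := s_incr i.+1 i; rewrite !leEnat ltnn => /negbT; rewrite -ltnNge.
  by apply: leq_trans (ge_s n); rewrite leq_maxr.
have [_ h2] := tP (s n).
have h3 := mono k (s n) (t (s n)) sk.
have h4 : e * (2 ^ k)%:R < hn (twist U (t (s n)) (2 ^ k) f).
  by rewrite -ltr_pdivlMr// (lt_le_trans _ h3)// ltr_pdivlMr.
have Ht theta N' : H (twist U theta N' f) by exact: (twist_in sh iU).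
have h5 := hnorm_dist sh (Ht (t (s n)) (2 ^ k)%N) (Ht l (2 ^ k)%N).
have h6 := twist_lipschitz (t (s n)) l (2 ^ k) Hf.
have h7 : 2 * (2 ^ k)%:R ^+ 2 * `|t (s n) - l| * hn f <= e / 2 * (2 ^ k)%:R.
  rewrite distrC; have c0 : 0 < 2 * (2 ^ k)%:R ^+ 2 * (hn f + 1) by rewrite !mulr_gt0// exprn_gt0.
  apply: (@le_trans _ _ (d * (2 * (2 ^ k)%:R ^+ 2 * (hn f + 1)))); last by rewrite /d mulfVK// gt_eqF.
  have A0 : (0 : R) < 2 * (2 ^ k)%:R ^+ 2 by rewrite mulr_gt0// exprn_gt0.
  rewrite -mulrA [leRHS]mulrCA ler_pM2l//.
  by apply: ler_pM; rewrite ?hnorm_ge0// ?lerDl// ltW.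
lra.
Qed.

Definition corr_avg (f g : V) N : R :=
  N%:R^-1 * \sum_(n < N) normc (ip (iter n U f) g).

Lemma corr_avg_ge0 f g N : 0 <= corr_avg f g N.
Proof. by rewrite mulr_ge0 ?invr_ge0// sumr_ge0// => n _; exact: normc_ge0. Qed.

(* If [c n = <U^n f, g>], then Cauchy-Schwarz and Parseval over roots of unity bound
   [(sum_(n < N) |c n|^2)^2] by the largest norm of the sums [sum_n cis (- n theta) U^n f].
   These are [o(N)] by the mean ergodic theorem, and uniformly in [theta] because the dyadic
   means decrease (Dini). *)
Theorem weak_mixing_of_no_eigenvector :
  (forall theta h, H h -> hn (U h - cis theta *: h) = 0 -> hn h = 0) ->
  forall f g, H f -> H g -> corr_avg f g N @[N --> \oo] --> (0 : R).
Proof.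
move=> noeig f g Hf Hg; apply/cvg0P => eta eta0.
have pt theta e : 0 < e -> exists k, hn (twist U theta (2 ^ k) f) <= e * (2 ^ k)%:R.
  move=> e0; have [|k hk] := mean_ergodic sh (iso_twist theta) Hf _ e0.
    move=> h Hh h0; apply: (noeig theta h Hh).
    have HU : H (U h) by exact: (isoH iU).
    have -> : U h - cis theta *: h = cis theta *: (cis (- theta) *: U h - h).
      by rewrite scalerBr scalerA -cisD subrr cis0 scale1r.
    rewrite (hnormZ sh) ?h0 ?mulr0//; apply: (shB sh) => //; exact: (shZ sh).
  by exists k; rewrite twist_psum.
pose G := hn g ^+ 2 * hn f + 1.
have G0 : 0 < G by rewrite ltr_wpDl// mulr_ge0 ?exprn_ge0 ?hnorm_ge0.
(* Chosen so that the first [2 ^ k.+1] squares sum to at most [eta ^ 2 * 2 ^ k], which is at most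
   [eta ^ 2 * N] when [2 ^ k <= N < 2 ^ k.+1]. *)
pose e := eta ^+ 2 / (4 * G).
have e0 : 0 < e by rewrite divr_gt0 ?exprn_gt0 ?mulr_gt0.
have [K hK] := twist_uniform Hf (fun theta => pt theta) e0.
pose c n := normc (ip (iter n U f) g).
have sq k : (K <= k.+1)%N -> \sum_(n < 2 ^ k) c n ^+ 2 <= G * (2 * e * (2 ^ k)%:R).
  move=> Kk; have p2 : (0 : R) <= (2 ^ k)%:R by [].
  have S0 : 0 <= \sum_(n < 2 ^ k) c n ^+ 2 by apply: sumr_ge0 => n _; rewrite sqr_ge0.
  have htw theta : 0 <= theta <= pi *+ 2 ->
      hn (twist U theta (2 * 2 ^ k) f) ^+ 2 <= (e * (2 ^ k.+1)%:R) ^+ 2.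
    move=> th; rewrite -expnS; apply: lerXn2r; rewrite ?nnegrE ?hnorm_ge0 ?hK//.
    by rewrite mulr_ge0// ltW.
  have := corr_twist sh iU Hf Hg htw; rewrite -/c.
  have -> : hn g ^+ 4 * ((e * (2 ^ k.+1)%:R) ^+ 2 * hn f ^+ 2) =
     (hn g ^+ 2 * hn f * (2 * e * (2 ^ k)%:R)) ^+ 2.
    by rewrite expnS natrM; ring.
  move=> h; have X0 : 0 <= 2 * e * (2 ^ k)%:R by apply: mulr_ge0 => //; lra.
  have Y0 : 0 <= hn g ^+ 2 * hn f by rewrite mulr_ge0 ?exprn_ge0 ?hnorm_ge0.
  have h' : \sum_(n < 2 ^ k) c n ^+ 2 <= hn g ^+ 2 * hn f * (2 * e * (2 ^ k)%:R).
    by rewrite -(ler_pXn2r (n := 2)) ?nnegrE// mulr_ge0.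
  by rewrite (le_trans h')// ler_wpM2r// lerDl.
exists (2 ^ K)%N => N KN; rewrite ger0_norm ?corr_avg_ge0//.
have N0 : (0 < N)%N by rewrite (leq_trans _ KN)// expn_gt0.
pose k := trunc_log 2 N; have /andP[k1 k2] := trunc_log_bounds (isT : (1 < 2)%N) N0.
have Kk : (K <= k.+1)%N.
  by rewrite -(leq_exp2l (m := 2))// (leq_trans KN)// ltnW.
have hS : \sum_(n < N) c n ^+ 2 <= eta ^+ 2 * N%:R.
  apply: (@le_trans _ _ (\sum_(n < 2 ^ k.+1) c n ^+ 2)).
    rewrite -!(big_mkord xpredT (fun n => c n ^+ 2)) [leRHS](big_cat_nat _ (n := N))//=.
      by rewrite lerDl sumr_ge0// => i _; rewrite sqr_ge0.
    exact: ltnW.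
  rewrite (le_trans (sq _ _)) 1?ltnW//.
  have -> : G * (2 * e * (2 ^ k.+1)%:R) = eta ^+ 2 * (2 ^ k)%:R.
    by rewrite expnS natrM /e; field; rewrite gt_eqF.
  by rewrite ler_pM2l ?exprn_gt0// ler_nat.
rewrite /corr_avg ler_pdivrMl ?ltr0n//.
(* From mean squares to means by the inequality of arithmetic and geometric means. *)
apply: (@le_trans _ _ (\sum_(n < N) (eta + c n ^+ 2 / eta) / 2)).
  apply: ler_sum => n _; rewrite -/(c n) ler_pdivlMr//.
  have : 0 <= (c n - eta) ^+ 2 / eta by rewrite divr_ge0 ?sqr_ge0 ?ltW.
  have -> : (c n - eta) ^+ 2 / eta = eta + c n ^+ 2 / eta - c n * 2.
    by field; rewrite gt_eqF.
  by rewrite subr_ge0.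
rewrite -mulr_suml big_split/= sumr_const card_ord -mulr_suml -[eta *+ N]mulr_natr.
rewrite ler_pdivrMr//.
have : (\sum_(n < N) c n ^+ 2) / eta <= eta * N%:R.
  by rewrite ler_pdivrMr// mulrAC -expr2.
lra.
Qed.

End WeakMixing.

(** * There is no uniform rate of weak mixing *)

Section NoRate.
Context {R : realType} {V : lmodType R[i]}.
Variables (H : set V) (ip : V -> V -> R[i]) (U : V -> V).
Hypotheses (sh : semi_hilbert H ip) (iU : isometry H ip U).
Local Notation hn := (hnorm ip).
Local Notation q N f := (corr_avg ip U f f N).

Let HU n u : H u -> H (iter n U u). Proof. exact: (isoH (iso_iter iU n)). Qed.

Lemma corr_avg_dist N f g : H f -> H g ->
  q N f <= q N g + hn (f - g) * (hn f + hn g).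
Proof.
move=> Hf Hg; have Hfg : H (f - g) by exact: (shB sh).
have [->|N0] := posnP N.
  by rewrite /corr_avg !big_ord0 !mulr0 add0r mulr_ge0 ?addr_ge0 ?hnorm_ge0.
rewrite -(ler_pM2l (_ : 0 < N%:R :> R)) ?ltr0n// mulrDr !mulrA !divff ?pnatr_eq0 -?lt0n//.
rewrite !mul1r -mulrA mulr_natl -[N in _ *+ N]card_ord -sumr_const -big_split/=.
apply: ler_sum => n _; have In := iso_iter iU n.
have -> : ip (iter n U f) f = ip (iter n U g) g +
    (ip (iter n U (f - g)) f + ip (iter n U g) (f - g)).
  have h1 := HU n Hf; have h2 := HU n Hg; have h3 := shN sh h2; have h4 := shN sh Hg.
  by rewrite (isoB In) (ipDl sh)// (ipNl sh)// (ipDr sh)// (ipNr sh)//; ring.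
rewrite (le_trans (normcD _ _))// lerD2l (le_trans (normcD _ _))// mulrDr lerD//.
  by rewrite (le_trans (cauchy_schwarz sh (HU n Hfg) Hf))// (hnorm_iso In).
by rewrite (le_trans (cauchy_schwarz sh (HU n Hg) Hfg))// (hnorm_iso In)// mulrC.
Qed.

(** Each [<U^n f, f>] is a quadratic function of [f] and obeys the parallelogram identity; the
    triangle inequality does the rest. This moves a bound on a ball around [f] to a ball around
    0. *)
Lemma corr_avg_parallelogram N f e : H f -> H e ->
  2 * q N e <= q N (f + e) + q N (f - e) + 2 * q N f.
Proof.
move=> Hf He; rewrite /corr_avg !mulrA ![2 * _]mulrC -!mulrA -!mulrDr.
rewrite ler_wpM2l ?invr_ge0// !mulr_sumr -!big_split/=; apply: ler_sum => n _.
have In := iso_iter iU n; have HNe := shN sh He.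
have Hn := HU n Hf; have Hne := HU n He; have HnN := shN sh Hne.
have E : 2 * ip (iter n U e) e = ip (iter n U (f + e)) (f + e) +
    ip (iter n U (f - e)) (f - e) - 2 * ip (iter n U f) f.
  rewrite (isoB In) (isoD In).
  have Hfe : H (f + e) by exact: (shD sh).
  have Hfe' : H (f - e) by exact: (shB sh).
  by rewrite !(ipDl sh)// !(ipDr sh)// !(ipNl sh)// !(ipNr sh)//; ring.
have n2 : normc (2 : R[i]) = 2 by rewrite normc_nat.
rewrite -[X in X * normc (ip _ e)]n2 -normcM E.
rewrite (le_trans (normcB _ _))// normcM n2 lerD2r.
exact: normcD.
Qed.

(** By Parseval some Fourier sum [e] of the orbit of [v] has norm at least [sqrt L * hn v]. The
    rotated isometry [W] moves it only by the two end terms of the sum, of norm at most [2 * hn v],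
    so [e] is almost fixed by [W] for [N] steps. *)
Lemma approx_eigenvector v N : H v -> 0 < hn v -> exists2 e, H e &
  0 < hn e /\ forall n, (n < N)%N -> hn e ^+ 2 / 2 <= normc (ip (iter n U e) e).
Proof.
(* With this length [hn e >= 4 N.+1 hn v], so a drift of [2 * hn v] at each of fewer than [N.+1]
   steps stays below [hn e / 2]. *)
move=> Hv v0; pose L := (16 * N.+1 ^ 2)%N.
have L0 : (0 < L)%N by rewrite muln_gt0 expn_gt0.
have [theta hth] : exists theta, L%:R * hn v ^+ 2 <= hn (twist U theta L v) ^+ 2.
  apply/not_existsP => h.
  have := twist_parseval sh iU Hv (leqnn L).
  apply/eqP; rewrite lt_eqF//.
  have -> : L%:R * L%:R * hn v ^+ 2 = \sum_(j < L) (L%:R * hn v ^+ 2).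
    by rewrite sumr_const card_ord -[RHS]mulr_natl mulrA.
  apply: ltr_sum; first by apply/hasP; exists (Ordinal L0); rewrite ?mem_index_enum.
  by move=> j _; rewrite ltNge; apply/negP; exact: h.
pose W u := cis (- theta) *: U u.
have iW : isometry H ip W by exact: iso_twist.
pose e := twist U theta L v; have He : H e by exact: (twist_in sh iU).
have he : 4 * N.+1%:R * hn v <= hn e.
  rewrite -ler_sqr ?nnegrE ?mulr_ge0 ?hnorm_ge0//; apply: le_trans hth.
  by rewrite /L natrM natrX; nra.
have e0 : 0 < hn e.
  by rewrite (lt_le_trans _ he)// !mulr_gt0.
exists e => //; split=> // n nN.
have We : hn (W e - e) <= 2 * hn v.
  have -> : W e - e = iter L W v - v.
    rewrite /e (twist_psum iU) -/W.
    have -> : W (psum W L v) = psum W L (W v).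
      by rewrite /psum (iso_sum iW); apply: eq_bigr => i _; rewrite -iterSr.
    by rewrite psum_iso addrAC subrr add0r.
  rewrite (le_trans (ler_hnormB sh (isoH (iso_iter iW L) Hv) Hv))//.
  by rewrite (hnorm_iso (iso_iter iW L))//; lra.
have HW k : H (iter k W e) by exact: (isoH (iso_iter iW k)).
have Wn : hn (iter n W e - e) <= n%:R * (2 * hn v).
  elim: n {nN} => [|n ih]; first by rewrite subrr (hnorm0 sh) mul0r.
  have -> : iter n.+1 W e - e = (iter n W (W e - e)) + (iter n W e - e).
    by rewrite (isoB (iso_iter iW n)) addrA subrK iterSr.
  have HWe : H (W e - e) by apply: (shB sh) => //; exact: (HW 1%N).
  rewrite (le_trans (ler_hnormD sh (isoH (iso_iter iW n) HWe) _))//; first exact: (shB sh).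
  by rewrite (hnorm_iso (iso_iter iW n))// -natr1; lra.
have -> : normc (ip (iter n U e) e) = normc (ip (iter n W e) e).
  rewrite (iter_scale iU) (ipZl sh)//; last exact: HU.
  by rewrite normcM -cisMn normc_cis mul1r.
have Hd : H (e - iter n W e) by exact: (shB sh).
have h1 : hn e ^+ 2 <= normc (ip (iter n W e) e) + normc (ip (e - iter n W e) e).
  rewrite (hnorm_sqr sh)// (le_trans (ler_norm _))// (le_trans (normc_Re _))//.
  have -> : ip e e = ip (iter n W e) e + ip (e - iter n W e) e.
    by rewrite -(ipDl sh)// addrC subrK.
  exact: normcD.
have h2 := cauchy_schwarz sh Hd He.
rewrite (hnormBC sh He (HW n)) in h2.
have nN1 : n%:R <= N.+1%:R :> R by rewrite ler_nat ltnW// ltnW.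
have h3 : hn (iter n W e - e) <= hn e / 2.
  by rewrite (le_trans Wn)//; have := hnorm_ge0 ip v; nra.
have h4 : hn (iter n W e - e) * hn e <= hn e / 2 * hn e.
  by rewrite ler_wpM2r// ltW.
lra.
Qed.

Lemma corr_avgZ c N f : H f -> q N (c *: f) = normc c ^+ 2 * q N f.
Proof.
move=> Hf; rewrite /corr_avg mulrCA; congr (_ * _); rewrite mulr_sumr.
apply: eq_bigr => n _; have Hn := HU n Hf.
rewrite (isoZ (iso_iter iU n)) (ipZl sh)//; last exact: (shZ sh).
by rewrite (ipZr sh)// !normcM normcJ mulrA expr2.
Qed.

(** Baire's theorem by nested balls: if no ball satisfied a uniform bound, each ball would contain a
    smaller one on which the bound with constant [j] fails, and the common point of the balls would
    violate the bound for every [j]. *)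
Lemma baire_corr_avg (b : nat -> R) : (forall n, 0 <= b n) ->
  (forall f, H f -> exists j : nat, forall N, (j <= N)%N -> q N f <= j%:R * b N) ->
  exists f r j, [/\ H f, 0 < r & forall g, H g -> hn (g - f) <= r ->
    forall N, (j <= N)%N -> q N g <= j%:R * b N].
Proof.
move=> b0 hf; apply/not_existsP => hno.
(* The state is (stage, (centre, radius)). The choice function has to be total, so validity of the
   ball is an assumption inside the existential. *)
have step (x : nat * (V * R)) : exists y : V * R, H x.2.1 -> 0 < x.2.2 ->
   [/\ H y.1, 0 < y.2, y.2 <= x.2.2 / 2, hn (y.1 - x.2.1) <= x.2.2 / 2 &
     forall g, H g -> hn (g - y.1) <= y.2 ->
       ~ forall N, (x.1 <= N)%N -> q N g <= x.1%:R * b N].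
  case: x => j [f r] /=.
  have [Hf|nHf] := pselect (H f); last by exists (f, r).
  have [r0|nr0] := pselect (0 < r); last by exists (f, r).
  have [g Hg [hg [N jN hN]]] : exists2 g, H g & hn (g - f) <= r / 2 /\
      exists2 N, (j <= N)%N & j%:R * b N < q N g.
    apply/not_exists2P => h; apply: (hno f); exists (r / 2), j.
    split=> // [|g Hg hg N jN]; first by rewrite divr_gt0.
    rewrite leNgt; apply/negP => hN; have [|] := h g; first by [].
    by apply; split=> //; exists N.
  pose G := 2 * hn g + 1; pose d := q N g - j%:R * b N.
  have G0 : 0 < G by rewrite ltr_wpDl// mulr_ge0 ?hnorm_ge0.
  have d0 : 0 < d by rewrite subr_gt0.
  (* The bound fails at [g] by the margin [d]. On a ball of this radius [q N] moves by at most
     [d / 2], so it fails on the whole ball. *)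
  pose r' := Num.min (r / 2) (Num.min 1 (d / 2 / G)).
  have r'0 : 0 < r' by rewrite !lt_min ltr01 !divr_gt0.
  have r'1 : r' <= 1 by rewrite !ge_min lexx orbT.
  have r'd : r' * G <= d / 2 by rewrite -ler_pdivlMr// !ge_min lexx !orbT.
  exists (g, r') => _ _ /=; split=> //; first by rewrite ge_min lexx.
  move=> h Hh hh /(_ N jN) hq.
  have := corr_avg_dist N Hg Hh; rewrite (hnormBC sh Hg Hh).
  have h1 : hn h <= hn g + r' by have := hnorm_dist sh Hh Hg; lra.
  have h2 : hn (h - g) * (hn g + hn h) <= r' * G.
    by rewrite ler_pM ?hnorm_ge0 ?addr_ge0 ?hnorm_ge0// /G; lra.
  rewrite /d in d0 r'd; lra.
have [S SP] := choice step.
pose s := fix s n := if n is n'.+1 then S (n', s n') else (0 : V, 1 : R).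
have sP n : H (s n).1 /\ 0 < (s n).2.
  elim: n => [|n [h1 h2]]; first by split=> //; exact: (sh0 sh).
  by have [] := SP (n, s n) h1 h2.
have sS n : [/\ (s n.+1).2 <= (s n).2 / 2, hn ((s n.+1).1 - (s n).1) <= (s n).2 / 2 &
     forall g, H g -> hn (g - (s n.+1).1) <= (s n.+1).2 ->
       ~ forall N, (n <= N)%N -> q N g <= n%:R * b N].
  by have [_ _ h3 h4 h5] := SP (n, s n) (sP n).1 (sP n).2.
have Hs n := (sP n).1; have rs n := (sP n).2.
have nest n m : hn ((s (m + n)%N).1 - (s n).1) <= (s n).2 - (s (m + n)%N).2.
  elim: m => [|m ih]; first by rewrite !subrr (hnorm0 sh).
  have [h1 h2 _] := sS (m + n)%N; rewrite addSn.
  have Ha := shB sh (Hs (m + n).+1) (Hs (m + n)%N); have Hb := shB sh (Hs (m + n)%N) (Hs n).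
  have := ler_hnormD sh Ha Hb; rewrite addrA subrK; lra.
have r2 n : (s n).2 <= 2^-1 ^+ n.
  elim: n => [|n ih]; first by rewrite expr0.
  by have [h1 _ _] := sS n; rewrite exprS; lra.
have [||h Hh lim] := sh_complete sh (u_ := fun n => (s n).1); first by [].
  move=> e e0.
  have /cvg0P /(_ (e / 2) (divr_gt0 e0 (ltr0Sn _ 1))) [N hN] :
      (2^-1 : R) ^+ n @[n --> \oo] --> (0 : R).
    by apply: cvg_expr; rewrite ger0_norm ?invr_ge0// invf_lt1// ltr1n.
  have := hN N (leqnn N); rewrite ger0_norm ?exprn_ge0 ?invr_ge0//.
  move=> hN2; exists N => m n Nm Nn.
  have := nest N (m - N)%N; have := nest N (n - N)%N; rewrite !subnK//.
  have Ha := shB sh (Hs m) (Hs N); have Hb := shB sh (Hs N) (Hs n).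
  have := ler_hnormD sh Ha Hb; rewrite addrA subrK (hnormBC sh (Hs N) (Hs n)).
  have := rs m; have := rs n; have := r2 N; lra.
have hin n : hn (h - (s n).1) <= (s n).2.
  apply/ler_addgt0Pr => e e0; have [N hN] := lim e e0.
  have := hN (maxn N n) (leq_maxl _ _); set m := maxn N n => hm.
  have := nest n (m - n)%N; rewrite subnK ?leq_maxr//.
  have Ha := shB sh Hh (Hs m); have Hb := shB sh (Hs m) (Hs n).
  have := ler_hnormD sh Ha Hb; rewrite addrA subrK (hnormBC sh Hh (Hs m)).
  have := rs m; lra.
have [j hj] := hf h Hh.
by have [_ _ /(_ h Hh (hin _))] := sS j; apply.
Qed.

(* By Baire, the bound [C * beta N] holds with the same [C] on a ball, and by the
   parallelogram inequality on a ball around 0; but this contains vectors that are almost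
   eigenvectors for a long time, whose averages stay close to their squared norm. *)
Theorem no_uniform_rate (beta : nat -> R) : beta n @[n --> \oo] --> (0 : R) ->
  (forall f, H f -> exists C, \forall N \near \oo, q N f <= C * beta N) ->
  forall f, H f -> hn f = 0.
Proof.
move=> /cvg0P beta0 hC v Hv; apply/eqP; rewrite eq_le hnorm_ge0 andbT leNgt.
apply/negP => v0.
have [||f [r [j [Hf r0 hfr]]]] := @baire_corr_avg (fun n => `|beta n|); first by [].
  move=> f Hf; have [C [N0 _ hN]] := hC f Hf.
  exists (maxn N0 (Num.truncn `|C|).+1) => N; rewrite geq_max => /andP[/hN h _].
  rewrite (le_trans h)// (le_trans (ler_norm _))// normrM ler_wpM2r//.
  rewrite (le_trans (ltW (Num.Theory.truncnS_gt _)))// ler_nat leq_maxr//.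
have small e N : H e -> hn e <= r -> (j <= N)%N -> q N e <= 2 * j%:R * `|beta N|.
  move=> He er jN; have := corr_avg_parallelogram N Hf He.
  have := hfr f Hf _ N jN; rewrite subrr (hnorm0 sh) => /(_ (ltW r0)).
  have := hfr (f + e) (shD sh Hf He) _ N jN; rewrite addrAC subrr add0r => /(_ er).
  have := hfr (f - e) (shB sh Hf He) _ N jN; rewrite addrAC subrr add0r (hnormN sh)// => /(_ er).
  lra.
(* On the ball of radius [r] around 0 the averages are at most [2 j |beta N|]. Once [|beta N| <= d]
   this is at most [r ^ 2 / 4], whereas an approximate eigenvector scaled to norm [r] has average at
   least [r ^ 2 / 2]. *)
pose d := r ^+ 2 / (8 * (j%:R + 1)).
have d0 : 0 < d by rewrite divr_gt0 ?exprn_gt0// mulr_gt0// ltr_wpDl.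
have [N0 hN0] := beta0 d d0; pose N := (maxn N0 j).+1.
have [e He [e0 hN]] := approx_eigenvector N Hv v0.
pose c : R := r / hn e.
have c0 : 0 < c by rewrite divr_gt0.
have Hce : H ((c%:C)%C *: e) by exact: (shZ sh).
have hce : hn ((c%:C)%C *: e) = r.
  by rewrite (hnormZ sh)// normc_real gtr0_norm// divfK// gt_eqF.
have jN : (j <= N)%N by rewrite leqW// leq_maxr.
have := small _ N Hce _ jN; rewrite hce => /(_ (lexx _)).
rewrite corr_avgZ// normc_real gtr0_norm//.
have qe : hn e ^+ 2 / 2 <= q N e.
  rewrite /corr_avg ler_pdivlMl ?ltr0n//.
  rewrite (_ : N%:R * (hn e ^+ 2 / 2) = \sum_(n < N) (hn e ^+ 2 / 2)); last first.
    by rewrite sumr_const card_ord mulr_natl.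
  by apply: ler_sum => n _; apply: hN.
have h1 : r ^+ 2 / 2 <= c ^+ 2 * q N e.
  have -> : r ^+ 2 / 2 = c ^+ 2 * (hn e ^+ 2 / 2).
    by rewrite /c; field; rewrite gt_eqF.
  by rewrite ler_pM2l ?exprn_gt0.
have h2 : `|beta N| <= d by apply: hN0; rewrite leqW// leq_maxl.
have h3 : 2 * j%:R * `|beta N| <= r ^+ 2 / 4.
  apply: (@le_trans _ _ (2 * (j%:R + 1) * d)).
    by apply: ler_pM => //; rewrite ler_pM2l// lerDl.
  by rewrite /d le_eqVlt; apply/orP; left; apply/eqP; field; rewrite gt_eqF// ltr_wpDl.
have r2 : 0 < r ^+ 2 by rewrite exprn_gt0.
move=> h4; lra.
Qed.

End NoRate.

(** * Square integrable complex functions *)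

Section ComplexMeasurable.
Context {R : realType} {d : measure_display} {T : measurableType d}.
Implicit Types (f g : T -> R[i]).

Definition cmeas f := measurable_fun setT (fun x => complex.Re (f x)) /\
  measurable_fun setT (fun x => complex.Im (f x)).

Lemma cmeas_cst (c : R[i]) : cmeas (fun=> c).
Proof. by split; exact: measurable_cst. Qed.

Lemma cmeas_real (u : T -> R) : measurable_fun setT u -> cmeas (fun x => (u x)%:C%C).
Proof. by move=> mu; split=> //; exact: measurable_cst. Qed.

Lemma cmeasD f g : cmeas f -> cmeas g -> cmeas (fun x => f x + g x).
Proof.
move=> [f1 f2] [g1 g2]; split.
  by under eq_fun do rewrite ReD; exact: measurable_funD.
by under eq_fun do rewrite ImD; exact: measurable_funD.
Qed.

Lemma cmeasM f g : cmeas f -> cmeas g -> cmeas (fun x => f x * g x).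
Proof.
move=> [f1 f2] [g1 g2]; split.
  by under eq_fun do rewrite ReM; apply: measurable_funB; exact: measurable_funM.
by under eq_fun do rewrite ImM; apply: measurable_funD; exact: measurable_funM.
Qed.

Lemma cmeasZ c f : cmeas f -> cmeas (fun x => c * f x).
Proof. by apply: cmeasM; exact: cmeas_cst. Qed.

Lemma cmeasN f : cmeas f -> cmeas (fun x => - f x).
Proof. 
move=> mf; rewrite (_ : (fun x => - f x) = (fun x => -1 * f x)); first exact: cmeasZ.
by apply/funext => x; rewrite mulN1r.
 Qed.

Lemma cmeasB f g : cmeas f -> cmeas g -> cmeas (fun x => f x - g x).
Proof. by move=> mf mg; apply: cmeasD => //; exact: cmeasN. Qed.

Lemma cmeasJ f : cmeas f -> cmeas (fun x => (f x)^*%C).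
Proof.
move=> [f1 f2]; split; first by under eq_fun do rewrite ReJ.
by under eq_fun do rewrite ImJ; exact: measurableT_comp.
Qed.

Lemma measurable_normc f : cmeas f -> measurable_fun setT (fun x => normc (f x)).
Proof.
move=> [f1 f2].
have -> : (fun x => normc (f x)) =
    Num.sqrt \o (fun x => complex.Re (f x) ^+ 2 + complex.Im (f x) ^+ 2).
  by apply/funext => x /=; rewrite -normc_sqr sqrtr_sqr ger0_norm ?normc_ge0.
apply: measurableT_comp; last by apply: measurable_funD; exact: measurable_funX.
by apply: continuous_measurable_fun; exact: sqrt_continuous.
Qed.

Lemma measurable_normc_sqr f : cmeas f -> measurable_fun setT (fun x => normc (f x) ^+ 2).
Proof. by move=> mf; apply: measurable_funX; exact: measurable_normc. Qed.

Lemma cmeas_cis (u : T -> R) : measurable_fun setT u -> cmeas (fun x => cis (u x)).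
Proof.
move=> mu; split; apply: measurableT_comp => //; apply: continuous_measurable_fun.
  exact: continuous_cos.
exact: continuous_sin.
Qed.

End ComplexMeasurable.

Lemma cmeas_comp {R : realType} {d d' : measure_display} {T : measurableType d}
  {T' : measurableType d'} (f : T' -> R[i]) (S : T -> T') :
  measurable_fun setT S -> cmeas f -> cmeas (fun x => f (S x)).
Proof. by move=> mS [f1 f2]; split; [exact: (measurableT_comp f1 mS)|exact: (measurableT_comp f2 mS)]. Qed.

Section ComplexIntegral.
Context {R : realType} {d : measure_display} {T : measurableType d}.
Variable mu : {measure set T -> \bar R}.
Implicit Types (f g : T -> R[i]) (u v : T -> R).

Definition cint f : R[i] :=
  ((\int[mu]_x complex.Re (f x)) +i* (\int[mu]_x complex.Im (f x)))%C.

Definition cintegrable f :=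
  mu.-integrable setT (fun x => (complex.Re (f x))%:E) /\
  mu.-integrable setT (fun x => (complex.Im (f x))%:E).

Lemma integrable_scale r u : mu.-integrable setT (fun x => (u x)%:E) ->
  mu.-integrable setT (fun x => (r * u x)%:E).
Proof. by move=> iu; under eq_fun do rewrite EFinM; exact: integrableZl. Qed.

Lemma integrable_le u v : measurable_fun setT u ->
  mu.-integrable setT (fun x => (v x)%:E) -> (forall x, `|u x| <= v x) ->
  mu.-integrable setT (fun x => (u x)%:E).
Proof.
move=> mu' iv uv; apply: le_integrable iv => //; first exact/measurable_EFinP.
by move=> x _ /=; rewrite lee_fin (le_trans (uv x))// ler_norm.
Qed.

Lemma cintegrable_le f v : cmeas f ->
  mu.-integrable setT (fun x => (v x)%:E) -> (forall x, normc (f x) <= v x) ->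
  cintegrable f.
Proof.
move=> [m1 m2] iv fv; split; apply: integrable_le iv _ => // x.
  exact: le_trans (normc_Re _) (fv x).
exact: le_trans (normc_Im _) (fv x).
Qed.

Lemma cintD f g : cintegrable f -> cintegrable g ->
  cint (fun x => f x + g x) = cint f + cint g.
Proof.
move=> [f1 f2] [g1 g2]; apply: eq_complexP; rewrite ?ReD ?ImD /=.
  by under eq_Rintegral do rewrite ReD; rewrite RintegralD.
by under eq_Rintegral do rewrite ImD; rewrite RintegralD.
Qed.

Lemma cintZ c f : cintegrable f -> cint (fun x => c * f x) = c * cint f.
Proof.
move=> [f1 f2]; apply: eq_complexP; rewrite ?ReM ?ImM /=.
  under eq_Rintegral do rewrite ReM; rewrite RintegralB ?RintegralZl//.
    exact: (integrable_scale _ f1).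
  exact: (integrable_scale _ f2).
under eq_Rintegral do rewrite ImM; rewrite RintegralD ?RintegralZl//.
  exact: (integrable_scale _ f2).
exact: (integrable_scale _ f1).
Qed.

Lemma cintJ f : cintegrable f -> cint (fun x => (f x)^*%C) = (cint f)^*%C.
Proof.
move=> [f1 f2]; apply: eq_complexP; rewrite ?ReJ ?ImJ /=.
  by under eq_Rintegral do rewrite ReJ.
under eq_Rintegral do rewrite ImJ -mulN1r; rewrite RintegralZl//.
by rewrite mulN1r.
Qed.

Lemma innerE f g : inner mu f g = cint (fun x => f x * (g x)^*%C).
Proof. by []. Qed.

Lemma in_L2_cmeas f : in_L2 mu f -> cmeas f.
Proof. by case. Qed.

Lemma in_L2P f : in_L2 mu f <-> cmeas f /\
  mu.-integrable setT (fun x => (normc (f x) ^+ 2)%:E).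
Proof.
split=> [[m1 m2 fi]|[[m1 m2] /integrableP[_ fi]]]; last first.
  split=> //; apply: le_lt_trans fi; rewrite le_eqVlt; apply/orP; left; apply/eqP.
  by apply: eq_integral => x _ /=; rewrite ger0_norm// sqr_ge0.
split; first by split.
apply/integrableP; split; first exact/measurable_EFinP/measurable_normc_sqr.
under eq_integral do rewrite /= ger0_norm ?sqr_ge0//.
exact: fi.
Qed.

Lemma in_L2_le f g (C : R) : cmeas f -> in_L2 mu g ->
  (forall x, normc (f x) <= C * normc (g x)) -> in_L2 mu f.
Proof.
move=> mf /in_L2P[mg ig] fg; apply/in_L2P; split=> //.
apply: (@integrable_le _ (fun x => C ^+ 2 * normc (g x) ^+ 2)).
- exact: measurable_normc_sqr.
- by under eq_fun do rewrite EFinM; exact: integrableZl.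
- move=> x; rewrite ger0_norm ?sqr_ge0// -exprMn lerXn2r ?nnegrE ?normc_ge0//.
  by rewrite (le_trans (normc_ge0 (f x))).
Qed.

Lemma in_L2D f g : in_L2 mu f -> in_L2 mu g -> in_L2 mu (fun x => f x + g x).
Proof.
move=> /in_L2P[mf fi] /in_L2P[mg gi]; apply/in_L2P; split; first exact: cmeasD.
apply: (@integrable_le _ (fun x => 2 * normc (f x) ^+ 2 + 2 * normc (g x) ^+ 2)).
- by apply: measurable_normc_sqr; exact: cmeasD.
- under eq_fun do rewrite EFinD !EFinM; apply: integrableD => //; exact: integrableZl.
- move=> x; rewrite ger0_norm ?sqr_ge0//.
  have := normcD (f x) (g x); have := normc_ge0 (f x + g x).
  by have := sqr_ge0 (normc (f x) - normc (g x)); nra.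
Qed.

Lemma in_L2Z c f : in_L2 mu f -> in_L2 mu (fun x => c * f x).
Proof.
move=> Lf; apply: (@in_L2_le _ f (normc c)) => //.
  by apply: cmeasZ; exact: in_L2_cmeas.
by move=> x; rewrite normcM.
Qed.

Lemma in_L2B f g : in_L2 mu f -> in_L2 mu g -> in_L2 mu (fun x => f x - g x).
Proof.
move=> Lf Lg; rewrite (_ : (fun x => _) = (fun x => f x + -1 * g x)).
  by apply: in_L2D => //; exact: in_L2Z.
by apply/funext => x; rewrite mulN1r.
Qed.

Lemma in_L2_0 : in_L2 mu (fun=> 0).
Proof.
apply/in_L2P; split; first exact: cmeas_cst.
by under eq_fun do rewrite normc0 expr0n/=; exact: integrable0.
Qed.

Lemma in_L2_mul f g (C : R) : cmeas f -> (forall x, normc (f x) <= C) ->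
  in_L2 mu g -> in_L2 mu (fun x => f x * g x).
Proof.
move=> mf fC Lg; apply: (@in_L2_le _ g C) => //.
  by apply: cmeasM => //; exact: in_L2_cmeas.
by move=> x; rewrite normcM ler_wpM2r ?normc_ge0.
Qed.

Lemma cintegrable_inner f g : in_L2 mu f -> in_L2 mu g ->
  cintegrable (fun x => f x * (g x)^*%C).
Proof.
move=> /in_L2P[mf fi] /in_L2P[mg gi].
apply: (@cintegrable_le _ (fun x => normc (f x) ^+ 2 + normc (g x) ^+ 2)).
- by apply: cmeasM => //; exact: cmeasJ.
- by under eq_fun do rewrite EFinD; exact: integrableD.
- move=> x; rewrite normcM normcJ.
  have := sqr_ge0 (normc (f x) - normc (g x)).
  by have := sqr_ge0 (normc (f x) + normc (g x)); nra.
Qed.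

Lemma inner_sqrE f : in_L2 mu f ->
  (\int[mu]_x (normc (f x) ^+ 2)%:E)%E = (hnorm (inner mu) f ^+ 2)%:E.
Proof.
move=> /in_L2P[mf fi].
have E : complex.Re (inner mu f f) = \int[mu]_x normc (f x) ^+ 2.
  by rewrite /inner/=; apply: eq_Rintegral => x _; rewrite mulcJ.
rewrite /hnorm E sqr_sqrtr; last by apply: Rintegral_ge0 => x _; rewrite sqr_ge0.
by rewrite fineK//; exact: integrable_fin_num.
Qed.

Lemma in_L2_lt f (a : R) : cmeas f -> (\int[mu]_x (normc (f x) ^+ 2)%:E <= a%:E)%E ->
  in_L2 mu f.
Proof. by move=> [m1 m2] fa; split=> //; exact: le_lt_trans fa (ltry _). Qed.

Lemma hnorm_leP f (e : R) : in_L2 mu f -> 0 <= e ->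
  (hnorm (inner mu) f <= e) = (\int[mu]_x (normc (f x) ^+ 2)%:E <= (e ^+ 2)%:E)%E.
Proof.
by move=> Lf e0; rewrite inner_sqrE// lee_fin ler_sqr ?nnegrE ?hnorm_ge0.
Qed.

Lemma hnorm_eq0P f : in_L2 mu f ->
  (hnorm (inner mu) f = 0) <-> {ae mu, forall x, f x = 0}.
Proof.
move=> Lf; have mf := in_L2_cmeas Lf.
have mn : measurable_fun setT (fun x => (normc (f x) ^+ 2)%:E).
  exact/measurable_EFinP/measurable_normc_sqr.
have /= E := ae_eq_integral_abs mu measurableT mn.
have E2 : (\int[mu]_x `|(normc (f x) ^+ 2)%:E| = (hnorm (inner mu) f ^+ 2)%:E)%E.
  rewrite -inner_sqrE//; apply: eq_integral => x _.
  by rewrite gee0_abs// lee_fin sqr_ge0.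
rewrite E2 in E; split=> [h0|h0].
  have /E : ((hnorm (inner mu) f ^+ 2)%:E = 0)%E by rewrite h0 expr0n.
  apply: filterS => x /(_ I) [/eqP]; rewrite sqrf_eq0 => /eqP /eq0_normc //.
have /E [] : ae_eq mu setT (fun x => (normc (f x) ^+ 2)%:E) (cst 0%E).
  by apply: filterS h0 => x -> _; rewrite normc0 expr0n.
by move/eqP; rewrite sqrf_eq0 => /eqP.
Qed.

Lemma cint_ae f g : cmeas f -> cmeas g -> {ae mu, forall x, f x = g x} ->
  cint f = cint g.
Proof.
move=> [f1 f2] [g1 g2] fg; apply: eq_complexP => /=; rewrite /Rintegral; congr fine.
  apply: ae_eq_integral => //; try exact/measurable_EFinP.
  by apply: filterS fg => x -> _.
apply: ae_eq_integral => //; try exact/measurable_EFinP.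
by apply: filterS fg => x -> _.
Qed.

Lemma in_L2_ae f g : cmeas g -> {ae mu, forall x, f x = g x} -> in_L2 mu f -> in_L2 mu g.
Proof.
move=> mg fg Lf; have mf := in_L2_cmeas Lf; case: Lf => _ _ fi; case: (mg) => g1 g2.
split=> //; apply: le_lt_trans fi; rewrite le_eqVlt; apply/orP; left; apply/eqP.
apply: ae_eq_integral => //; try exact/measurable_EFinP/measurable_normc_sqr.
by apply: filterS fg => x -> _.
Qed.

Lemma inner_ae f f' g g' : cmeas f -> cmeas f' -> cmeas g -> cmeas g' ->
  {ae mu, forall x, f x = f' x} -> {ae mu, forall x, g x = g' x} ->
  inner mu f g = inner mu f' g'.
Proof.
move=> mf mf' mg mg' ff' gg'; rewrite !innerE; apply: cint_ae.
- by apply: cmeasM => //; exact: cmeasJ.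
- by apply: cmeasM => //; exact: cmeasJ.
- by apply: filterS2 ff' gg' => x -> ->.
Qed.

End ComplexIntegral.

(** * Completeness of L^2 *)

Section L2Complete.
Context {R : realType} {d : measure_display} {T : measurableType d}.
Variable mu : probability T R.
Implicit Types (f g : T -> R[i]).
Local Notation hn := (hnorm (inner mu)).

(** Integrate [|f| <= t / 2 + |f|^2 / (2 t)] against the probability measure. *)
Lemma integral_normc_le f (t : R) : in_L2 mu f -> 0 < t -> hn f <= t ->
  (\int[mu]_x (normc (f x))%:E <= t%:E)%E.
Proof.
move=> Lf t0 ft; have /in_L2P[mf fi] := Lf.
apply: (@le_trans _ _ (\int[mu]_x (t / 2 + (2 * t)^-1 * normc (f x) ^+ 2)%:E)%E).
  apply: ge0_le_integral => //.
  - by move=> x _; rewrite lee_fin normc_ge0.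
  - exact/measurable_EFinP/measurable_normc.
  - apply/measurable_EFinP; apply: measurable_funD; first exact: measurable_cst.
    by apply: measurable_funM; [exact: measurable_cst|exact: measurable_normc_sqr].
  - move=> x _; rewrite lee_fin -subr_ge0.
    have -> : t / 2 + (2 * t)^-1 * normc (f x) ^+ 2 - normc (f x) =
       (2 * t)^-1 * (normc (f x) - t) ^+ 2 by field; rewrite gt_eqF.
    by rewrite mulr_ge0 ?sqr_ge0// invr_ge0 mulr_ge0// ltW.
under eq_integral do rewrite EFinD.
rewrite ge0_integralD//=; last 3 first.
- by move=> x _; rewrite lee_fin divr_ge0// ltW.
- by move=> x _; rewrite lee_fin mulr_ge0 ?sqr_ge0// invr_ge0 mulr_ge0// ltW.
- by apply/measurable_EFinP; apply: measurable_funM; [exact: measurable_cst|exact: measurable_normc_sqr].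
rewrite integral_cst//. rewrite [X in (_ * X)%E]probability_setT mule1.
under eq_integral do rewrite EFinM.
rewrite ge0_integralZl//=; last 3 first.
- exact/measurable_EFinP/measurable_normc_sqr.
- by move=> x _; rewrite lee_fin sqr_ge0.
- by rewrite lee_fin invr_ge0 mulr_ge0// ltW.
rewrite inner_sqrE// -EFinM -EFinD lee_fin.
have -> : t / 2 + (2 * t)^-1 * hn f ^+ 2 = (t ^+ 2 + hn f ^+ 2) / (2 * t) by field; rewrite gt_eqF.
rewrite ler_pdivrMr ?mulr_gt0//.
have : hn f ^+ 2 <= t ^+ 2 by rewrite ler_sqr ?nnegrE ?hnorm_ge0// ltW.
by rewrite expr2; lra.
Qed.

Lemma in_L2_hnorm_fatou (v_ : nat -> T -> R[i]) f (e : R) : 0 <= e -> cmeas f ->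
  (forall n, in_L2 mu (v_ n)) ->
  (forall x, normc (v_ n x) @[n --> \oo] --> normc (f x)) ->
  (exists N, forall n, (N <= n)%N -> hn (v_ n) <= e) ->
  in_L2 mu f /\ hn f <= e.
Proof.
move=> e0 mf Lv vf [N hN].
have key : (\int[mu]_x (normc (f x) ^+ 2)%:E <= (e ^+ 2)%:E)%E.
  have -> : (\int[mu]_x (normc (f x) ^+ 2)%:E =
      \int[mu]_x limn_einf (fun n => (normc (v_ n x) ^+ 2)%:E))%E.
    apply: eq_integral => x _.
    have cv : (normc (v_ n x) ^+ 2)%:E @[n --> \oo] --> (normc (f x) ^+ 2)%:E.
      apply: cvg_EFin; first by near=> n.
      by apply: cvgM; exact: vf.
    by rewrite (is_cvg_limn_einfE (cvgP _ cv)) (cvg_lim _ cv).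
  apply: le_trans (fatou mu measurableT _ _) _.
  - by move=> n; apply/measurable_EFinP/measurable_normc_sqr; exact: in_L2_cmeas.
  - by move=> n x _; rewrite lee_fin sqr_ge0.
  rewrite limn_einf_lim; apply: lime_le; first exact: is_cvg_einfs.
  near=> n; apply: le_trans (ereal_inf_lbound _) _.
    by exists (maxn n N); [rewrite /= leq_maxl|reflexivity].
  by rewrite -hnorm_leP// hN// leq_maxr.
have Lf := in_L2_lt mf key.
by split=> //; rewrite hnorm_leP.
Unshelve. all: by end_near. Qed.

Lemma cvg_of_summable_steps (u : nat -> R) (h : nat -> R) (B : R) :
  (forall k, `|u k.+1 - u k| <= h k) -> (forall n, \sum_(0 <= k < n) h k <= B) ->
  cvgn u.
Proof.
move=> uh hB; have h0 k : 0 <= h k by exact: le_trans (uh k).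
have ch : cvgn (series h).
  apply: nondecreasing_is_cvgn; first by apply/nondecreasing_series => k _ _; exact: h0.
  by exists B => _ [n _ <-]; rewrite /series/=; exact: hB.
have ct : cvgn (series (telescope u)).
  by apply: normed_cvg; apply: series_le_cvg ch => k; [exact: normr_ge0|exact: h0|exact: uh].
have -> : u = (fun n => u 0%N + series (telescope u) n).
  by apply/funext => n; rewrite [LHS]eq_sum_telescope.
by apply: is_cvgD => //; exact: is_cvg_cst.
Qed.

(** The Riesz-Fischer argument: the sum [G] of the moduli of the increments has finite integral, so
    it is finite off a null set, where the sequence converges absolutely. The limit is set to 0 off
    [A] to be measurable on the whole space. *)
Lemma L2_cvg_ae (v_ : nat -> T -> R[i]) : (forall n, in_L2 mu (v_ n)) ->
  (forall k, hn (fun x => v_ k.+1 x - v_ k x) <= 2^-1 ^+ k) ->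
  exists2 f, cmeas f & exists2 A : set T, measurable A /\ mu (~` A) = 0%E &
    (forall x, ~ A x -> f x = 0) /\
    (forall x, A x -> normc (v_ n x - f x) @[n --> \oo] --> (0 : R)).
Proof.
move=> Lv hv; have mv n := in_L2_cmeas (Lv n).
pose h k x := normc (v_ k.+1 x - v_ k x).
have mh k : measurable_fun setT (fun x => (h k x)%:E).
  by apply/measurable_EFinP/measurable_normc; exact: cmeasB.
have h0 k x : (0 <= (h k x)%:E)%E by rewrite lee_fin normc_ge0.
pose G x := (\sum_(0 <= k <oo) (h k x)%:E)%E.
have mG : measurable_fun setT G by apply: ge0_emeasurable_sum.
have iG : (\int[mu]_x G x < +oo)%E.
  rewrite /G integral_nneseries//; apply: (@le_lt_trans _ _ 2%:E); last exact: ltry.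
  apply: lime_le; first by apply: is_cvg_nneseries => k _ _; exact: integral_ge0.
  apply: nearW => n; apply: (@le_trans _ _ (\sum_(0 <= k < n) (2^-1 ^+ k)%:E)%E).
    apply: lee_sum => k _; apply: integral_normc_le; rewrite ?exprn_gt0 ?invr_gt0//.
    exact: in_L2B.
  have E : \sum_(0 <= k < n) (2^-1 : R) ^+ k = 2 - 2 * 2^-1 ^+ n.
    elim: n => [|n ih]; first by rewrite big_geq// expr0; lra.
    by rewrite big_nat_recr//= ih exprS; lra.
  rewrite sumEFin lee_fin E; have : (0 : R) <= 2^-1 ^+ n by rewrite exprn_ge0// invr_ge0.
  lra.
pose A := [set x | G x \is a fin_num].
have mA : measurable A by rewrite -[A]setTI; exact: emeasurable_fin_num.
have G0 x : (0 <= G x)%E by apply: nneseries_ge0.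
have muA : mu (~` A) = 0%E.
  have iG' : mu.-integrable setT G.
    by apply/integrableP; split=> //; under eq_integral do rewrite gee0_abs//.
  have := integrable_ae measurableT iG'.
  move=> [N [mN N0 sub]]; apply/eqP; rewrite eq_le measure_ge0 andbT -N0.
  apply: le_measure; rewrite ?inE//; first exact: measurableC.
  by move=> x nA; apply: sub => /= /(_ I).
have hB x n : A x -> \sum_(0 <= k < n) h k x <= fine (G x).
  move=> Ax; rewrite -lee_fin fineK// -sumEFin.
  exact: (nneseries_lim_ge (u_ := fun k => (h k x)%:E)).
have cRe x : A x -> cvgn (fun n => complex.Re (v_ n x)).
  move=> Ax; apply: (cvg_of_summable_steps (h := h^~ x)) => [k|n]; last exact: hB.
  by rewrite -ReN -ReD; exact: normc_Re.
have cIm x : A x -> cvgn (fun n => complex.Im (v_ n x)).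
  move=> Ax; apply: (cvg_of_summable_steps (h := h^~ x)) => [k|n]; last exact: hB.
  by rewrite -ImN -ImD; exact: normc_Im.
have lim_indic (u : nat -> T -> R) x : (A x -> cvgn (u^~ x)) ->
    \1_A x * u n x @[n --> \oo] --> \1_A x * limn (u^~ x).
  have [Ax|nAx] := pselect (A x).
    by move=> /(_ Ax) cu; apply: cvgM => //; exact: cvg_cst.
  move=> _; rewrite indicE memNset// mul0r.
  by under eq_fun do rewrite mul0r; exact: cvg_cst.
pose f x : R[i] := Complex (\1_A x * limn (fun n => complex.Re (v_ n x)))
  (\1_A x * limn (fun n => complex.Im (v_ n x))).
exists f.
  split; rewrite /f /=.
    apply: (@measurable_fun_cvg _ _ _ _ (fun n x => \1_A x * complex.Re (v_ n x))).
      by move=> n; apply: measurable_funM; [exact: measurable_indic|case: (mv n)].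
    by move=> x _; apply: (lim_indic (fun n x => complex.Re (v_ n x))) => /cRe.
  apply: (@measurable_fun_cvg _ _ _ _ (fun n x => \1_A x * complex.Im (v_ n x))).
    by move=> n; apply: measurable_funM; [exact: measurable_indic|case: (mv n)].
  by move=> x _; apply: (lim_indic (fun n x => complex.Im (v_ n x))) => /cIm.
exists A => //; split=> [x nA|x Ax].
  by rewrite /f indicE memNset// !mul0r.
rewrite /f indicE mem_set// !mul1r; set l : R[i] := Complex _ _.
have c1 : `|complex.Re (v_ n x) - complex.Re l| + `|complex.Im (v_ n x) - complex.Im l|
    @[n --> \oo] --> (0 : R).
  rewrite -[X in _ --> X]addr0; apply: cvgD; rewrite -(normr0 R); apply: cvg_norm.
    by rewrite -(subrr (complex.Re l)); apply: cvgB; [exact: (cRe x Ax)|exact: cvg_cst].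
  by rewrite -(subrr (complex.Im l)); apply: cvgB; [exact: (cIm x Ax)|exact: cvg_cst].
apply: (@squeeze_cvgr _ _ _ _ (fun=> 0) _ _ _ _ _ c1); last exact: cvg_cst.
apply: nearW => n; rewrite normc_ge0 /=.
rewrite -ler_sqr ?nnegrE ?normc_ge0 ?addr_ge0// normc_sqr !ReImE.
have sqD (a b : R) : a ^+ 2 + b ^+ 2 <= (`|a| + `|b|) ^+ 2.
  rewrite sqrrD !real_normK ?num_real//.
  have : 0 <= `|a| * `|b| by rewrite mulr_ge0.
  lra.
exact: sqD.
Qed.

End L2Complete.

Section L2Hilbert.
Context {R : realType} {d : measure_display} {T : measurableType d}.
Variable mu : probability T R.
Implicit Types (f g : T -> R[i]).
Local Notation hn := (hnorm (inner mu)).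

Lemma hnorm_ae f g : cmeas f -> cmeas g -> {ae mu, forall x, f x = g x} -> hn f = hn g.
Proof. by move=> mf mg fg; rewrite /hnorm (inner_ae mf mg mf mg fg fg). Qed.

Lemma ae_of_null (A : set T) : measurable A -> mu (~` A) = 0%E -> {ae mu, forall x, A x}.
Proof. by move=> mA A0; exists (~` A); split=> //; exact: measurableC. Qed.

Lemma cmeas_indic (A : set T) : measurable A -> cmeas (fun x => (\1_A x)%:C%C : R[i]).
Proof. by move=> mA; apply: cmeas_real; exact: measurable_indic. Qed.

Lemma normc_indic (A : set T) x : normc ((\1_A x)%:C%C : R[i]) <= 1.
Proof. by rewrite normc_real indicE; case: (_ \in _); rewrite ?normr1 ?normr0. Qed.

Lemma in_L2_indic (A : set T) f : measurable A -> in_L2 mu f ->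
  in_L2 mu (fun x => (\1_A x)%:C%C * f x).
Proof.
move=> mA; apply: in_L2_mul (cmeas_indic mA) _; exact: normc_indic.
Qed.

Lemma L2_complete (u_ : nat -> T -> R[i]) : (forall n, in_L2 mu (u_ n)) ->
  (forall e : R, 0 < e -> exists N, forall m n, (N <= m)%N -> (N <= n)%N ->
     hn (fun x => u_ m x - u_ n x) <= e) ->
  exists2 v, in_L2 mu v & forall e : R, 0 < e -> exists N, forall n, (N <= n)%N ->
     hn (fun x => u_ n x - v x) <= e.
Proof.
move=> Lu cauchy.
have /choice[N_ NP] : forall k : nat, exists N, forall m n, (N <= m)%N -> (N <= n)%N ->
     hn (fun x => u_ m x - u_ n x) <= 2^-1 ^+ k.
  by move=> k; apply: cauchy; rewrite exprn_gt0// invr_gt0.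
(* Indices increasing in [k] and beyond [N_ k], so that consecutive terms of the subsequence differ
   by at most [2 ^ -k]. *)
pose M k := (\sum_(i < k.+1) N_ i + k)%N.
have NM k : (N_ k <= M k)%N by rewrite /M big_ord_recr -addnA leq_add2l leq_addl || rewrite /M big_ord_recr addnAC leq_addl.
have MS k : (M k <= M k.+1)%N by rewrite /M [in leqRHS]big_ord_recr /= leq_add// leq_addr.
have kM k : (k <= M k)%N by rewrite leq_addl.
have [f mf [A [mA A0] [fA cA]]] : exists2 f, cmeas f & exists2 A : set T,
    measurable A /\ mu (~` A) = 0%E & (forall x, ~ A x -> f x = 0) /\
    (forall x, A x -> normc (u_ (M n) x - f x) @[n --> \oo] --> (0 : R)).
  apply: (L2_cvg_ae (v_ := fun n => u_ (M n))) => k; first exact: Lu.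
  by apply: NP => //; exact: leq_trans (NM k) (MS k).
have key e : 0 < e -> exists N, forall n, (N <= n)%N ->
    in_L2 mu (fun x => u_ n x - f x) /\ hn (fun x => u_ n x - f x) <= e.
  move=> e0; have [N hN] := cauchy e e0; exists N => n Nn.
  have mu_ k := in_L2_cmeas (Lu k).
  (* The Fatou lemma above asks for convergence at every point, hence the indicator of [A]. *)
  apply: (in_L2_hnorm_fatou (v_ := fun k x => u_ n x - (\1_A x)%:C%C * u_ (M k) x)).
  - exact: ltW.
  - exact: cmeasB.
  - by move=> k; apply: in_L2B => //; exact: in_L2_indic.
  - move=> x; have [Ax|nAx] := pselect (A x); last first.
      rewrite fA// indicE memNset//; under eq_fun do rewrite mul0r.
      exact: cvg_cst.
    rewrite indicE mem_set//; under eq_fun do rewrite mul1r.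
    apply/cvgrPdist_le => eps eps0.
    have /cvg0P /(_ eps eps0) [K hK] := cA x Ax.
    exists K => // k /= /hK; rewrite ger0_norm ?normc_ge0// => h.
    rewrite ler_norml; apply/andP; split.
      rewrite lerNl opprB lerBlDr (le_trans _ (lerD h (lexx _)))//.
      have -> : u_ n x - u_ (M k) x = - (u_ (M k) x - f x) + (u_ n x - f x) by ring.
      by rewrite (le_trans (normcD _ _))// normcN'.
    rewrite lerBlDr (le_trans _ (lerD h (lexx _)))//.
    have -> : u_ n x - f x = (u_ (M k) x - f x) + (u_ n x - u_ (M k) x) by ring.
    exact: normcD.
  - exists N => k Nk; rewrite (@hnorm_ae _ (fun x => u_ n x - u_ (M k) x)).
    + by apply: hN => //; exact: leq_trans Nk (kM k).
    + by apply: cmeasB => //; apply: cmeasM => //; exact: cmeas_indic.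
    + exact: cmeasB.
    + by apply: filterS (ae_of_null mA A0) => x Ax; rewrite indicE mem_set// mul1r.
exists f; last by move=> e /key[N hN]; exists N => n /hN[].
have [N /(_ N (leqnn _))[L _]] := key 1 ltr01.
rewrite (_ : f = fun x => u_ N x - (u_ N x - f x)); first exact: in_L2B.
by apply/funext => x; rewrite opprB addrC subrK.
Qed.

Lemma semi_hilbert_L2 : semi_hilbert (in_L2 mu) (inner mu).
Proof.
split.
- exact: in_L2_0.
- by move=> u v; exact: in_L2D.
- by move=> a u; exact: in_L2Z.
- move=> u v w Lu Lv Lw; rewrite !innerE -cintD; try exact: cintegrable_inner.
  by congr cint; apply/funext => x; rewrite mulrDl.
- move=> a u w Lu Lw; rewrite !innerE -cintZ; last exact: cintegrable_inner.
  by congr cint; apply/funext => x; rewrite mulrA.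
- move=> u v Lu Lv; rewrite !innerE -cintJ; last exact: cintegrable_inner.
  by congr cint; apply/funext => x; rewrite rmorphM/= conjcK mulrC.
- move=> u Lu; rewrite /inner/=; apply: Rintegral_ge0 => x _.
  by rewrite mulcJ /= sqr_ge0.
- exact: L2_complete.
Qed.

Lemma in_L2_bounded f (C : R) : cmeas f -> (forall x, normc (f x) <= C) -> in_L2 mu f.
Proof.
move=> mf fC; have C0 : 0 <= C by exact: le_trans (normc_ge0 _) (fC point).
apply: (in_L2_lt (a := C ^+ 2)) => //.
apply: (@le_trans _ _ (\int[mu]_x (C ^+ 2)%:E)%E); last first.
  by rewrite integral_cst// [X in (_ * X)%E]probability_setT mule1.
apply: ge0_le_integral => //.
- by move=> x _; rewrite lee_fin sqr_ge0.
- exact/measurable_EFinP/measurable_normc_sqr.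
- by move=> x _; rewrite lee_fin ler_sqr ?nnegrE ?normc_ge0.
Qed.

Lemma in_L2_cst c : in_L2 mu (fun=> c).
Proof. by apply: (@in_L2_bounded _ (normc c)) => //; exact: cmeas_cst. Qed.

Lemma cint_cst c : cint mu (fun=> c) = c.
Proof.
by apply: eq_complexP; rewrite /= Rintegral_cst// [X in fine X]probability_setT mulr1.
Qed.

Lemma cintegrable_L2 f : in_L2 mu f -> cintegrable mu f.
Proof.
move=> Lf; rewrite (_ : f = fun x => f x * (1 : R[i])^*%C).
  exact: (cintegrable_inner Lf (in_L2_cst 1)).
by apply/funext => x; rewrite conjc1 mulr1.
Qed.

Lemma inner_cst f c : in_L2 mu f -> inner mu f (cst c) = cint mu f * c^*%C.
Proof.
move=> Lf; rewrite innerE mulrC -cintZ; last exact: cintegrable_L2.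
by congr cint; apply/funext => x; rewrite mulrC.
Qed.

(** Dominated convergence with the bound [(2 C)^2 |g|^2]. It is what allows multipliers to pass to
    bounded pointwise limits. *)
Lemma L2_dominated (v_ : nat -> T -> R[i]) (v g : T -> R[i]) (C : R) :
  (forall n, cmeas (v_ n)) -> cmeas v -> in_L2 mu g ->
  (forall n x, normc (v_ n x) <= C) ->
  (forall x, normc (v_ n x - v x) @[n --> \oo] --> (0 : R)) ->
  forall e, 0 < e -> exists n, hn (fun x => v_ n x * g x - v x * g x) <= e.
Proof.
move=> mv_ mv Lg vC vv e e0; have [mg ig] := (in_L2P mu g).1 Lg.
have vC' x : normc (v x) <= C.
  apply/ler_addgt0Pr => eps eps0; have /cvg0P /(_ eps eps0) [N /(_ N (leqnn _))] := vv x.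
  rewrite ger0_norm ?normc_ge0// => h.
  have -> : v x = v_ N x - (v_ N x - v x) by ring.
  by rewrite (le_trans (normcB _ _))// lerD.
pose h n x := normc (v_ n x * g x - v x * g x) ^+ 2.
have mh n : cmeas (fun x => v_ n x * g x - v x * g x).
  by apply: cmeasB; exact: cmeasM.
have hE n x : h n x = normc (v_ n x - v x) ^+ 2 * normc (g x) ^+ 2.
  by rewrite /h -mulrBl normcM exprMn.
have Lh n : in_L2 mu (fun x => v_ n x * g x - v x * g x).
  by apply: in_L2B; [exact: in_L2_mul (vC n) Lg|exact: in_L2_mul vC' Lg].
have mhn n : measurable_fun setT (fun x => (h n x)%:E).
  exact/measurable_EFinP/measurable_normc_sqr.
have ch : {ae mu, forall x, setT x -> (h n x)%:E @[n --> \oo] --> (0%:E : \bar R)}.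
  apply: aeW => x _; apply: cvg_EFin; first exact: nearW.
  rewrite [X in X @ _](_ : _ = fun n => h n x)//; under eq_fun do rewrite hE.
  rewrite -(mul0r (normc (g x) ^+ 2)); apply: cvgM; last exact: cvg_cst.
  by rewrite -(mul0r (0 : R)); apply: cvgM; exact: vv.
have ig' : mu.-integrable setT (fun x => ((2 * C) ^+ 2 * normc (g x) ^+ 2)%:E).
  exact: integrable_scale.
have dom : {ae mu, forall x, forall n, setT x ->
    (`|(h n x)%:E| <= ((2 * C) ^+ 2 * normc (g x) ^+ 2)%:E)%E}.
  apply: aeW => x n _; rewrite gee0_abs ?lee_fin ?sqr_ge0// hE ler_wpM2r ?sqr_ge0//.
  have h1 : normc (v_ n x - v x) <= 2 * C.
    by have := normcB (v_ n x) (v x); have := vC n x; have := vC' x; lra.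
  by rewrite ler_sqr ?nnegrE ?normc_ge0// (le_trans (normc_ge0 _) h1).
have [_ _ ] := dominated_convergence measurableT mhn (@measurable_cst _ _ _ _ _ 0%E) ch ig' dom.
rewrite integral0 => lim0.
have c0 : fine (\int[mu]_x (h n x)%:E)%E @[n --> \oo] --> (0 : R) by exact: fine_cvg lim0.
have e2 : 0 < e ^+ 2 by rewrite exprn_gt0.
have [N /(_ N (leqnn _))] := (cvg0P _).1 c0 (e ^+ 2) e2.
rewrite /= (inner_sqrE (Lh N)) /= ger0_norm ?sqr_ge0// => h1.
exists N; rewrite -ler_sqr ?nnegrE ?hnorm_ge0//; exact: ltW.
Qed.

End L2Hilbert.

(** * Measure-preserving maps and their Koopman operators *)

Section MeasurePreserving.
Context {R : realType} {d d' : measure_display}.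
Context {T : measurableType d} {T' : measurableType d'}.
Variables (mu : probability T R) (mu' : probability T' R) (S : T -> T').

Definition preserving := measurable_fun setT S /\
  forall A, measurable A -> mu (S @^-1` A) = mu' A.

Hypothesis pS : preserving.
Implicit Types (f g : T' -> R[i]).

Lemma preserving_ge0_integral (u : T' -> \bar R) : measurable_fun setT u ->
  (forall x, 0 <= u x)%E -> (\int[mu]_x u (S x) = \int[mu']_x u x)%E.
Proof.
move=> mu_ u0; have [mS eS] := pS.
rewrite -(@eq_measure_integral _ _ _ setT mu' (pushforward mu S)); last first.
  by move=> A mA _; exact: eS.
by rewrite ge0_integral_pushforward// preimage_setT.
Qed.

Lemma preserving_integrable (u : T' -> R) : measurable_fun setT u ->
  mu'.-integrable setT (fun x => (u x)%:E) <-> mu.-integrable setT (fun x => (u (S x))%:E).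
Proof.
move=> mu_; have [mS eS] := pS.
have mn : measurable_fun setT (fun x => `|(u x)%:E|%E).
  by apply: measurableT_comp => //; exact/measurable_EFinP.
have E := preserving_ge0_integral mn (fun x => abse_ge0 _).
split=> /integrableP[_ h]; apply/integrableP; split.
- by apply/measurable_EFinP; exact: (measurableT_comp mu_ mS).
- by rewrite E.
- exact/measurable_EFinP.
- by rewrite -E.
Qed.

Lemma preserving_Rintegral (u : T' -> R) : measurable_fun setT u ->
  mu'.-integrable setT (fun x => (u x)%:E) ->
  \int[mu]_x u (S x) = \int[mu']_x u x.
Proof.
move=> mu_ iu; have [mS eS] := pS.
rewrite /Rintegral; congr fine.
rewrite -(@eq_measure_integral _ _ _ setT mu' (pushforward mu S)); last first.
  by move=> A mA _; exact: eS.
rewrite integral_pushforward ?preimage_setT//; first exact/measurable_EFinP.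
exact/(preserving_integrable mu_).1.
Qed.

Lemma preserving_cint f : cmeas f -> cintegrable mu' f ->
  cint mu (fun x => f (S x)) = cint mu' f.
Proof.
move=> [m1 m2] [i1 i2]; apply: eq_complexP => /=.
  exact: (preserving_Rintegral m1 i1).
exact: (preserving_Rintegral m2 i2).
Qed.

Lemma preserving_in_L2 f : cmeas f -> in_L2 mu' f <-> in_L2 mu (fun x => f (S x)).
Proof.
move=> mf; have [mS _] := pS; rewrite !in_L2P.
split=> -[_ h]; split => //; try exact: cmeas_comp.
  exact/(preserving_integrable (measurable_normc_sqr mf)).1.
exact/(preserving_integrable (measurable_normc_sqr mf)).2.
Qed.

Lemma preserving_inner f g : in_L2 mu' f -> in_L2 mu' g ->
  inner mu (fun x => f (S x)) (fun x => g (S x)) = inner mu' f g.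
Proof.
move=> Lf Lg; rewrite !innerE (preserving_cint (f := fun x => f x * (g x)^*%C))//.
  by apply: cmeasM; [exact: in_L2_cmeas Lf|exact/cmeasJ/(in_L2_cmeas Lg)].
exact: cintegrable_inner.
Qed.

Lemma preserving_ae (P : T' -> Prop) : {ae mu', forall x, P x} -> {ae mu, forall x, P (S x)}.
Proof.
move=> [N [mN N0 sub]]; have [mS eS] := pS; exists (S @^-1` N); split.
- by rewrite -[_ @^-1` _]setTI; exact: mS.
- by rewrite eS.
- by move=> x /= h; apply: sub.
Qed.

(** The function [f - c] has the same L^2 norm before and after composition with [S], so its
    vanishing almost everywhere descends as well as it lifts. *)
Lemma preserving_ae_inv f (c : R[i]) : cmeas f ->
  {ae mu, forall x, f (S x) = c} -> {ae mu', forall x, f x = c}.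
Proof.
move=> mf h; have [mS _] := pS.
pose g x := f x - c.
have Lg : in_L2 mu' g.
  apply/preserving_in_L2; first by apply: cmeasB => //; exact: cmeas_cst.
  apply: in_L2_ae (in_L2_0 mu); last by apply: filterS h => x; rewrite /g => ->; rewrite subrr.
  by apply: cmeasB; [exact: cmeas_comp|exact: cmeas_cst].
have /hnorm_eq0P : hnorm (inner mu') g = 0.
  have Lg' := (preserving_in_L2 (in_L2_cmeas Lg)).1 Lg.
  rewrite /hnorm -preserving_inner//; apply/(hnorm_eq0P Lg').
  by apply: filterS h => x; rewrite /g => ->; rewrite subrr.
by move=> /(_ Lg); apply: filterS => x /eqP; rewrite subr_eq0 => /eqP.
Qed.

End MeasurePreserving.

Section Koopman.
Context {R : realType} {d : measure_display} {T : measurableType d}.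
Variables (mu : probability T R) (S : T -> T).
Hypothesis pS : preserving mu mu S.

Definition koopman (f : T -> R[i]) : T -> R[i] := f \o S.

Lemma iter_koopman n f : iter n koopman f = f \o iter n S.
Proof.
elim: n => // n ih; rewrite iterS ih /koopman.
by apply/funext => x /=; rewrite -iterSr.
Qed.

Lemma preserving_iter n : preserving mu mu (iter n S).
Proof.
elim: n => [|n [m e]]; first by split=> //; exact: measurable_id.
have [mS eS] := pS; split; first exact: (measurableT_comp mS m).
move=> A mA; have mSA : measurable (S @^-1` A) by rewrite -[_ @^-1` _]setTI; exact: mS.
exact: (etrans (e _ mSA) (eS _ mA)).
Qed.

Lemma isometry_koopman : isometry (in_L2 mu) (inner mu) koopman.
Proof.
split=> // u Hu.
  exact: (preserving_in_L2 pS (in_L2_cmeas Hu)).1.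
exact: preserving_inner.
Qed.

Lemma mean_zeroP f : mean_zero mu f <-> in_L2 mu f /\ cint mu f = 0.
Proof.
split=> [[Lf h]|[Lf h]]; split=> //.
  by have := h (cst 1) (ex_intro _ 1 erefl); rewrite inner_cst// conjc1 mulr1.
by move=> _ [c ->]; rewrite inner_cst// h mul0r.
Qed.

Lemma inner_cst1 f : in_L2 mu f -> inner mu f (cst 1) = cint mu f.
Proof. by move=> Lf; rewrite inner_cst// conjc1 mulr1. Qed.

Lemma semi_hilbert_mean_zero : semi_hilbert (mean_zero mu) (inner mu).
Proof.
have sh := semi_hilbert_L2 mu; have L1 := in_L2_cst mu 1.
split.
- apply/mean_zeroP; split; first exact: in_L2_0.
  by rewrite cint_cst.
- move=> u v /mean_zeroP[Lu u0] /mean_zeroP[Lv v0]; apply/mean_zeroP; split; first exact: in_L2D.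
  by rewrite cintD ?u0 ?v0 ?addr0//; exact: cintegrable_L2.
- move=> a u /mean_zeroP[Lu u0]; apply/mean_zeroP; split; first exact: in_L2Z.
  by rewrite cintZ ?u0 ?mulr0//; exact: cintegrable_L2.
- by move=> u v w [Lu _] [Lv _] [Lw _]; exact: (ipDl sh).
- by move=> a u w [Lu _] [Lw _]; exact: (ipZl sh).
- by move=> u v [Lu _] [Lv _]; exact: (ipC sh).
- by move=> u [Lu _]; exact: (Re_ip_ge0 sh).
- move=> u_ Lu cauchy; have [v Lv hv] := sh_complete sh (fun n => (Lu n).1) cauchy.
  exists v => //; apply/mean_zeroP; split=> //; rewrite -inner_cst1//.
  have h1 : normc (inner mu v (cst 1)) = 0.
    apply/eqP; rewrite eq_le normc_ge0 andbT; apply/ler_addgt0Pr => e e0; rewrite add0r.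
    pose B := hnorm (inner mu) (cst 1) + 1.
    have B0 : 0 < B by rewrite ltr_wpDl// hnorm_ge0.
    have [N /(_ N (leqnn _)) h] := hv (e / B) (divr_gt0 e0 B0).
    have [LN N0] := (mean_zeroP (u_ N)).1 (Lu N).
    have Lnv : in_L2 mu (u_ N - v) by exact: in_L2B.
    have -> : inner mu v (cst 1) = - inner mu (u_ N - v) (cst 1).
      rewrite (ipDl sh) ?(ipNl sh) ?inner_cst1 ?N0//; last exact: (shN sh).
      by rewrite add0r opprK.
    rewrite normcN' (le_trans (cauchy_schwarz sh Lnv L1))//.
    rewrite (le_trans (ler_wpM2r _ h)) ?hnorm_ge0// mulrAC ler_pdivrMr// ler_pM2l//.
    by rewrite lerDl.
  exact: eq0_normc.
Qed.

Lemma isometry_koopman_mean_zero : isometry (mean_zero mu) (inner mu) koopman.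
Proof.
have iK := isometry_koopman; split=> // u.
  move=> /mean_zeroP[Lu u0]; apply/mean_zeroP; split; first exact: (isoH iK).
  by rewrite (preserving_cint pS) ?u0//; [exact: in_L2_cmeas Lu|exact: cintegrable_L2].
by move=> v [Lu _] [Lv _]; exact: (isoI iK).
Qed.

End Koopman.

(** * Bounded multipliers of closed subspaces *)

Section Bernoulli.
Context {R : realType}.

Lemma bernoulli_lower (y : R) K : 0 <= y <= 1 -> 1 - K%:R * y <= (1 - y) ^+ K.
Proof.
move=> /andP[y0 y1]; elim: K => [|K ih]; first by rewrite mul0r subr0 expr0.
rewrite exprS -natr1; have K0 : 0 <= K%:R * y ^+ 2 by rewrite mulr_ge0 ?sqr_ge0.
have := ler_wpM2l (_ : 0 <= 1 - y) ih; rewrite subr_ge0 => /(_ y1); nra.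
Qed.

Lemma bernoulli_upper (y : R) K : 0 <= y <= 1 -> (1 - y) ^+ K * (1 + K%:R * y) <= 1.
Proof.
move=> /andP[y0 y1]; elim: K => [|K ih]; first by rewrite mul0r addr0 expr0 mulr1.
apply: le_trans ih; rewrite exprS -natr1 -mulrA mulrCA ler_wpM2l ?exprn_ge0 ?subr_ge0//.
by have : 0 <= K%:R * y ^+ 2; [rewrite mulr_ge0 ?sqr_ge0|nra].
Qed.

Lemma bernoulli_grow (h : R) n : 0 <= h -> 1 + n%:R * h <= (1 + h) ^+ n.
Proof.
move=> h0; elim: n => [|n ih]; first by rewrite mul0r addr0 expr0.
have n0 : 0 <= n%:R * h ^+ 2 by rewrite mulr_ge0 ?sqr_ge0.
rewrite exprS -natr1; have := ler_wpM2l (_ : 0 <= 1 + h) ih.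
rewrite addr_ge0// => /(_ isT); nra.
Qed.

(* polynomials in [w] converging pointwise on [0, 1] to the indicator of [w < 1/2] *)
Definition step_poly n (w : R) := (1 - w ^+ (2 * n)) ^+ (n * 4 ^ n).

Lemma step_poly_itv n w : 0 <= w <= 1 -> 0 <= step_poly n w <= 1.
Proof.
move=> /andP[w0 w1]; have p0 : 0 <= w ^+ (2 * n) by rewrite exprn_ge0.
have p1 : w ^+ (2 * n) <= 1 by rewrite exprn_ile1.
by rewrite /step_poly exprn_ge0 ?subr_ge0// exprn_ile1 ?subr_ge0// lerBlDr lerDl.
Qed.

(** By the two Bernoulli bounds the behaviour is decided by [n 4^n w^(2n) = n (2w)^(2n)], which
    tends to 0 for [w < 1/2] and is at least [n] otherwise. *)
Lemma step_poly_cvg w : 0 <= w <= 1 ->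
  step_poly n w @[n --> \oo] --> (if w < 1 / 2 then 1 else 0 : R).
Proof.
move=> w01; have /andP[w0 w1] := w01.
have wn n : 0 <= w ^+ (2 * n) <= 1 by rewrite exprn_ge0// exprn_ile1.
have E n : (n * 4 ^ n)%:R * w ^+ (2 * n) = n%:R * ((2 * w) ^+ n) ^+ 2.
  have e4 : (4 : R) ^+ n = 2 ^+ (2 * n) by rewrite exprM; congr (_ ^+ n); ring.
  by rewrite natrM natrX e4 exprMn exprMn -!exprM [(n * 2)%N]mulnC mulrA.
apply/cvgrPdist_le => e e0; case: ltP => hw.
  (* Then [1 + h = 2 / (2 w + 1)] and [2 w (1 + h) <= 1]. This bounds [n (2 w)^n] by [1 / h], and
     the second factor [(2 w)^n] supplies the decay. *)
  pose h := (2 * w + 1)^-1 * (1 - 2 * w).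
  have d0 : 0 < 2 * w + 1 by lra.
  have h0 : 0 < h by rewrite mulr_gt0 ?invr_gt0//; lra.
  have xh : 2 * w * (1 + h) <= 1.
    have -> : 2 * w * (1 + h) = 4 * w / (2 * w + 1) by rewrite /h; field; rewrite gt_eqF.
    by rewrite ler_pdivrMr//; lra.
  have c0 : (2 * w) ^+ n @[n --> \oo] --> (0 : R).
    by apply: cvg_expr; rewrite ger0_norm; lra.
  have [N hN] := (cvg0P _).1 c0 (e * h) (mulr_gt0 e0 h0).
  exists N => // n /= /hN; have x0 : 0 <= (2 * w) ^+ n by rewrite exprn_ge0; lra.
  rewrite ger0_norm// => hx; have /andP[s0 s1] := step_poly_itv n w01.
  rewrite ger0_norm ?subr_ge0//; have := bernoulli_lower (n * 4 ^ n) (wn n).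
  rewrite -/(step_poly n w) E => h1.
  have h2 : (2 * w) ^+ n * (1 + n%:R * h) <= 1.
    apply: le_trans (_ : (2 * w) ^+ n * (1 + h) ^+ n <= 1).
      by rewrite ler_wpM2l// bernoulli_grow// ltW.
    by rewrite -exprMn exprn_ile1// mulr_ge0 ?addr_ge0//; lra.
  have h3 : n%:R * (2 * w) ^+ n <= h^-1 by rewrite -div1r ler_pdivlMr//; nra.
  have h4 : n%:R * ((2 * w) ^+ n) ^+ 2 <= h^-1 * (e * h).
    by rewrite expr2 mulrA ler_pM// mulr_ge0.
  have h5 : h^-1 * (e * h) = e by rewrite mulrCA mulVf ?mulr1// gt_eqF.
  lra.
exists (Num.truncn e^-1) => // n /= hn; have /andP[s0 s1] := step_poly_itv n w01.
rewrite sub0r normrN ger0_norm//; have := bernoulli_upper (n * 4 ^ n) (wn n).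
rewrite -/(step_poly n w) E => h1.
have x1 : 1 <= ((2 * w) ^+ n) ^+ 2 by rewrite -exprM exprn_ege1//; lra.
have h2 : e^-1 <= n.+1%:R.
  by rewrite (le_trans (ltW (Num.Theory.truncnS_gt _)))// ler_nat.
have h3 : n.+1%:R <= 1 + n%:R * ((2 * w) ^+ n) ^+ 2.
  by rewrite -natr1 addrC lerD2l ler_peMr.
have h4 : step_poly n w * e^-1 <= 1.
  by apply: le_trans h1; rewrite ler_wpM2l// (le_trans h2).
by rewrite ler_pdivrMr// mul1r in h4.
Qed.
End Bernoulli.

Section Multipliers.
Import HBNNSimple.
Context {R : realType} {d : measure_display} {T : measurableType d}.
Variable mu : probability T R.
Implicit Types (f g v : T -> R[i]) (C : set (T -> R[i])) (A : set T).
Local Notation hn := (hnorm (inner mu)).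
Local Notation ind A := (fun x => (\1_A x)%:C%C : R[i]).

Record closed_subspace C : Prop := ClosedSubspace {
  cs_L2 : forall f, C f -> in_L2 mu f ;
  csD : forall f g, C f -> C g -> C (fun x => f x + g x) ;
  csZ : forall a f, C f -> C (fun x => a * f x) ;
  cs_lim : forall f, in_L2 mu f ->
    (forall e, 0 < e -> exists g, C g /\ hn (fun x => g x - f x) <= e) -> C f }.

(** The subspace [C] is only linear, while its multipliers form an algebra. Polynomial approximation
    thus becomes available for functions acting on [C]. *)
Definition multiplier C v := [/\ cmeas v, exists B, forall x, normc (v x) <= B &
  forall g, C g -> C (fun x => v x * g x)].

Variable C : set (T -> R[i]).
Hypothesis hC : closed_subspace C.

Lemma mult_cst c : multiplier C (fun=> c).
Proof.
split; [exact: cmeas_cst|by exists (normc c)|by move=> g; exact: (csZ hC)].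
Qed.

Lemma multD u v : multiplier C u -> multiplier C v -> multiplier C (fun x => u x + v x).
Proof.
move=> [mu_ [B uB] uC] [mv [B' vB] vC]; split; first exact: cmeasD.
  by exists (B + B') => x; rewrite (le_trans (normcD _ _))// lerD.
move=> g Cg; rewrite (_ : (fun x => _) = fun x => u x * g x + v x * g x).
  by apply: (csD hC); [exact: uC|exact: vC].
by apply/funext => x; rewrite mulrDl.
Qed.

Lemma multM u v : multiplier C u -> multiplier C v -> multiplier C (fun x => u x * v x).
Proof.
move=> [mu_ [B uB] uC] [mv [B' vB] vC]; split; first exact: cmeasM.
  by exists (B * B') => x; rewrite normcM ler_pM ?normc_ge0.
move=> g Cg; rewrite (_ : (fun x => _) = fun x => u x * (v x * g x)).
  by apply: uC; exact: vC.
by apply/funext => x; rewrite mulrA.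
Qed.

Lemma eq_mult u v : u =1 v -> multiplier C u -> multiplier C v.
Proof. by move=> /funext ->. Qed.

Lemma multZ a v : multiplier C v -> multiplier C (fun x => a * v x).
Proof. by move=> hv; apply: multM => //; exact: mult_cst. Qed.

Lemma multX v n : multiplier C v -> multiplier C (fun x => v x ^+ n).
Proof.
move=> hv; elim: n => [|n ih].
  by apply: eq_mult (mult_cst 1) => x; rewrite expr0.
by apply: eq_mult (multM hv ih) => x; rewrite exprS.
Qed.

Lemma mult_sum (I : Type) (s : seq I) (P : pred I) (F : I -> T -> R[i]) :
  (forall i, multiplier C (F i)) -> multiplier C (fun x => \sum_(i <- s | P i) F i x).
Proof.
move=> mF; rewrite (_ : (fun x => _) = \sum_(i <- s | P i) F i); last first.
  by apply/funext => x; rewrite fct_sumE.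
by apply: big_ind => [|f g|i _]; [exact: mult_cst|exact: multD|exact: mF].
Qed.

Lemma mult_lim (v_ : nat -> T -> R[i]) v (B : R) : (forall n, multiplier C (v_ n)) ->
  cmeas v -> (forall n x, normc (v_ n x) <= B) ->
  (forall x, normc (v_ n x - v x) @[n --> \oo] --> (0 : R)) -> multiplier C v.
Proof.
move=> hv mv vB vv; have mv_ n : cmeas (v_ n) by case: (hv n).
have vB' x : normc (v x) <= B.
  apply/ler_addgt0Pr => eps eps0; have /cvg0P /(_ eps eps0) [N /(_ N (leqnn _))] := vv x.
  rewrite ger0_norm ?normc_ge0// => h.
  have -> : v x = v_ N x - (v_ N x - v x) by ring.
  by rewrite (le_trans (normcB _ _))// lerD.
split=> //; first by exists B.
move=> g Cg; have Lg := cs_L2 hC Cg; apply: (cs_lim hC); first exact: in_L2_mul vB' Lg.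
move=> e e0; have [n hn_] := L2_dominated mv_ mv Lg vB vv e0.
by exists (fun x => v_ n x * g x); split=> //; case: (hv n) => _ _; apply.
Qed.

(** An affine change of [u] takes values in [0, 1] and sends the threshold [c] to 1/2, where the
    polynomials [step_poly] converge to the indicator. *)
Lemma mult_ltr (u : T -> R) (c : R) : multiplier C (fun x => (u x)%:C%C) ->
  multiplier C (ind [set x | u x < c]).
Proof.
move=> hu; have [[mu_ _] [B uB] _] := hu.
pose K := B + `|c| + 1.
have B0 : 0 <= B by exact: le_trans (normc_ge0 _) (uB point).
have K0 : 0 < K by rewrite /K; have := normr_ge0 c; lra.
pose w x := (u x - c) / (2 * K) + 1 / 2.
have w01 x : 0 <= w x <= 1.
  have : `|u x - c| <= K.
    have := uB x; rewrite normc_real => h.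
    by rewrite (le_trans (ler_normB _ _))// /K; lra.
  rewrite ler_norml => /andP[h1 h2].
  have : - (1 / 2) <= (u x - c) / (2 * K) <= 1 / 2.
    by rewrite ler_pdivlMr ?ler_pdivrMr ?mulr_gt0//; apply/andP; split; lra.
  by rewrite /w; lra.
have hw : multiplier C (fun x => (w x)%:C%C).
  apply: (@eq_mult (fun x => ((2 * K)^-1)%:C%C * (u x)%:C%C + ((2 * K)^-1 * (- c) + 1 / 2)%:C%C)).
    by move=> x; rewrite -rmorphM -rmorphD /=; congr (_%:C)%C; rewrite /w; ring.
  by apply: multD; [exact: multZ|exact: mult_cst].
have hs n : multiplier C (fun x => (step_poly n (w x))%:C%C).
  apply: (@eq_mult (fun x => (1 + -1 * (w x)%:C%C ^+ (2 * n)) ^+ (n * 4 ^ n))).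
    by move=> x; rewrite mulN1r -rmorphXn -[1](rmorph1 (real_complex R)) -rmorphB -rmorphXn.
  by apply: multX; apply: multD; [exact: mult_cst|apply: multZ; exact: multX].
apply: (mult_lim (B := 1) hs).
- apply: cmeas_indic; rewrite (_ : mkset _ = setT `&` u @^-1` `]-oo, c[%classic).
    exact: mu_.
  by rewrite setTI; apply/seteqP; split=> x /=; rewrite in_itv.
- by move=> n x; rewrite normc_real ger0_norm; have /andP[] := step_poly_itv n (w01 x).
- move=> x; have := step_poly_cvg (w01 x); move=> h.
  have -> : (fun n => normc ((step_poly n (w x))%:C%C - (\1_[set x | u x < c] x)%:C%C)) =
     (fun n => `|step_poly n (w x) - (if w x < 1 / 2 then 1 else 0)|).
    apply/funext => n; rewrite -rmorphB normc_real; congr (`|_ - _|).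
    rewrite indicE /w -[X in _ < X]add0r ltrD2r pmulr_llt0 ?invr_gt0 ?mulr_gt0// subr_lt0.
    by case: ltP => uc; [rewrite mem_set|rewrite memNset//= ; apply/negP; rewrite -leNgt].
  move/cvgrPdist_le: h => h; apply/cvg0P => e e0; have [N _ hN] := h e e0.
  by exists N => n /hN; rewrite normr_id distrC.
Qed.

Definition mult_sets := [set A | measurable A /\ multiplier C (ind A)].

Lemma indC A : (ind (~` A)) = (fun x => 1 + -1 * (\1_A x)%:C%C).
Proof.
apply/funext => x; rewrite !indicE in_setC; case: (_ \in _) => /=; apply: eq_complexP => /=; ring.
Qed.

Lemma indI A B : (ind (A `&` B)) = (fun x => (\1_A x)%:C%C * (\1_B x)%:C%C).
Proof.
apply/funext => x; rewrite !indicE in_setI; case: (_ \in _); case: (_ \in _) => /=;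
  apply: eq_complexP => /=; ring.
Qed.

Lemma mult_setsC A : mult_sets A -> mult_sets (~` A).
Proof.
move=> [mA hA]; split; first exact: measurableC.
by rewrite indC; apply: multD; [exact: mult_cst|exact: multZ].
Qed.

Lemma mult_setsI A B : mult_sets A -> mult_sets B -> mult_sets (A `&` B).
Proof.
move=> [mA hA] [mB hB]; split; first exact: measurableI.
by rewrite indI; exact: multM.
Qed.

Lemma mult_setsU A B : mult_sets A -> mult_sets B -> mult_sets (A `|` B).
Proof.
move=> hA hB; rewrite -[A `|` B]setCK setCU.
by apply: mult_setsC; apply: mult_setsI; exact: mult_setsC.
Qed.

(** Complements come from the algebra structure of the multipliers, countable unions from their
    bounded pointwise limits. *)
Lemma mult_sets_sigma : sigma_algebra setT mult_sets.
Proof.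
split=> [|A|F hF].
- split=> //; apply: eq_mult (mult_cst 0) => x; rewrite indicE in_set0 //.
- by rewrite setTD; exact: mult_setsC.
have mF : measurable (\bigcup_k F k) by apply: bigcup_measurable => k _; case: (hF k).
split=> //.
pose G n := \big[setU/set0]_(i < n) F i.
have hG n : mult_sets (G n).
  rewrite /G; elim: n => [|n ih]; last by rewrite big_ord_recr; exact: mult_setsU.
  rewrite big_ord0; split=> //.
  by apply: eq_mult (mult_cst 0) => x; rewrite indicE in_set0.
apply: (mult_lim (v_ := fun n => ind (G n)) (B := 1)).
- by move=> n; case: (hG n).
- exact: cmeas_indic.
- by move=> n x; exact: normc_indic.
- move=> x; apply/cvg0P => e e0.
  have [[k _ Fk]|nF] := pselect ((\bigcup_k F k) x).
    exists k.+1 => n kn; rewrite -rmorphB normc_real !indicE mem_set; last first.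
      by rewrite /G -bigcup_mkord; exists k.
    by rewrite mem_set ?subrr ?normr0 ?ltW//; exists k.
  exists 0%N => n _; rewrite -rmorphB normc_real !indicE memNset; last first.
    by rewrite /G -bigcup_mkord => -[k _ Fk]; apply: nF; exists k.
  by rewrite memNset// subrr !normr0 ltW.
Qed.

Lemma mult_real_bounded (u : T -> R) (B : R) : (forall A, measurable A -> multiplier C (ind A)) ->
  measurable_fun setT u -> (forall x, 0 <= u x <= B) -> multiplier C (fun x => (u x)%:C%C).
Proof.
move=> hA mu_ uB.
have mu' : measurable_fun setT (EFin \o u) by exact/measurable_EFinP.
pose g_ := nnsfun_approx measurableT mu'.
have gB n x : 0 <= g_ n x <= B.
  apply/andP; split; first exact: fun_ge0.
  have /andP[_ uxB] := uB x; apply: le_trans uxB.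
  rewrite -lee_fin /g_ nnsfun_approxE.
  by apply: (@le_approx _ _ _ setT (EFin \o u)) => // y _; rewrite lee_fin; case/andP: (uB y).
apply: (mult_lim (v_ := fun n x => (g_ n x)%:C%C) (B := B)).
- move=> n; apply: (@eq_mult (fun x => \sum_(y <- finmap.enum_fset (fset_set (range (g_ n))))
     (y%:C%C * (\1_(g_ n @^-1` [set y]) x)%:C%C))).
    move=> x; rewrite fimfunE fsbig_finite//= raddf_sum/=.
    by apply: eq_bigr => y _; rewrite -rmorphM.
  by apply: mult_sum => y; apply: multZ; apply: hA; exact: measurable_sfunP.
- exact: cmeas_real.
- by move=> n x; rewrite normc_real ger0_norm; have /andP[] := gB n x.
- move=> x; have u0 y : setT y -> (0 <= (EFin \o u) y)%E.
    by move=> _; rewrite lee_fin; case/andP: (uB y).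
  have h := cvg_nnsfun_approx measurableT mu' u0 (I : setT x).
  have {}h : g_ n x @[n --> \oo] --> u x by exact: (fine_cvg h).
  rewrite (_ : (fun n => _) = (fun n => `|g_ n x - u x|)); last first.
    by apply/funext => n; rewrite -rmorphB normc_real.
  move/cvgrPdist_le: h => h; apply/cvg0P => e e0; have [N _ hN] := h e e0.
  by exists N => n /hN; rewrite normr_id distrC.
Qed.

(** Multipliers applied to the constant 1 give all bounded functions, and the truncations of [f] to
    the sets [|f| < n] converge to [f]. *)
Lemma closed_subspace_full : (forall A, measurable A -> multiplier C (ind A)) ->
  C (fun=> 1) -> forall f, in_L2 mu f -> C f.
Proof.
move=> hA C1.
have real_pos (u : T -> R) (B : R) : measurable_fun setT u -> (forall x, 0 <= u x <= B) ->
    C (fun x => (u x)%:C%C).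
  move=> mu_ uB; have [_ _ /(_ _ C1)] := mult_real_bounded hA mu_ uB.
  by under eq_fun do rewrite mulr1.
have real_bnd (u : T -> R) (B : R) : measurable_fun setT u -> (forall x, `|u x| <= B) ->
    C (fun x => (u x)%:C%C).
  move=> mu_ uB.
  have := csD hC (real_pos (fun x => u x + B) (2 * B) _ _) (csZ hC (- B%:C%C) C1).
  rewrite (_ : (fun x => _) = fun x => (u x)%:C%C); last first.
    by apply/funext => x; rewrite mulr1 -rmorphN -rmorphD addrK.
  apply; first by apply: measurable_funD => //; exact: measurable_cst.
  by move=> x; have := uB x; rewrite ler_norml => /andP[h1 h2]; apply/andP; split; lra.
have bnd f (B : R) : cmeas f -> (forall x, normc (f x) <= B) -> C f.
  move=> [m1 m2] fB; rewrite (_ : f = fun x => (complex.Re (f x))%:C%C + 'i%C * (complex.Im (f x))%:C%C).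
    apply: (csD hC); last apply: (csZ hC).
      by apply: (real_bnd _ B) => // x; exact: le_trans (normc_Re _) (fB x).
    by apply: (real_bnd _ B) => // x; exact: le_trans (normc_Im _) (fB x).
  by apply/funext => x; rewrite -complexE.
move=> f Lf; have mf := in_L2_cmeas Lf.
pose A n := [set x | normc (f x) < n%:R].
have mA n : measurable (A n).
  rewrite (_ : A n = setT `&` (fun x => normc (f x)) @^-1` `]-oo, n%:R[%classic).
    exact: measurable_normc.
  by rewrite setTI; apply/seteqP; split=> x /=; rewrite in_itv.
apply: (cs_lim hC) => // e e0.
have [||x|n hn_] := @L2_dominated _ _ _ mu (fun n => ind (A n)) (fun=> 1) f 1 _ (cmeas_cst 1) Lf _ _ e e0.
- by move=> n; exact: cmeas_indic.
- by move=> n x; exact: normc_indic.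
- apply/cvg0P => eps eps0; exists (Num.truncn (normc (f x))).+1 => n nx.
  rewrite indicE mem_set ?subrr ?normc0 ?normr0 ?ltW//.
  by rewrite /A /= (lt_le_trans (Num.Theory.truncnS_gt _))// ler_nat.
exists (fun x => (\1_(A n) x)%:C%C * f x); split.
  apply: (bnd _ n%:R); first by apply: cmeasM => //; exact: cmeas_indic.
  move=> x; rewrite normcM normc_real indicE; case: (boolP (x \in A n)) => [/set_mem|_] /=.
    by rewrite normr1 mul1r => /ltW.
  by rewrite normr0 mul0r.
by move: hn_; under eq_fun do rewrite mul1r.
Qed.

End Multipliers.

(** * Ergodic flows and their eigenfunctions *)

Section Lebesgue.
Context {R : realType}.
Local Notation leb := (@lebesgue_measure R).

Lemma measurable_shift (s : R) :
  measurable_fun setT ((fun t => t + s) : measurableTypeR R -> measurableTypeR R).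
Proof. by apply: measurable_funD => //; exact: measurable_cst. Qed.

Lemma lebesgue_shift (s : R) (A : set (measurableTypeR R)) : measurable A ->
  leb ((fun t => t + s) @^-1` A) = leb A.
Proof.
move=> mA; rewrite [RHS](lebesgue_measure_unique (mu := pushforward leb (fun t : measurableTypeR R => t + s : measurableTypeR R)))//.
  exact: measurable_shift.
move=> mS X [[a b] _ <-].
transitivity (leb `]a - s, b - s]%classic); last first.
  congr (leb _); apply/seteqP; split=> x /=; rewrite !in_itv/= ltrBlDr lerBrDr //.
rewrite !lebesgue_measure_itv/= !lte_fin ltrD2r; case: ifP => // _.
by rewrite -!EFinB; congr EFin; ring.
Qed.

End Lebesgue.

Lemma ae_measure_le {R : realType} {d : measure_display} {T : measurableType d}
  (mu : {measure set T -> \bar R}) (A B : set T) : measurable A -> measurable B ->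
  {ae mu, forall x, A x -> B x} -> (mu A <= mu B)%E.
Proof.
move=> mA mB [N [mN N0 sub]].
have : (mu A <= mu (B `|` N))%E.
  apply: le_measure; rewrite ?inE//; first exact: measurableU.
  move=> x Ax; have [Bx|nBx] := pselect (B x); [by left|right].
  by apply: sub => /= /(_ Ax).
by move/le_trans; apply; apply: le_trans (measureU2 _ mB mN) _;
  rewrite [X in (_ + X)%E](N0 : mu N = 0%E) adde0.
Qed.

Lemma ae_measure_eq {R : realType} {d : measure_display} {T : measurableType d}
  (mu : {measure set T -> \bar R}) (A B : set T) : measurable A -> measurable B ->
  {ae mu, forall x, A x <-> B x} -> mu A = mu B.
Proof.
move=> mA mB h; apply/eqP; rewrite eq_le; apply/andP; split; apply: ae_measure_le => //;
  by apply: filterS h => x [].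
Qed.

Section Sections.
Context {R : realType} {d1 d2 : measure_display}.
Context {T1 : measurableType d1} {T2 : measurableType d2}.
Variables (m1 : {sigma_finite_measure set T1 -> \bar R}).
Variables (m2 : {sigma_finite_measure set T2 -> \bar R}).

Lemma sections_integral (D : set (T1 * T2)) : measurable D ->
  (\int[m1]_x m2 (xsection D x) = \int[m2]_y m1 (ysection D y))%E.
Proof.
move=> mD; have := indic_fubini_tonelli m1 m2 mD.
by rewrite indic_fubini_tonelli_FE// indic_fubini_tonelli_GE.
Qed.

(** Both sides say that the iterated integrals of the indicator of [D], equal by Tonelli, are 0. *)
Lemma ae_section (D : set (T1 * T2)) : measurable D ->
  {ae m1, forall x, m2 (xsection D x) = 0%E} <->
  {ae m2, forall y, m1 (ysection D y) = 0%E}.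
Proof.
move=> mD.
have m1' := measurable_fun_xsection m2 mD; have m2' := measurable_fun_ysection m1 mD.
have E1 := ae_eq_integral_abs m1 measurableT m1'.
have E2 := ae_eq_integral_abs m2 measurableT m2'.
have e1 : (\int[m1]_x `|(m2 \o xsection D) x| = \int[m1]_x m2 (xsection D x))%E.
  by apply: eq_integral => x _; rewrite gee0_abs.
have e2 : (\int[m2]_x `|(m1 \o ysection D) x| = \int[m2]_x m1 (ysection D x))%E.
  by apply: eq_integral => x _; rewrite gee0_abs.
split=> h.
  have : ae_eq m2 setT (m1 \o ysection D) (cst 0%E).
    apply/E2; rewrite e2 -sections_integral// -e1; apply/E1.
    by apply: filterS h.
  by apply: filterS => x /(_ I).
have : ae_eq m1 setT (m2 \o xsection D) (cst 0%E).
  apply/E1; rewrite e1 sections_integral// -e2; apply/E2.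
  by apply: filterS h.
by apply: filterS => x /(_ I).
Qed.

Lemma ae_section_pred (Q : T1 -> T2 -> Prop) : measurable [set p | Q p.1 p.2] ->
  {ae m1, forall x, {ae m2, forall y, Q x y}} <-> {ae m2, forall y, {ae m1, forall x, Q x y}}.
Proof.
move=> mQ; pose D := ~` [set p : T1 * T2 | Q p.1 p.2].
have mD : measurable D by exact: measurableC.
have h1 x : {ae m2, forall y, Q x y} <-> m2 (xsection D x) = 0%E.
  have mx : measurable (xsection D x) by exact: measurable_xsection.
  have E : xsection D x = ~` [set y | Q x y].
    by apply/seteqP; split=> y; rewrite /xsection/= inE.
  rewrite -(negligibleP m2 mx) E; split => [[N [mN N0 sub]]|[N [mN N0 sub]]]; exists N; split=> //.
have h2 y : {ae m1, forall x, Q x y} <-> m1 (ysection D y) = 0%E.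
  have my : measurable (ysection D y) by exact: measurable_ysection.
  have E : ysection D y = ~` [set x | Q x y].
    by apply/seteqP; split=> x; rewrite /ysection/= inE.
  rewrite -(negligibleP m1 my) E; split => [[N [mN N0 sub]]|[N [mN N0 sub]]]; exists N; split=> //.
split=> h.
  have : {ae m2, forall y, m1 (ysection D y) = 0%E}.
    by apply/(ae_section mD); apply: filterS h => x /h1.
  by apply: filterS => y /h2.
have : {ae m1, forall x, m2 (xsection D x) = 0%E}.
  by apply/(ae_section mD); apply: filterS h => y /h2.
by apply: filterS => x /h1.
Qed.

End Sections.

Section ErgodicFlow.
Context {R : realType} {d : measure_display} {T : measurableType d}.
Local Notation leb := (@lebesgue_measure R).
Variables (mu : probability T R) (Phi : R -> T -> T).

Definition flow_measurable :=
  measurable_fun setT (fun p : measurableTypeR R * T => Phi p.1 p.2).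

Hypothesis mPhi : flow_measurable.
Hypothesis PhiD : forall s t x, Phi (s + t) x = Phi s (Phi t x).
Hypothesis erg : ergodic_invariant mu Phi.

Lemma flow_measurable_at t : measurable_fun setT (Phi t).
Proof.
have -> : Phi t = (fun p : measurableTypeR R * T => Phi p.1 p.2) \o (fun x => (t : measurableTypeR R, x)).
  by [].
by apply: measurableT_comp => //; exact: measurable_pair1.
Qed.

Lemma flow_preserving t : preserving mu mu (Phi t).
Proof. by split; [exact: flow_measurable_at|move=> A mA; exact: erg.1]. Qed.

(* The almost invariant set [A] is replaced by the strictly invariant set of the
   points whose orbit is in [A] at almost every time. *)
Lemma ae_invariant_set A : measurable A ->
  (forall t, {ae mu, forall x, A (Phi t x) <-> A x}) -> mu A = 0%E \/ mu A = 1%E.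
Proof.
move=> mA invA.
pose D : set (measurableTypeR R * T) := [set p | ~ A (Phi p.1 p.2)].
have mD : measurable D.
  rewrite (_ : D = setT `&` (fun p => Phi p.1 p.2) @^-1` (~` A)); last by rewrite setTI.
  by apply: mPhi => //; exact: measurableC.
have mDy x : measurable (ysection D x) by exact: measurable_ysection.
pose A' := [set x | leb (ysection D x) = 0%E].
have mA' : measurable A'.
  rewrite (_ : A' = setT `&` (leb \o ysection D) @^-1` [set 0%E]).
    by apply: measurable_fun_ysection => //; exact: emeasurable_set1.
  by rewrite setTI.
have A'inv s : Phi s @^-1` A' = A'.
  have E x : leb (ysection D (Phi s x)) = leb (ysection D x).
    rewrite -(lebesgue_shift s (mDy x)); congr (leb _).
    by apply/seteqP; split=> t; rewrite /ysection/= !inE /D/= PhiD.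
  by apply/seteqP; split=> x; rewrite /A' /= E.
have AA' : {ae mu, forall x, A x <-> A' x}.
  have mQ : measurable [set p : measurableTypeR R * T | A (Phi p.1 p.2) <-> A p.2].
    pose E1 : set (measurableTypeR R * T) := [set p | A (Phi p.1 p.2)].
    pose E2 : set (measurableTypeR R * T) := [set p | A p.2].
    have m1 : measurable E1.
      by rewrite -[E1]setTI; exact: (mPhi measurableT mA).
    have m2 : measurable E2.
      by rewrite -[E2]setTI; exact: (@measurable_snd _ _ (measurableTypeR R) T measurableT _ mA).
    rewrite (_ : mkset _ = (E1 `&` E2) `|` (~` E1 `&` ~` E2)).
      by apply: measurableU; apply: measurableI => //; exact: measurableC.
    apply/seteqP; split=> p /=; last by move=> [[h1 h2]|[h1 h2]]; split.
    by move=> h; have [h2|h2] := pselect (A p.2); [left|right]; split=> //; apply/h.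
  have /(ae_section_pred leb mu mQ) : {ae leb, forall t, {ae mu, forall x, A (Phi t x) <-> A x}}.
    exact: aeW.
  apply: filterS => x h; split=> [Ax|A'x].
    apply/negligibleP; first exact: mDy.
    apply: negligibleS h => t; rewrite /ysection/= inE/= => nA; rewrite -/(~ _) => e.
    by apply: nA; apply/e.
  (* If [x] were not in [A], its orbit would be outside [A] at almost every time and inside at
     almost every time, and the real line would be null. *)
  apply: contrapT => nA.
  have : {ae leb, forall t : measurableTypeR R, False}.
    have h' : {ae leb, forall t, A (Phi t x)}.
      exists (ysection D x); split=> // t /=.
      by rewrite /ysection/= inE.
    by apply: filterS2 h h' => t e /e.
  move=> [N [mN N0 sub]]; have NT : N = setT by apply/seteqP; split=> // t _; apply: sub.
  have : (leb `[0%R, 1%R]%classic <= leb N)%E.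
    by apply: le_measure; rewrite ?inE// NT.
  by rewrite N0 lebesgue_measure_itv/= lte_fin ltr01 oppr0 adde0 lee_fin ler10.
have -> : mu A = mu A' by exact: ae_measure_eq.
exact: erg.2.
Qed.

End ErgodicFlow.

Section Eigenfunctions.
Context {R : realType} {d : measure_display} {T : measurableType d}.
Variables (mu : probability T R) (Phi : R -> T -> T).
Hypothesis mPhi : flow_measurable Phi.
Hypothesis PhiD : forall s t x, Phi (s + t) x = Phi s (Phi t x).
Hypothesis erg : ergodic_invariant mu Phi.

Lemma ae_lt_Rintegral (u : T -> R) : measurable_fun setT u ->
  mu.-integrable setT (fun x => (u x)%:E) ->
  ~ {ae mu, forall x, u x < \int[mu]_x u x}.
Proof.
move=> mu_ iu h; set c := \int[mu]_x u x in h.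
have mcu : measurable_fun setT (fun x => (c - u x)%:E).
  by apply/measurable_EFinP; apply: measurable_funB => //; exact: measurable_cst.
have icst : mu.-integrable setT (fun=> c%:E) by exact: finite_measure_integrable_cst.
have i0 : (\int[mu]_x (c - u x)%:E = 0)%E.
  under eq_integral do rewrite EFinB.
  rewrite integralB_EFin// integral_cst// [X in (_ * X)%E]probability_setT mule1.
  by rewrite /c /Rintegral fineK ?subee// integrable_fin_num.
have : ae_eq mu setT (fun x => (c - u x)%:E) (cst 0%E).
  apply/(ae_eq_integral_abs mu measurableT mcu); rewrite -i0.
  apply: ae_eq_integral => //; first exact: measurableT_comp.
  by apply: filterS h => x xc _ /=; rewrite ger0_norm// subr_ge0 ltW.
move=> h2; have : {ae mu, forall x : T, False}.
  apply: filterS2 h h2 => x xc /(_ I) [/eqP]; rewrite subr_eq0 => /eqP cu.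
  by move: xc; rewrite cu ltxx.
move=> [N [mN N0 sub]].
have : (mu setT <= mu N)%E by apply: le_measure; rewrite ?inE// => x _; exact: sub.
by rewrite probability_setT N0 lee_fin ler10.
Qed.

Lemma ae_measure1 (A : set T) : measurable A -> mu A = 1%E -> {ae mu, forall x, A x}.
Proof.
move=> mA A1; apply: ae_of_null => //.
by rewrite probability_setC// A1 subee.
Qed.

(** The sets where [u] is below, or above, its mean are almost invariant, so each has measure 0 or
    1; measure 1 is incompatible with the mean. *)
Lemma ae_invariant_real (u : T -> R) : measurable_fun setT u ->
  mu.-integrable setT (fun x => (u x)%:E) ->
  (forall t, {ae mu, forall x, u (Phi t x) = u x}) ->
  {ae mu, forall x, u x = \int[mu]_x u x}.
Proof.
move=> mu_ iu inv; set c := \int[mu]_x u x.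
have inv_set (Q : R -> Prop) t : {ae mu, forall x, [set y | Q (u y)] (Phi t x) <-> [set y | Q (u y)] x}.
  by apply: filterS (inv t) => x /= ->.
have mlt : measurable [set x | u x < c].
  rewrite (_ : mkset _ = setT `&` u @^-1` `]-oo, c[%classic); first exact: mu_.
  by rewrite setTI; apply/seteqP; split=> x /=; rewrite in_itv.
have mgt : measurable [set x | c < u x].
  rewrite (_ : mkset _ = setT `&` u @^-1` `]c, +oo[%classic); first exact: mu_.
  by rewrite setTI; apply/seteqP; split=> x /=; rewrite in_itv/= andbT.
have l0 : mu [set x | u x < c] = 0%E.
  have [//|h1] := ae_invariant_set mPhi PhiD erg mlt (inv_set (fun y => y < c)).
  by case: (ae_lt_Rintegral mu_ iu); exact: (ae_measure1 mlt h1).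
have g0 : mu [set x | c < u x] = 0%E.
  have [//|h1] := ae_invariant_set mPhi PhiD erg mgt (inv_set (fun y => c < y)).
  have iNu : mu.-integrable setT (fun x => (- u x)%:E).
    by have := integrable_scale (-1) iu; under eq_fun do rewrite mulN1r.
  have mNu : measurable_fun setT (fun x => - u x) by exact: measurableT_comp.
  case: (ae_lt_Rintegral mNu iNu).
  have -> : \int[mu]_x (- u x) = - c.
    by under eq_Rintegral do rewrite -mulN1r; rewrite RintegralZl// mulN1r.
  by apply: filterS (ae_measure1 mgt h1) => x /=; rewrite ltrN2.
have a1 := ae_of_null (measurableC mlt); have a2 := ae_of_null (measurableC mgt).
rewrite !setCK in a1 a2; have {}a1 := a1 _ mu l0; have {}a2 := a2 _ mu g0.
apply: filterS2 a1 a2 => x /= h1 h2.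
by apply/eqP; rewrite eq_le; apply/andP; split; rewrite leNgt; apply/negP.
Qed.

Lemma ae_invariant_constant (F : T -> R[i]) : in_L2 mu F ->
  (forall t, {ae mu, forall x, F (Phi t x) = F x}) -> ae_constant mu F.
Proof.
move=> LF inv; have [i1 i2] := cintegrable_L2 LF; have [m1 m2] := in_L2_cmeas LF.
have h1 : {ae mu, forall x, complex.Re (F x) = \int[mu]_x complex.Re (F x)}.
  by apply: ae_invariant_real => // t; apply: filterS (inv t) => x ->.
have h2 : {ae mu, forall x, complex.Im (F x) = \int[mu]_x complex.Im (F x)}.
  by apply: ae_invariant_real => // t; apply: filterS (inv t) => x ->.
exists (cint mu F); apply: filterS2 h1 h2 => x e1 e2.
exact: eq_complexP.
Qed.

(** Products of square integrable functions may leave L^2. With a bound at every point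
    eigenfunctions can be multiplied, which makes the frequencies a group. *)
Definition unimodular_eigenfunction (w : R) (u : T -> R[i]) :=
  [/\ cmeas u, forall x, normc (u x) <= 1, {ae mu, forall x, normc (u x) = 1} &
    forall t, {ae mu, forall x, u (Phi t x) = cis (w * t) * u x}].

Lemma ueig_eigen w u : unimodular_eigenfunction w u -> L2_eigenfunction mu Phi w u.
Proof.
move=> [mu_ u1 ue eq]; split=> //; first exact: in_L2_bounded u1.
move=> h; have : {ae mu, forall x : T, False}.
  by apply: filterS2 ue h => x h1 h2; move: h1; rewrite h2 normc0 => /eqP; rewrite eq_sym oner_eq0.
move=> [N [mN N0 sub]].
have : (mu setT <= mu N)%E by apply: le_measure; rewrite ?inE// => x _; exact: sub.
by rewrite probability_setT N0 lee_fin ler10.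
Qed.

(** The modulus of [F] is invariant, hence almost everywhere a constant [r > 0], and [F / r] is
    unimodular almost everywhere. *)
Lemma eigen_ueig w F : L2_eigenfunction mu Phi w F ->
  exists u, unimodular_eigenfunction w u.
Proof.
move=> [LF F0 eq]; have mF := in_L2_cmeas LF; have mn := measurable_normc mF.
have [_ iF] := (in_L2P mu F).1 LF.
have iN : mu.-integrable setT (fun x => (normc (F x))%:E).
  have i1 : mu.-integrable setT (fun x => (1 + normc (F x) ^+ 2)%:E).
    under eq_fun do rewrite EFinD; apply: integrableD => //.
    exact: finite_measure_integrable_cst.
  apply: integrable_le i1 _ => // x; rewrite ger0_norm ?normc_ge0//.
  by have := sqr_ge0 (normc (F x) - 1); have := normc_ge0 (F x); nra.
pose r := \int[mu]_x normc (F x).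
have hr : {ae mu, forall x, normc (F x) = r}.
  apply: ae_invariant_real => // t; apply: filterS (eq t) => x ->.
  by rewrite normcM normc_cis mul1r.
have r0 : 0 <= r by apply: Rintegral_ge0 => x _; exact: normc_ge0.
have rn0 : r != 0.
  apply/eqP => e; apply: F0; apply: filterS hr => x; rewrite e; exact: eq0_normc.
have rp : 0 < r by rewrite lt_def rn0.
(* Cutting off outside this conull set gives the bound by 1 at every point. *)
pose A := [set x | normc (F x) <= r].
have mA : measurable A.
  rewrite (_ : A = setT `&` (fun x => normc (F x)) @^-1` `]-oo, r]%classic); first exact: mn.
  by rewrite setTI; apply/seteqP; split=> x /=; rewrite in_itv.
pose u x := (\1_A x)%:C%C * (((r^-1)%:C)%C * F x).
have uE : {ae mu, forall x, u x = ((r^-1)%:C)%C * F x}.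
  apply: filterS hr => x e; rewrite /u indicE mem_set ?mul1r//.
  by rewrite /A /= e.
exists u; split.
- by apply: cmeasM; [exact: cmeas_indic|exact: cmeasZ].
- move=> x; rewrite /u !normcM !normc_real [`|r^-1|]ger0_norm ?invr_ge0//.
  rewrite indicE; case: (boolP (x \in A)) => [/set_mem|_] /=; last by rewrite normr0 mul0r.
  by rewrite normr1 mul1r mulrC ler_pdivrMr// mul1r.
- apply: filterS2 uE hr => x -> e.
  by rewrite normcM normc_real ger0_norm ?invr_ge0// e mulVf.
- move=> t; have uE' := preserving_ae (flow_preserving mPhi erg t) uE.
  apply: filterS3 uE uE' (eq t) => x -> -> ->; ring.
Qed.

Lemma eigenfrequencyP w : eigenfrequency mu Phi w <-> exists u, unimodular_eigenfunction w u.
Proof.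
split=> [[F /eigen_ueig]//|[u /ueig_eigen h]]; by exists u.
Qed.

Lemma eigenfrequency0 : eigenfrequency mu Phi 0.
Proof.
apply/eigenfrequencyP; exists (fun=> 1); split.
- exact: cmeas_cst.
- by move=> x; rewrite normc1.
- by apply: aeW => x; rewrite normc1.
- by move=> t; apply: aeW => x; rewrite mul0r cis0 mulr1.
Qed.

Lemma eigenfrequencyN w : eigenfrequency mu Phi w -> eigenfrequency mu Phi (- w).
Proof.
move=> /eigenfrequencyP[u [mu_ u1 ue eq]]; apply/eigenfrequencyP.
exists (fun x => (u x)^*%C); split.
- exact: cmeasJ.
- by move=> x; rewrite normcJ.
- by apply: filterS ue => x; rewrite normcJ.
- by move=> t; apply: filterS (eq t) => x ->; rewrite rmorphM/= mulNr cisN.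
Qed.

Lemma eigenfrequencyD w w' : eigenfrequency mu Phi w -> eigenfrequency mu Phi w' ->
  eigenfrequency mu Phi (w + w').
Proof.
move=> /eigenfrequencyP[u [mu_ u1 ue eq]] /eigenfrequencyP[v [mv v1 ve eqv]].
apply/eigenfrequencyP; exists (fun x => u x * v x); split.
- exact: cmeasM.
- by move=> x; rewrite normcM mulr_ile1 ?normc_ge0.
- by apply: filterS2 ue ve => x e1 e2; rewrite normcM e1 e2 mulr1.
- move=> t; apply: filterS2 (eq t) (eqv t) => x -> ->; rewrite mulrDl cisD; ring.
Qed.

Lemma eigenfrequencyMz w (k : int) : eigenfrequency mu Phi w -> eigenfrequency mu Phi (k%:~R * w).
Proof.
move=> hw; have hn (n : nat) : eigenfrequency mu Phi (n%:R * w).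
  elim: n => [|n ih]; first by rewrite mul0r; exact: eigenfrequency0.
  by rewrite -natr1 mulrDl mul1r; exact: eigenfrequencyD.
case: k => n; first exact: hn.
by rewrite NegzE rmorphN/= mulNr; apply: eigenfrequencyN; exact: hn.
Qed.

Lemma eigenfrequency_sum (m : nat) (w : 'I_m -> R) (a : 'I_m -> int) :
  (forall i, eigenfrequency mu Phi (w i)) ->
  eigenfrequency mu Phi (\sum_(i < m) (a i)%:~R * w i).
Proof.
move=> hw; apply: big_ind => [|x y|i _]; [exact: eigenfrequency0|exact: eigenfrequencyD|].
exact: eigenfrequencyMz.
Qed.

End Eigenfunctions.

Lemma cis_surj {R : realType} (c : R[i]) : normc c = 1 -> exists a, c = cis a.
Proof.
move=> c1; have h : complex.Re c ^+ 2 + complex.Im c ^+ 2 = 1 by rewrite -normc_sqr c1 expr1n.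
have hre : -1 <= complex.Re c <= 1.
  have := normc_Re c; rewrite c1 ler_norml //.
have ca : cos (acos (complex.Re c)) = complex.Re c by rewrite acosK// in_itv.
have sa : sin (acos (complex.Re c)) = `|complex.Im c|.
  by rewrite sin_acos// -sqrtr_sqr; congr Num.sqrt; lra.
have [i0|i0] := leP 0 (complex.Im c).
  exists (acos (complex.Re c)); apply: eq_complexP; rewrite /= ?ca//.
  by rewrite sa ger0_norm.
exists (- acos (complex.Re c)); apply: eq_complexP; rewrite /= ?cosN ?sinN ?ca//.
by rewrite sa ltr0_norm// opprK.
Qed.

(** * Suspensions *)

Section Suspension.
Context {R : realType} {d : measure_display} {T : measurableType d}.
Variables (mu nu : probability T R) (rho : probability (measurableTypeR R) R).
Variables (Phi : R -> T -> T) (P : R) (tau : T -> R).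

Definition base (x : T) := Phi (- tau x) x.

(* [mu] is the measure of the suspension of [Phi P] under the constant roof [P]:
   [tau] is the time elapsed since the last visit of the base, and [base] the
   point of that visit. *)
Record suspension : Prop := Suspension {
  su_P : 0 < P ;
  su_meas : flow_measurable Phi ;
  su_0 : forall x, Phi 0 x = x ;
  su_D : forall s t x, Phi (s + t) x = Phi s (Phi t x) ;
  su_erg : ergodic_invariant mu Phi ;
  su_nu : preserving nu nu (Phi P) ;
  su_tau : measurable_fun setT (tau : T -> measurableTypeR R) ;
  su_itv : forall x, 0 <= tau x < P ;
  su_flow : forall t, {ae mu, forall x, exists k : int,
    tau (Phi t x) = tau x + t - k%:~R * P} ;
  su_indep : forall E B, measurable E -> measurable B ->
    mu (tau @^-1` E `&` base @^-1` B) = (rho E * nu B)%E ;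
  su_half : rho `[0, P / 2[%classic = (1 / 2)%:E }.

Hypothesis su : suspension.

Lemma PhiK t x : Phi (- t) (Phi t x) = x.
Proof. by rewrite -(su_D su) addNr (su_0 su). Qed.

Lemma PhiNK t x : Phi t (Phi (- t) x) = x.
Proof. by rewrite -(su_D su) subrr (su_0 su). Qed.

Lemma iter_Phi n x : iter n (Phi P) x = Phi (n%:R * P) x.
Proof.
elim: n => [|n ih]; first by rewrite mul0r (su_0 su).
by rewrite iterS ih -(su_D su) -natr1 mulrDl mul1r addrC.
Qed.

Lemma measurable_Phi t : measurable_fun setT (Phi t).
Proof. exact: (flow_measurable_at (su_meas su)). Qed.

Lemma mu_Phi t : preserving mu mu (Phi t).
Proof. exact: (flow_preserving (su_meas su) (su_erg su)). Qed.

Lemma nu_PhiN : preserving nu nu (Phi (- P)).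
Proof.
split=> [|A mA]; first exact: measurable_Phi.
have mA' : measurable (Phi (- P) @^-1` A).
  by rewrite -[_ @^-1` _]setTI; exact: measurable_Phi.
rewrite -((su_nu su).2 _ mA'); congr (nu _).
by apply/seteqP; split=> x /=; rewrite PhiK.
Qed.

Lemma nu_Phi_int (k : int) : preserving nu nu (Phi (k%:~R * P)).
Proof.
case: k => n.
  have := preserving_iter (su_nu su) n; rewrite (_ : iter n (Phi P) = Phi (n%:R * P))//.
  by apply/funext => x; exact: iter_Phi.
have iterN j x : iter j (Phi (- P)) x = Phi (- (j%:R * P)) x.
  elim: j => [|j ih]; first by rewrite mul0r oppr0 (su_0 su).
  by rewrite iterS ih -(su_D su) -natr1 mulrDl mul1r opprD addrC.
have := preserving_iter nu_PhiN n.+1.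
rewrite (_ : iter n.+1 (Phi (- P)) = Phi ((Negz n)%:~R * P))//.
by apply/funext => x; rewrite iterN NegzE rmorphN/= mulNr.
Qed.

Lemma measurable_base : measurable_fun setT base.
Proof.
have -> : base = (fun p : measurableTypeR R * T => Phi p.1 p.2) \o (fun x => (- tau x : measurableTypeR R, x)).
  by [].
apply: measurableT_comp; first exact: (su_meas su).
apply/measurable_fun_pair => //; apply: measurableT_comp => //; exact: (su_tau su).
Qed.

Definition coord (x : T) : measurableTypeR R * T := (tau x, base x).

Lemma measurable_coord : measurable_fun setT coord.
Proof. by apply/measurable_fun_pair => //; [exact: (su_tau su)|exact: measurable_base]. Qed.

Lemma mu_coord : preserving mu (rho \x nu)%E coord.
Proof.
split; first exact: measurable_coord.
move=> A mA; apply/esym.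
apply: (product_measure_unique (m' := pushforward mu coord)) => //; first exact: measurable_coord.
by move=> mc E B mE mB; rewrite -su_indep.
Qed.

Lemma mu_base : preserving mu nu base.
Proof.
split; first exact: measurable_base.
move=> A mA; have := su_indep su (measurableT : measurable [set: measurableTypeR R]) mA.
by rewrite preimage_setT setTI probability_setT mul1e.
Qed.

Lemma base_flow t x (k : int) : tau (Phi t x) = tau x + t - k%:~R * P ->
  base (Phi t x) = Phi (k%:~R * P) (base x).
Proof.
by move=> e; rewrite /base e -!(su_D su); congr (Phi _ x); ring.
Qed.

(** In the coordinates (height, base point) [mu] is a product and [Phi (tau x) (base x) = x], so
    this is Fubini for the exceptional null set. *)
Lemma ae_suspension (Q : T -> Prop) : {ae mu, forall x, Q x} ->
  {ae rho, forall s, {ae nu, forall x, Q (Phi s x)}}.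
Proof.
move=> [N [mN N0 sub]].
pose D : set (measurableTypeR R * T) := (fun p => Phi p.1 p.2) @^-1` N.
have mD : measurable D by rewrite -[D]setTI; exact: (su_meas su).
have D0 : ((rho \x nu) D = 0)%E.
  rewrite -(mu_coord.2 _ mD) -N0; congr (mu _).
  by apply/seteqP; split=> x; rewrite /D /= -/(base x) /base PhiNK.
have h : {ae rho, forall s, nu (xsection D s) = 0%E}.
  have mx := measurable_fun_xsection nu mD.
  have : ae_eq rho setT (nu \o xsection D) (cst 0%E).
    apply/(ae_eq_integral_abs rho measurableT mx); rewrite -D0.
    by apply: eq_integral => s _; rewrite gee0_abs.
  by apply: filterS => s /(_ I).
apply: filterS h => s h; exists (xsection D s); split=> //.
  exact: measurable_xsection.
by move=> x nQ; rewrite /xsection/= inE /D/=; apply: sub.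
Qed.

Lemma ae_exists {d' : measure_display} {T' : measurableType d'} (m : probability T' R) (Q : T' -> Prop) :
  {ae m, forall x, Q x} -> exists x, Q x.
Proof.
move=> [N [mN N0 sub]]; apply: contrapT => /forallNP h.
have : (m setT <= m N)%E by apply: le_measure; rewrite ?inE// => x _; apply: sub; exact: h.
by rewrite probability_setT N0 lee_fin ler10.
Qed.

(** The eigenfunction is restricted to the translate of the base by a good time [s]; since [Phi s]
    commutes with [Phi P], the eigenvalue is the same. *)
Lemma eigenfrequency_map_eigenfunction w : eigenfrequency mu Phi w ->
  exists f, map_eigenfunction nu (Phi P) (cis (w * P)) f.
Proof.
move=> /(eigenfrequencyP (su_meas su) (su_D su) (su_erg su)) [u [mu_ u1 ue eq]].
have [s [h1 h2]] : exists s, {ae nu, forall x, normc (u (Phi s x)) = 1} /\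
    {ae nu, forall x, u (Phi P (Phi s x)) = cis (w * P) * u (Phi s x)}.
  apply: (ae_exists (m := rho)); have h1 := ae_suspension ue.
  have h2 := ae_suspension (eq P); by apply: (@filterS2 _ _ (ae_filter_ringOfSetsType rho)) h1 h2 => s; split.
exists (fun x => u (Phi s x)).
have ms : cmeas (fun x => u (Phi s x)) by apply: cmeas_comp => //; exact: measurable_Phi.
split.
- by apply: in_L2_bounded => // x; exact: u1.
- move=> h; have [x] : exists x : T, False; last by [].
  apply: (ae_exists (m := nu)); apply: filterS2 h1 h => x e1 e2.
  by move: e1; rewrite e2 normc0 => /eqP; rewrite eq_sym oner_eq0.
- by apply: filterS h2 => x; rewrite -!(su_D su) addrC.
Qed.

Lemma map_eigenvalue_norm c f : map_eigenfunction nu (Phi P) c f -> normc c = 1.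
Proof.
move=> [Lf f0 eq]; have sh := semi_hilbert_L2 nu.
have mf := in_L2_cmeas Lf; have n0 : hnorm (inner nu) f != 0.
  by apply/eqP => /(hnorm_eq0P Lf).
have e1 : hnorm (inner nu) (fun x => f (Phi P x)) = hnorm (inner nu) f.
  by rewrite /hnorm (preserving_inner (su_nu su)).
have e2 : hnorm (inner nu) (fun x => f (Phi P x)) = hnorm (inner nu) (fun x => c * f x).
  apply: hnorm_ae => //; last exact: cmeasZ.
  by apply: cmeas_comp => //; exact: measurable_Phi.
have := hnormZ sh c Lf; rewrite -[_ *: _]/(fun x => c * f x) -e2 e1.
by move=> /esym h; apply: (mulIf n0); rewrite mul1r.
Qed.

(** All integers are needed because the flow for a time of either sign crosses the base an integer
    number of times. *)
Lemma map_eigen_int a f (k : int) : cmeas f ->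
  {ae nu, forall x, f (Phi P x) = cis (a * P) * f x} ->
  {ae nu, forall x, f (Phi (k%:~R * P) x) = cis (a * (k%:~R * P)) * f x}.
Proof.
move=> mf eq; have hn (n : nat) : {ae nu, forall x, f (Phi (n%:R * P) x) = cis (a * (n%:R * P)) * f x}.
  elim: n => [|n ih]; first by apply: aeW => x; rewrite mul0r mulr0 cis0 mul1r (su_0 su).
  have ih' := preserving_ae (su_nu su) ih.
  apply: filterS2 eq ih' => x e1 e2.
  have -> : n.+1%:R * P = n%:R * P + P by rewrite -natr1 mulrDl mul1r.
  by rewrite (su_D su) e2 e1 mulrA -cisD mulrDr.
case: k => n; first exact: hn.
have := preserving_ae (nu_Phi_int (Negz n)) (hn n.+1).
apply: filterS => x; rewrite -(su_D su).
have -> : n.+1%:R * P + (Negz n)%:~R * P = 0 by rewrite NegzE rmorphN/= mulNr subrr.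
rewrite (su_0 su) => ->; rewrite mulrA -cisD -mulrDr.
have -> : (Negz n)%:~R * P + n.+1%:R * P = 0 by rewrite NegzE rmorphN/= mulNr addNr.
by rewrite mulr0 cis0 mul1r.
Qed.

Lemma ae_forall_int {d' : measure_display} {T' : measurableType d'} (m : probability T' R)
  (Q : int -> T' -> Prop) : (forall k, {ae m, forall x, Q k x}) ->
  {ae m, forall x, forall k, Q k x}.
Proof.
move=> h; have h1 : {ae m, forall x, forall n : nat, Q (Posz n) x}.
  by apply/ae_foralln => n; exact: h.
have h2 : {ae m, forall x, forall n : nat, Q (Negz n) x}.
  by apply/ae_foralln => n; exact: h.
by apply: filterS2 h1 h2 => x e1 e2 [n|n].
Qed.

(** Each crossing of the base multiplies [f (base x)] by [cis (a * P)] and lowers the height by [P].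
    The two effects cancel in the product, leaving the factor [cis (a * t)]. *)
Lemma map_eigen_extend a f : in_L2 nu f ->
  {ae nu, forall x, f (Phi P x) = cis (a * P) * f x} ->
  in_L2 mu (fun x => cis (a * tau x) * f (base x)) /\
  forall t, {ae mu, forall x, cis (a * tau (Phi t x)) * f (base (Phi t x)) =
    cis (a * t) * (cis (a * tau x) * f (base x))}.
Proof.
move=> Lf eq; have mf := in_L2_cmeas Lf; split.
  apply: (@in_L2_mul _ _ _ _ _ _ 1).
  - apply: cmeas_cis; apply: measurable_funM; first exact: measurable_cst.
    exact: (su_tau su).
  - by move=> x; rewrite normc_cis.
  - exact: (preserving_in_L2 mu_base mf).1.
move=> t; have h := preserving_ae mu_base (ae_forall_int (fun k => map_eigen_int k mf eq)).
apply: filterS2 (su_flow su t) h => x [k e] h.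
rewrite (base_flow e) h e !mulrA -!cisD; congr (cis _ * _); ring.
Qed.

Lemma map_eigen_frequency c f : map_eigenfunction nu (Phi P) c f ->
  exists2 a, c = cis (a * P) & eigenfrequency mu Phi a.
Proof.
move=> hf; have [b cb] := cis_surj (map_eigenvalue_norm hf).
have [Lf f0 eq] := hf; exists (b / P); first by rewrite divfK// gt_eqF ?(su_P su).
have [|L E] := @map_eigen_extend (b / P) f Lf.
  by apply: filterS eq => x ->; rewrite divfK ?cb// gt_eqF ?(su_P su).
exists (fun x => cis (b / P * tau x) * f (base x)); split=> // h; apply: f0.
apply: (preserving_ae_inv mu_base (in_L2_cmeas Lf)).
apply: filterS h => x /eqP; rewrite mulf_eq0 (negbTE (cis_neq0 _)) => /eqP //.
Qed.

End Suspension.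

(** * Primitive vectors of a lattice *)

Section Lattice.
Context {R : realType}.

(* Smith normal form: a primitive vector of a lattice is part of a basis. *)
Lemma primitive_basis (m : nat) (w : 'I_m.+1 -> R) (a : 'I_m.+1 -> int) :
  let comb (b : 'I_m.+1 -> int) := \sum_i (b i)%:~R * w i in
  (forall (b : 'I_m.+1 -> int) (k : int), comb a = k%:~R * comb b -> `|k|%N = 1%N) ->
  exists g : 'I_m -> 'I_m.+1 -> int, forall b, exists (k : int) (c : 'I_m -> int),
    comb b = k%:~R * comb a + \sum_j (c j)%:~R * comb (g j).
Proof.
move=> comb prim; pose A : 'M[int]_(1, m.+1) := \row_i a i.
have [L uL [Q uQ [d _ AE]]] := int_Smith_normal_form A.
(* Up to sign the content of the vector [a]. The first row of [Q] is the primitive vector of which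
   [a] is a multiple, and the other rows complete it to a basis. *)
pose kap : int := L 0 0 * d`_0.
pose q l i : int := Q l i.
have aE i : a i = kap * q ord0 i.
  have := congr1 (fun M : 'M[int]_(1, m.+1) => M 0 i) AE.
  rewrite /A mxE => ->; rewrite !mxE (bigD1 ord0)//= big1 ?addr0; last first.
    move=> l l0; rewrite !mxE big_ord1 !mxE /= (_ : (0%N == l) = false) ?mulr0n ?mulr0 ?mul0r//.
    by apply/negbTE; rewrite eq_sym; exact: l0.
  by rewrite mxE big_ord1 !mxE.
have combA : comb a = kap%:~R * comb (q ord0).
  rewrite /comb mulr_sumr; apply: eq_bigr => i _; rewrite aE rmorphM/= mulrA //.
have kap1 := prim _ _ combA.
have kap2 : kap * kap = 1.
  have sq (k : int) : `|k|%N = 1%N -> k * k = 1 by case: k => n /= => [->|[->]].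
  exact: sq.
exists (fun j => q (lift ord0 j)) => b.
pose e : 'rV[int]_m.+1 := (\row_i b i) *m invmx Q.
have bE i : b i = \sum_l e 0 l * q l i.
  have := congr1 (fun M : 'M[int]_(1, m.+1) => M 0 i) (mulmxKV uQ (\row_i b i)).
  by rewrite !mxE => <-.
exists (e 0 ord0 * kap), (fun j => e 0 (lift ord0 j)).
have -> : comb b = \sum_l (e 0 l)%:~R * comb (q l).
  rewrite /comb; under [RHS]eq_bigr do rewrite mulr_sumr.
  rewrite exchange_big; apply: eq_bigr => i _; rewrite bE rmorph_sum mulr_suml.
  by apply: eq_bigr => l _; rewrite rmorphM/= mulrA.
rewrite big_ord_recl combA mulrA -rmorphM/= -mulrA kap2 mulr1 //.
Qed.
End Lattice.

(** * Eigenfunctions and weak mixing of the return map *)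

Section Discrete.
Context {R : realType} {d : measure_display} {T : measurableType d}.
Variables (mu nu : probability T R) (rho : probability (measurableTypeR R) R).
Variables (Phi : R -> T -> T) (P : R) (tau : T -> R).
Hypothesis su : suspension mu nu rho Phi P tau.

Lemma map_generated_suspension (omega : R) (m : nat) (w : 'I_m.+1 -> R) (zs : 'I_m.+1 -> T -> R[i]) :
  cis (omega * P) = 1 -> eigenfrequency mu Phi omega -> primitive_frequency mu Phi omega ->
  generated_by_independent mu Phi w zs -> map_generated_by nu (Phi P) m.
Proof.
move=> omP om_eig om_prim [zs_eig _ gen].
have fsum := eigenfrequency_sum (su_meas su) (su_D su) (su_erg su).
have w_eig i : eigenfrequency mu Phi (w i) by exists (zs i).
have [a aE] := gen _ om_eig.
have [|g gP] := @primitive_basis R m w a.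
  move=> b k e; apply: (om_prim (\sum_i (b i)%:~R * w i)); first exact: fsum.
  by rewrite aE.
pose G j := \sum_i (g j i)%:~R * w i.
have /choice[h hP] : forall j, exists f, map_eigenfunction nu (Phi P) (cis (G j * P)) f.
  by move=> j; apply: (eigenfrequency_map_eigenfunction su); exact: fsum.
exists (fun j => cis (G j * P)), h; split=> // c f hf.
have [al -> al_eig] := map_eigen_frequency su hf.
have [b bE] := gen _ al_eig; have [k [e E]] := gP b.
exists e; rewrite bE E -aE mulrDl cisD -mulrA cisMz omP exp1rz mul1r mulr_suml.
rewrite (big_morph (fun x => cis x) (id1 := 1) (op1 := *%R) (@cisD R) (cis0)).
by apply: eq_bigr => j _; rewrite -mulrA cisMz.
Qed.

(** By primitivity [omega] is the generator [w0] up to sign, so every frequency is a multiple of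
    [omega] and every eigenvalue is 1. The extension of [f] to the flow is then invariant, hence
    constant by ergodicity. *)
Lemma map_eigenfunction_constant (omega : R) (w0 : R) :
  cis (omega * P) = 1 -> eigenfrequency mu Phi omega -> primitive_frequency mu Phi omega ->
  eigenfrequency mu Phi w0 -> 
  (forall w', eigenfrequency mu Phi w' -> exists a : int, w' = a%:~R * w0) ->
  forall c f, map_eigenfunction nu (Phi P) c f -> ae_constant nu f.
Proof.
move=> omP om_eig om_prim w0_eig gen c f hf.
have [al cE al_eig] := map_eigen_frequency su hf.
have [k omE] := gen _ om_eig; have [j alE] := gen _ al_eig.
have k1 := om_prim _ _ w0_eig omE.
have c1 : c = 1.
  have w0E : w0 = k%:~R * omega.
    have sq (i : int) : `|i|%N = 1%N -> i * i = 1 by case: i => n /= => [->|[->]].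
    by rewrite omE mulrA -rmorphM/= sq// mul1r.
  by rewrite cE alE w0E -!mulrA !cisMz omP !exp1rz.
have [Lf f0 eq] := hf; have mf := in_L2_cmeas Lf.
have eq0 : {ae nu, forall x, f (Phi P x) = cis (0 * P) * f x}.
  by apply: filterS eq => x ->; rewrite c1 mul0r cis0.
have [L E] := map_eigen_extend su Lf eq0.
have [|b hb] := ae_invariant_constant (su_meas su) (su_D su) (su_erg su) L.
  by move=> t; apply: filterS (E t) => x ->; rewrite mul0r cis0 mul1r.
exists b; apply: (preserving_ae_inv (mu_base su) mf).
by apply: filterS hb => x; rewrite mul0r cis0 mul1r.
Qed.

(** On the functions of mean zero the Koopman operator has no eigenvector, as a constant of mean
    zero vanishes. The test function [g] is arbitrary in L^2 and is first centred, which does not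
    change the correlations. *)
Lemma map_weakly_mixing_of_constant :
  (forall c f, map_eigenfunction nu (Phi P) c f -> ae_constant nu f) ->
  map_weakly_mixing nu (Phi P).
Proof.
move=> hcst f g f0 Lg; have sh := semi_hilbert_L2 nu; have shm := semi_hilbert_mean_zero nu.
have iK := isometry_koopman_mean_zero (su_nu su).
pose c := cint nu g; pose g0 x := g x - c.
have Lg0 : in_L2 nu g0 by apply: in_L2B => //; exact: in_L2_cst.
have mg0 : mean_zero nu g0.
  apply/mean_zeroP; split=> //.
  rewrite /g0 (cintD (f := g) (g := fun=> - c)); last 2 first.
  - exact: cintegrable_L2.
  - by apply: cintegrable_L2; exact: in_L2_cst.
  by rewrite cint_cst subrr.
have E n : corr nu (iter n (Phi P)) f g = normc (inner nu (iter n (koopman (Phi P)) f) g0).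
  rewrite /corr iter_koopman; congr normc.
  have [Ln n0] := (mean_zeroP _ _).1 (isoH (iso_iter iK n) f0).
  rewrite iter_koopman in Ln n0.
  have -> : g = (fun x => g0 x + cst c x) by apply/funext => x; rewrite /g0 subrK.
  rewrite (ipDr sh (u := g0) (v := cst c) Lg0 (in_L2_cst nu c) Ln) inner_cst// n0 mul0r addr0.
  by congr (inner _ _); apply/funext => x; rewrite /g0 /= addrK.
have := weak_mixing_of_no_eigenvector shm iK _ f0 mg0.
rewrite /corr_avg /map_average => H.
under eq_cvg do under eq_bigr do rewrite E.
apply: H => theta h h0 he.
have [Lh ch] := (mean_zeroP nu h).1 h0; have mh := in_L2_cmeas Lh.
have [//|hn0] := eqVneq (hnorm (inner nu) h) 0.
have hE : map_eigenfunction nu (Phi P) (cis theta) h.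
  split=> //; first by move=> /(hnorm_eq0P Lh) e; rewrite e eqxx in hn0.
  have Ld : in_L2 nu (koopman (Phi P) h - cis theta *: h).
    by apply: in_L2B; [exact: (isoH iK h0).1|exact: in_L2Z].
  have /(hnorm_eq0P Ld) := he.
  by apply: filterS => x /eqP; rewrite subr_eq0 => /eqP.
have [b hb] := hcst _ _ hE.
have b0 : b = 0.
  by rewrite -ch -[LHS](cint_cst nu b); apply/esym/cint_ae => //; exact: cmeas_cst.
apply/(hnorm_eq0P Lh); apply: filterS hb => x ->; exact: b0.
Qed.

End Discrete.

(** * Mixing of the suspension flow *)

Section Product.
Context {R : realType} {d : measure_display} {T : measurableType d}.
Variables (mu nu : probability T R) (rho : probability (measurableTypeR R) R).
Variables (Phi : R -> T -> T) (P : R) (tau : T -> R).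
Hypothesis su : suspension mu nu rho Phi P tau.
Local Notation base := (base Phi tau).

Lemma snd_preserving : preserving (rho \x nu)%E nu snd.
Proof.
split=> [|A mA]; first exact: measurable_snd.
rewrite (_ : _ @^-1` _ = setT `*` A); last by apply/seteqP; split=> x //= [].
transitivity (rho setT * nu A)%E; last by rewrite probability_setT mul1e.
exact: product_measure1E.
Qed.

Lemma product_Rintegral (u : measurableTypeR R -> R) (v : T -> R) (B : R) :
  measurable_fun setT u -> (forall s, `|u s| <= B) ->
  measurable_fun setT v -> nu.-integrable setT (fun x => (v x)%:E) ->
  mu.-integrable setT (fun x => (u (tau x) * v (base x))%:E) /\
  \int[mu]_x (u (tau x) * v (base x)) = (\int[rho]_s u s) * (\int[nu]_x v x).
Proof.
move=> mu_ uB mv iv; have B0 : 0 <= B by exact: le_trans (normr_ge0 _) (uB 0).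
pose f (p : measurableTypeR R * T) := u p.1 * v p.2.
have mf : measurable_fun setT f.
  apply: measurable_funM; first exact: (measurableT_comp mu_ measurable_fst).
  exact: (measurableT_comp mv measurable_snd).
have i2 : (rho \x nu)%E.-integrable setT (fun p : measurableTypeR R * T => (B * `|v p.2|)%:E).
  apply: integrable_scale.
  have mn : measurable_fun setT (fun x => `|v x|) by exact: measurableT_comp.
  apply: (preserving_integrable snd_preserving mn).1.
  by have := integrable_norm iv.
have iF : (rho \x nu)%E.-integrable setT (fun p => (f p)%:E).
  by apply: integrable_le i2 _ => // p; rewrite normrM ler_wpM2r.
have iu : rho.-integrable setT (fun s => (u s)%:E).
  apply: (integrable_le (v := fun=> B)) => //.
  exact: finite_measure_integrable_cst.
split; first exact: (preserving_integrable (mu_coord su) mf).1.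
rewrite (preserving_Rintegral (mu_coord su) mf iF) /Rintegral -(integral12_prod_meas1 iF).
have -> : (\int[rho]_x fubini_F nu (fun p => (f p)%:E) x =
    \int[rho]_s (u s * \int[nu]_x v x)%:E)%E.
  apply: eq_integral => s _; rewrite /fubini_F /f /=.
  under eq_integral do rewrite EFinM.
  by rewrite integralZl// EFinM /Rintegral fineK// integrable_fin_num.
exact: (@RintegralZr _ _ _ rho setT u (\int[nu]_x v x) measurableT iu).
Qed.

Lemma product_cint (th : measurableTypeR R -> R[i]) (h : T -> R[i]) (B : R) :
  cmeas th -> (forall s, normc (th s) <= B) -> cmeas h -> cintegrable nu h ->
  cint mu (fun x => th (tau x) * h (base x)) = cint rho th * cint nu h.
Proof.
move=> [m1 m2] thB [n1 n2] [i1 i2].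
have B1 s : `|complex.Re (th s)| <= B by exact: le_trans (normc_Re _) (thB s).
have B2 s : `|complex.Im (th s)| <= B by exact: le_trans (normc_Im _) (thB s).
have [j11 e11] := product_Rintegral m1 B1 n1 i1.
have [j12 e12] := product_Rintegral m1 B1 n2 i2.
have [j21 e21] := product_Rintegral m2 B2 n1 i1.
have [j22 e22] := product_Rintegral m2 B2 n2 i2.
apply: eq_complexP; rewrite ?ReM ?ImM /=.
  under eq_Rintegral do rewrite ReM.
  by rewrite RintegralB// e11 e22.
under eq_Rintegral do rewrite ImM.
by rewrite RintegralD// e12 e21.
Qed.

Lemma product_inner (th : measurableTypeR R -> R[i]) f g (B : R) :
  cmeas th -> (forall s, normc (th s) <= B) -> in_L2 nu f -> in_L2 nu g ->
  cint mu (fun x => th (tau x) * (f (base x) * (g (base x))^*%C)) =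
  cint rho th * inner nu f g.
Proof.
move=> mth thB Lf Lg; rewrite (product_cint (h := fun x => f x * (g x)^*%C) mth thB)//.
  by apply: cmeasM; [exact: in_L2_cmeas Lf|exact: cmeasJ (in_L2_cmeas Lg)].
exact: cintegrable_inner.
Qed.

Lemma cint_indic (E : set (measurableTypeR R)) : measurable E ->
  cint rho (fun s => (\1_E s)%:C%C) = (fine (rho E))%:C%C.
Proof.
move=> mE; apply: eq_complexP => /=; rewrite /Rintegral.
  by rewrite integral_indic// setIT.
by rewrite integral_cst// mul0e.
Qed.

End Product.

(** * The discrete subspace when all frequencies are multiples of [2 pi / P] *)

Section Dperp.
Context {R : realType} {d : measure_display} {T : measurableType d}.
Variables (mu nu : probability T R) (rho : probability (measurableTypeR R) R).
Variables (Phi : R -> T -> T) (P : R) (tau : T -> R).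
Hypothesis su : suspension mu nu rho Phi P tau.
Local Notation base := (base Phi tau).
Local Notation om := (pi *+ 2 / P : R).
Local Notation Dperp := (orthocompl mu (flow_discrete mu Phi)).
Local Notation hn := (hnorm (inner mu)).

Let P0 : 0 < P := su_P su.
Let Pn0 : P != 0. Proof. by rewrite gt_eqF. Qed.
Let sh := semi_hilbert_L2 mu.

(** The Fourier characters in the height, of period [P]. *)
Definition zeta (k : int) (x : T) : R[i] := cis (k%:~R * om * tau x).

Lemma zeta_cmeas k : cmeas (zeta k).
Proof.
apply: cmeas_cis; apply: measurable_funM; first exact: measurable_cst.
exact: (su_tau su).
Qed.

Lemma zeta_norm k x : normc (zeta k x) = 1.
Proof. exact: normc_cis. Qed.

Lemma zeta_L2 k : in_L2 mu (zeta k).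
Proof. by apply: (@in_L2_bounded _ _ _ _ _ 1); [exact: zeta_cmeas|move=> x; rewrite zeta_norm]. Qed.

Lemma zetaD k j x : zeta k x * zeta j x = zeta (k + j) x.
Proof. by rewrite /zeta -cisD -!mulrDl -rmorphD. Qed.

Lemma zetaN k x : (zeta k x)^*%C = zeta (- k) x.
Proof. by rewrite /zeta -cisN -!mulNr -rmorphN. Qed.

Lemma zeta0 x : zeta 0 x = 1.
Proof. by rewrite /zeta !mul0r cis0. Qed.

Lemma zeta_unimodular k : unimodular_eigenfunction mu Phi (k%:~R * om) (zeta k).
Proof.
split; [exact: zeta_cmeas|by move=> x; rewrite zeta_norm|by apply: aeW => x; rewrite zeta_norm|].
move=> t; apply: filterS (su_flow su t) => x [j e].
(* The [j] crossings of the base change the argument by an integer multiple of [2 pi]. *)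
rewrite /zeta e (_ : _ * _ = k%:~R * om * t + k%:~R * om * tau x + (- (k * j))%:~R * (pi *+ 2)).
  by rewrite !cisD cis_2piz mulr1.
by rewrite rmorphN rmorphM/=; field.
Qed.

Lemma orthocompl_closed_span E f : (forall g, E g -> in_L2 mu g) ->
  in_L2 mu f -> (forall g, E g -> inner mu f g = 0) -> orthocompl mu (closed_span mu E) f.
Proof.
move=> EL Lf h; split=> // g [Lg hg]; apply: eq0_normc.
apply/eqP; rewrite eq_le normc_ge0 andbT; apply/ler_addgt0Pr => e e0; rewrite add0r.
pose B := hn f + 1; have B0 : 0 < B by rewrite ltr_wpDl// hnorm_ge0.
have [k [c [v [Ev hv]]]] := hg (e / B) (divr_gt0 e0 B0).
pose s : T -> R[i] := \sum_(i < k) c i *: v i.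
have sE x : s x = \sum_(i < k) c i * v i x by rewrite /s fct_sumE.
have Lv i : in_L2 mu (v i) by exact: EL.
have Ls : in_L2 mu s by apply: (sh_sum sh) => i; apply: in_L2Z.
have Lgs : in_L2 mu (g - s) by exact: in_L2B.
have h1 : hn (g - s) <= e / B.
  rewrite hnorm_leP ?divr_ge0 ?ltW//.
  rewrite (_ : (\int[mu]_x _)%E = (\int[mu]_x ((normc (g x - \sum_(i < k) c i * v i x)%R) ^+ 2)%:E)%E) ?ltW//.
  by apply: eq_integral => x _; rewrite -sE.
have -> : inner mu f g = inner mu f (g - s).
  rewrite (ipDr sh) ?(ipNr sh)//; last exact: (shN sh).
  rewrite (_ : inner mu f s = 0) ?subr0// (ip_sumr sh) //; last by move=> i; exact: in_L2Z.
  by rewrite big1// => i _; rewrite (ipZr sh)// h ?mulr0.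
rewrite (le_trans (cauchy_schwarz sh Lf Lgs))//.
apply: (@le_trans _ _ (B * (e / B))); last by rewrite mulrCA divff ?mulr1// gt_eqF.
by rewrite ler_pM ?hnorm_ge0// lerDl.
Qed.

Lemma Dperp_zeta F k : Dperp F -> inner mu F (zeta k) = 0.
Proof.
move=> [LF h]; apply: h; split; first exact: zeta_L2.
move=> e e0; exists 1%N, (fun=> 1), (fun=> zeta k); split.
  by move=> _; exists (k%:~R * om); apply: ueig_eigen; exact: zeta_unimodular.
rewrite (_ : (\int[mu]_x _ = 0)%E) ?lte_fin ?exprn_gt0//.
by apply: integral0_eq => x _; rewrite big_ord1 mul1r subrr normc0 expr0n.
Qed.

Hypothesis freq : forall w, eigenfrequency mu Phi w -> exists k : int, w = k%:~R * om.

(** Multiplication by [zeta (- k)] cancels the frequency, and ergodicity makes the product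
    constant. *)
Lemma eigenfunction_zeta w F : L2_eigenfunction mu Phi w F ->
  exists k (c : R[i]), {ae mu, forall x, F x = c * zeta k x}.
Proof.
move=> hF; have [k wE] : exists k : int, w = k%:~R * om by apply: freq; exists F.
have [LF _ eq] := hF; have [_ _ _ zeq] := zeta_unimodular (- k).
exists k; have L : in_L2 mu (fun x => zeta (- k) x * F x).
  by apply: in_L2_mul LF; [exact: zeta_cmeas|move=> x; rewrite zeta_norm].
have [t|c hc] := ae_invariant_constant (su_meas su) (su_D su) (su_erg su) L.
  apply: filterS2 (eq t) (zeq t) => x -> ->.
  rewrite wE rmorphN mulrACA -cisD (_ : _ + _ = 0) ?cis0 ?mul1r//; ring.
by exists c; apply: filterS hc => x <-; rewrite mulrAC zetaD addNr zeta0 mul1r.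
Qed.

Lemma Dperp_in F : in_L2 mu F -> (forall k, inner mu F (zeta k) = 0) -> Dperp F.
Proof.
move=> LF h; apply: orthocompl_closed_span => // g [w hg]; first by case: hg.
have [k [c hc]] := eigenfunction_zeta hg.
have mF := in_L2_cmeas LF; have Lz := zeta_L2 k.
have [/in_L2_cmeas mg _ _] := hg.
rewrite (inner_ae mF mF mg (cmeasZ c (zeta_cmeas k)) (aeW _ (fun=> erefl)) hc).
by rewrite -[X in inner _ _ X]/(c *: zeta k) (ipZr sh)// h mulr0.
Qed.

End Dperp.

(** * Density of products, and functions of the height *)

Section Density.
Context {R : realType} {d : measure_display} {T : measurableType d}.
Variables (mu nu : probability T R) (rho : probability (measurableTypeR R) R).
Variables (Phi : R -> T -> T) (P : R) (tau : T -> R).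
Hypothesis su : suspension mu nu rho Phi P tau.
Local Notation base := (base Phi tau).
Local Notation coord := (coord Phi tau).
Local Notation om := (pi *+ 2 / P : R).
Local Notation Dperp := (orthocompl mu (flow_discrete mu Phi)).
Local Notation hn := (hnorm (inner mu)).
Local Notation zeta := (zeta P tau).

Let P0 : 0 < P := su_P su.
Let Pn0 : P != 0. Proof. by rewrite gt_eqF. Qed.
Let sh := semi_hilbert_L2 mu.

(** The sets whose preimages are multiplier sets form a sigma-algebra, so it suffices to treat a
    generating family. *)
Lemma mult_sets_preimage (C : set (T -> R[i])) {d' : measure_display} {T' : measurableType d'}
  (phi : T -> T') (G : set (set T')) : closed_subspace mu C -> measurable = <<s G >> ->
  (forall E, G E -> mult_sets C (phi @^-1` E)) ->
  forall E, measurable E -> mult_sets C (phi @^-1` E).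
Proof.
move=> hC mG hG E; rewrite mG => /(_ [set E | mult_sets C (phi @^-1` E)]); apply.
split; last exact: hG.
have /(@sigma_algebra_image _ _ setT phi) := mult_sets_sigma hC.
by congr (sigma_algebra _ _); apply/funext => B; rewrite /image_set_system/= setTI.
Qed.

Definition product_fun (E : set (measurableTypeR R)) (f : T -> R[i]) (x : T) : R[i] :=
  (\1_E (tau x))%:C%C * f (base x).

Lemma product_L2 E f : measurable E -> in_L2 nu f -> in_L2 mu (product_fun E f).
Proof.
move=> mE Lf; apply: (@in_L2_mul _ _ _ _ _ _ 1).
- apply: (@cmeas_comp _ _ _ _ _ (fun s : measurableTypeR R => (\1_E s)%:C%C)).
    exact: (su_tau su).
  exact: cmeas_indic.
- by move=> x; exact: (@normc_indic _ _ (measurableTypeR R)).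
- exact: (preserving_in_L2 (mu_base su) (in_L2_cmeas Lf)).1.
Qed.

(* Indicators of the sets [coord @^-1` (E `*` B)] multiply the smallest closed
   subspace containing the products, hence so do all indicators. *)
Theorem product_density C : closed_subspace mu C ->
  (forall E f, measurable E -> in_L2 nu f -> C (product_fun E f)) ->
  forall F, in_L2 mu F -> C F.
Proof.
move=> hC hp.
pose Cm F := forall C', closed_subspace mu C' ->
  (forall E f, measurable E -> in_L2 nu f -> C' (product_fun E f)) -> C' F.
have hCm : closed_subspace mu Cm.
  split.
  - by move=> f /(_ C hC hp)/(cs_L2 hC).
  - by move=> f g hf hg C' hC' hp'; apply: (csD hC'); [exact: hf|exact: hg].
  - by move=> a f hf C' hC' hp'; apply: (csZ hC'); exact: hf.
  - move=> f Lf h C' hC' hp'; apply: (cs_lim hC') => // e /h[g [hg he]].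
    by exists g; split=> //; exact: hg.
have Cmp E f : measurable E -> in_L2 nu f -> Cm (product_fun E f).
  by move=> mE Lf C' hC' hp'; exact: hp'.
have mrect E B : measurable E -> measurable B -> mult_sets Cm (coord @^-1` (E `*` B)).
  move=> mE mB; set A := coord @^-1` _.
  have mA : measurable A.
    by rewrite -[A]setTI; apply: (measurable_coord su) => //; exact: measurableX.
  split=> //; split; first exact: cmeas_indic.
    by exists 1 => x; exact: normc_indic.
  (* Minimality of [Cm] is applied to the set of functions that the indicator of [A] multiplies into
     [Cm]. This set is closed because multiplication by an indicator is a contraction, and it
     contains the products because rectangles intersect in rectangles. *)
  move=> F hF; apply: (hF [set F | in_L2 mu F /\ Cm (fun x => (\1_A x)%:C%C * F x)] _ _).2.
    split.
    - by move=> f [].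
    - move=> f g [Lf hf] [Lg hg]; split; first exact: in_L2D.
      rewrite (_ : (fun x => _) = (fun x => (\1_A x)%:C%C * f x + (\1_A x)%:C%C * g x)).
        exact: (csD hCm).
      by apply/funext => x; rewrite mulrDr.
    - move=> a f [Lf hf]; split; first exact: in_L2Z.
      rewrite (_ : (fun x => _) = (fun x => a * ((\1_A x)%:C%C * f x))).
        exact: (csZ hCm).
      by apply/funext => x; rewrite mulrCA.
    - move=> f Lf h; split=> //; apply: (cs_lim hCm); first exact: in_L2_indic.
      move=> e /h[g [[Lg hg] he]]; exists (fun x => (\1_A x)%:C%C * g x); split=> //.
      apply: le_trans he; rewrite hnorm_leP ?hnorm_ge0//; last first.
        by apply: in_L2B; exact: in_L2_indic.
      rewrite -inner_sqrE; last exact: in_L2B.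
      have mgf : cmeas (fun x => g x - f x) by exact: in_L2_cmeas (in_L2B Lg Lf).
      apply: ge0_le_integral => //.
      + by move=> x _; rewrite lee_fin sqr_ge0.
      + apply/measurable_EFinP/measurable_normc_sqr/cmeasB.
          by apply: cmeasM; [exact: cmeas_indic|exact: in_L2_cmeas Lg].
        by apply: cmeasM; [exact: cmeas_indic|exact: in_L2_cmeas Lf].
      + by apply/measurable_EFinP/measurable_normc_sqr.
      + move=> x _; rewrite lee_fin ler_pXn2r ?nnegrE ?normc_ge0// -mulrBr normcM.
        by rewrite ler_piMl ?normc_ge0//; exact: normc_indic.
  move=> E' f mE' Lf; split; first exact: product_L2.
  rewrite (_ : (fun x => _) = product_fun (E `&` E') (fun x => (\1_B x)%:C%C * f x)).
    by apply: Cmp; [exact: measurableI|exact: in_L2_indic].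
  apply/funext => x; rewrite /product_fun.
  have -> : (\1_A x : R) = \1_E (tau x) * \1_B (base x).
    rewrite !indicE -natrM mulnb; congr ((_ : bool)%:R).
    by apply/idP/andP => [|[]]; rewrite !inE// => -[].
  rewrite (_ : \1_(E `&` E') (tau x) = \1_E (tau x) * \1_E' (tau x)) ?indicI//.
  by rewrite !rmorphM/=; ring.
move=> F LF; suff : Cm F by apply.
apply: closed_subspace_full LF => //; last first.
  rewrite (_ : (fun=> 1) = product_fun setT (fun=> 1)); last first.
    by apply/funext => x; rewrite /product_fun indicT !mulr1.
  by apply: Cmp => //; exact: in_L2_cst.
move=> A mA.
(* Every measurable [A] comes from the product space, as [x] is recovered from its coordinates by
   the flow. *)
pose D := (fun p : measurableTypeR R * T => Phi p.1 p.2) @^-1` A.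
have mD : measurable D by rewrite -[D]setTI; exact: (su_meas su).
have -> : A = coord @^-1` D.
  by apply/seteqP; split=> x; rewrite /D /= -/(base x) /base (PhiNK su).
have hs : mult_sets Cm (coord @^-1` D); last by case: hs.
apply: (mult_sets_preimage hCm (@measurable_prod_measurableType _ _ _ _) _ mD).
by move=> E [E1 mE1 [E2 mE2 <-]]; exact: mrect.
Qed.

(* The [g] such that [F] is orthogonal to all [zeta k * g] are stable under
   multiplication by [zeta], so by all bounded functions of the height. *)
Lemma Dperp_fourier F : Dperp F -> forall E, measurable E ->
  inner mu F (fun x => (\1_E (tau x))%:C%C) = 0.
Proof.
move=> hF; have LF : in_L2 mu F by case: hF.
pose C1 := [set g | in_L2 mu g /\ forall k, inner mu F (fun x => zeta k x * g x) = 0].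
have Lzg k g : in_L2 mu g -> in_L2 mu (fun x => zeta k x * g x).
  by apply: in_L2_mul; [exact: (zeta_cmeas su)|move=> x; rewrite zeta_norm].
have hC : closed_subspace mu C1.
  split=> [f []//|f g [Lf hf] [Lg hg]|a f [Lf hf]|f Lf h].
  - split=> [|k]; first exact: in_L2D.
    rewrite (_ : (fun x => _) = (fun x => zeta k x * f x) + (fun x => zeta k x * g x)).
      by rewrite (ipDr sh) ?hf ?hg ?addr0//; exact: Lzg.
    by apply/funext => x; rewrite mulrDr.
  - split=> [|k]; first exact: in_L2Z.
    rewrite (_ : (fun x => _) = a *: (fun x => zeta k x * f x)).
      by rewrite (ipZr sh) ?hf ?mulr0//; exact: Lzg.
    by apply/funext => x; rewrite mulrCA.
  - split=> // k; apply: eq0_normc.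
    apply/eqP; rewrite eq_le normc_ge0 andbT; apply/ler_addgt0Pr => e e0; rewrite add0r.
    pose B := hn F + 1; have B0 : 0 < B by rewrite ltr_wpDl// hnorm_ge0.
    have [g [[Lg hg] he]] := h (e / B) (divr_gt0 e0 B0).
    have -> : inner mu F (fun x => zeta k x * f x) =
        - inner mu F (fun x => zeta k x * (g x - f x)).
      rewrite (_ : (fun x => _ * (_ - _)) = (fun x => zeta k x * g x) - (fun x => zeta k x * f x)).
        rewrite (ipDr sh (Lzg k _ Lg) (shN sh (Lzg k _ Lf)) LF) (ipNr sh (Lzg k _ Lf) LF).
        by rewrite hg add0r opprK.
      by apply/funext => x; rewrite mulrBr.
    have Lgf : in_L2 mu (g - f) by exact: in_L2B.
    rewrite normcN' (le_trans (cauchy_schwarz sh LF (Lzg k _ Lgf)))//.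
    have -> : hn (fun x => zeta k x * (g - f) x) = hn (g - f).
      rewrite /hnorm !innerE; congr (Num.sqrt (complex.Re (cint _ _))); apply/funext => x.
      by rewrite !mulcJ normcM zeta_norm mul1r.
    apply: (@le_trans _ _ (B * (e / B))); last by rewrite mulrCA divff ?mulr1// gt_eqF.
    by rewrite ler_pM ?hnorm_ge0// lerDl.
have mz j : multiplier C1 (zeta j).
  split; [exact: (zeta_cmeas su)|by exists 1 => x; rewrite zeta_norm|].
  move=> g [Lg hg]; split=> [|k]; first exact: Lzg.
  by under [X in inner _ _ X]funext do rewrite mulrA zetaD; exact: hg.
pose c x := cos (om * tau x) : R; pose s x := sin (om * tau x) : R.
have mc : multiplier C1 (fun x => (c x)%:C%C).
  apply: (eq_mult _ (multZ hC 2^-1 (multD hC (mz 1) (mz (-1))))) => x.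
  rewrite -zetaN /zeta mul1r; apply: eq_complexP; rewrite /c ?ReImE/= ?ReImE/=; by field.
have ms : multiplier C1 (fun x => (s x)%:C%C).
  have h := multZ hC (0 -i* 2^-1)%C (multD hC (mz 1) (multZ hC (-1) (mz (-1)))).
  apply: (eq_mult _ h) => {h} y.
  rewrite -zetaN /zeta mul1r; apply: eq_complexP; rewrite /s ?ReImE/= ?ReImE/=; by field.
have mlt (u : T -> R) (a : R) : multiplier C1 (fun x => (u x)%:C%C) -> mult_sets C1 [set x | u x < a].
  move=> hu; split; last exact: (mult_ltr hC).
  have [[mu_ _] _ _] := hu; rewrite -[X in measurable X]setTI.
  rewrite (_ : [set x | u x < a] = u @^-1` `]-oo, a[%classic); first exact: mu_.
  by apply/seteqP; split=> x; rewrite /= in_itv.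
have hS : mult_sets C1 (~` [set x | s x < 0]) by apply: (mult_setsC hC); exact: mlt.
have om0 : 0 < om by rewrite divr_gt0// pmulrn_rgt0 ?pi_gt0.
have omP : om * P = pi *+ 2 by rewrite divfK.
have th x : 0 <= om * tau x < pi *+ 2.
  have /andP[h1 h2] := su_itv su x.
  by rewrite -[ltRHS]omP (ltr_pM2l om0) h2 andbT mulr_ge0// ltW.
have sin_lt0 t : pi < t < pi *+ 2 -> sin t < 0 :> R.
  move=> /andP[h1 h2]; rewrite -[t](subrK pi) sinDpi oppr_lt0 sin_gt0_pi// subr_gt0 h1/=.
  by rewrite ltrBlDr -mulr2n.
have cos2pi t : cos (pi *+ 2 - t) = cos t :> R.
  by rewrite -cosN opprB cosB cos2pi sin2pi mulr1 mulr0 addr0.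
have refl_itv t : pi < t -> t < pi *+ 2 -> pi *+ 2 - t \in `[0, pi :> R].
  by move=> h1 h2; rewrite in_itv/= subr_ge0 (ltW h2) lerBlDr mulr2n lerD2l (ltW h1).
(* The sign of the sine tells in which half of the period the height lies, and on each half the
   cosine is monotone. So a ray of heights is an intersection, or a union, of conditions on the sine
   and the cosine. *)
have hray a : mult_sets C1 [set x | tau x < a].
  have [M0 MC _] := mult_sets_sigma hC.
  have [a0|a0] := leP a 0.
    rewrite (_ : [set x | _] = set0)//; apply/seteqP; split=> x //=.
    by have /andP[h1 _] := su_itv su x; move=> /(le_lt_trans h1); rewrite ltNge a0.
  have [Pa|aP] := leP P a.
    rewrite (_ : [set x | _] = setT `\` set0); first exact: MC.
    rewrite setD0; apply/seteqP; split=> x //= _.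
    by have /andP[_ h2] := su_itv su x; exact: lt_le_trans Pa.
  have a2 : om * a < pi *+ 2 by rewrite -[ltRHS]omP (ltr_pM2l om0).
  have a1 : 0 < om * a by rewrite mulr_gt0.
  have eqa x : (tau x < a) = (om * tau x < om * a) by rewrite (ltr_pM2l om0).
  have [api|pia] := leP (om * a) pi.
    have mc' : multiplier C1 (fun x => (- c x)%:C%C).
      by apply: (eq_mult _ (multZ hC (-1) mc)) => x; rewrite rmorphN mulN1r.
    rewrite (_ : [set x | _] = ~` [set x | s x < 0] `&` [set x | - c x < - cos (om * a)]).
      by apply: mult_setsI => //; exact: mlt.
    apply/seteqP; split=> x /=; rewrite eqa ltrN2; have /andP[t1 t2] := th x.
      move=> ta; have tpi : om * tau x <= pi by rewrite ltW// (lt_le_trans ta).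
      split; first by apply/negP; rewrite -leNgt sin_ge0_pi// t1 tpi.
      by rewrite ltr_cos ?in_itv/= ?t1 ?tpi ?(ltW a1).
    move=> [/negP]; rewrite -leNgt => s0; have [tpi|tpi] := leP (om * tau x) pi.
      by rewrite ltr_cos ?in_itv/= ?t1 ?tpi ?(ltW a1).
    by move: s0; rewrite leNgt sin_lt0// tpi t2.
  rewrite (_ : [set x | _] = ~` [set x | s x < 0] `|` [set x | c x < cos (om * a)]).
    by apply: (mult_setsU hC) => //; exact: mlt.
  apply/seteqP; split=> x /=; rewrite eqa; have /andP[t1 t2] := th x.
    move=> ta; have [tpi|tpi] := leP (om * tau x) pi.
      by left; apply/negP; rewrite -leNgt sin_ge0_pi// t1 tpi.
    by right; rewrite /c -cos2pi -[ltRHS]cos2pi ltr_cos ?refl_itv// ltrD2l ltrN2.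
  have [tpi _|tpi] := leP (om * tau x) pi; first exact: le_lt_trans pia.
  move=> [/negP|]; first by rewrite sin_lt0// tpi t2.
  by rewrite /c -cos2pi -[ltRHS]cos2pi ltr_cos ?refl_itv// ltrD2l ltrN2.
move=> E mE; have hE : mult_sets C1 (tau @^-1` E).
  apply: (mult_sets_preimage (G := @RGenInftyO.G R) hC _ _ mE) => [|_ [a ->]].
    by have := @RGenInftyO.measurableE R.
  rewrite (_ : _ @^-1` _ = [set x | tau x < a])//.
have C11 : C1 (fun=> 1).
  split=> [|k]; first exact: in_L2_cst.
  by under [X in inner _ _ X]funext do rewrite mulr1; exact: (Dperp_zeta su).
have [_ [_ _ /(_ _ C11)[_ /(_ 0)]]] := hE.
by under [X in inner _ _ X]funext do rewrite zeta0 mul1r mulr1.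
Qed.

End Density.

(** * Bounds and continuity of correlations *)

Section Correlations.
Context {R : realType} {d : measure_display} {T : measurableType d}.
Variables (mu : probability T R) (S : T -> T).
Hypothesis pS : preserving mu mu S.
Local Notation hn := (hnorm (inner mu)).
Let sh := semi_hilbert_L2 mu.
Let iS := isometry_koopman pS.

Lemma comp_L2 f : in_L2 mu f -> in_L2 mu (f \o S).
Proof. exact: (isoH iS). Qed.

Lemma corr_ge0 f g : 0 <= corr mu S f g.
Proof. exact: normc_ge0. Qed.

Lemma corrDl f f' g : in_L2 mu f -> in_L2 mu f' -> in_L2 mu g ->
  corr mu S (fun x => f x + f' x) g <= corr mu S f g + corr mu S f' g.
Proof.
move=> Lf Lf' Lg; rewrite /corr (_ : _ \o S = (f \o S) + (f' \o S))//.
rewrite (ipDl sh (comp_L2 Lf) (comp_L2 Lf') Lg); exact: normcD.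
Qed.

Lemma corrZl a f g : in_L2 mu f -> in_L2 mu g ->
  corr mu S (fun x => a * f x) g = normc a * corr mu S f g.
Proof.
move=> Lf Lg; rewrite /corr (_ : _ \o S = a *: (f \o S))//.
by rewrite (ipZl sh _ (comp_L2 Lf) Lg) normcM.
Qed.

Lemma corrDr f g g' : in_L2 mu f -> in_L2 mu g -> in_L2 mu g' ->
  corr mu S f (fun x => g x + g' x) <= corr mu S f g + corr mu S f g'.
Proof.
move=> Lf Lg Lg'; rewrite /corr (_ : (fun x => _) = g + g')//.
rewrite (ipDr sh Lg Lg' (comp_L2 Lf)); exact: normcD.
Qed.

Lemma corrZr a f g : in_L2 mu f -> in_L2 mu g ->
  corr mu S f (fun x => a * g x) = normc a * corr mu S f g.
Proof.
move=> Lf Lg; rewrite /corr (_ : (fun x => _) = a *: g)//.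
by rewrite (ipZr sh _ Lg (comp_L2 Lf)) normcM normcJ.
Qed.

Lemma corr_le f g : in_L2 mu f -> in_L2 mu g -> corr mu S f g <= hn f * hn g.
Proof.
move=> Lf Lg; rewrite -(hnorm_iso iS Lf).
by apply: (cauchy_schwarz sh) => //; exact: comp_L2.
Qed.

Lemma corr_distl f f' g : in_L2 mu f -> in_L2 mu f' -> in_L2 mu g ->
  corr mu S f g <= corr mu S f' g + hn (fun x => f' x - f x) * hn g.
Proof.
move=> Lf Lf' Lg; have Ld : in_L2 mu (fun x => f' x - f x) by exact: in_L2B.
have Ld' := in_L2Z (-1) Ld.
apply: le_trans (lerD (lexx _) (corr_le Ld Lg)).
have := corrDl Lf' Ld' Lg; rewrite corrZl// normcN' normc1 mul1r.
by rewrite (_ : (fun x => _) = f)//; apply/funext => x; ring.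
Qed.

Lemma corr_distr f g g' : in_L2 mu f -> in_L2 mu g -> in_L2 mu g' ->
  corr mu S f g <= corr mu S f g' + hn (fun x => g' x - g x) * hn f.
Proof.
move=> Lf Lg Lg'; have Ld : in_L2 mu (fun x => g' x - g x) by exact: in_L2B.
have Ld' := in_L2Z (-1) Ld; rewrite [_ * hn f]mulrC.
apply: le_trans (lerD (lexx _) (corr_le Lf Ld)).
have := corrDr Lf Lg' Ld'; rewrite corrZr// normcN' normc1 mul1r.
by rewrite (_ : (fun x => _) = g)//; apply/funext => x; ring.
Qed.

End Correlations.

(** * Comparison of integrals with step sums *)

Section StepIntegrals.
Context {R : realType}.
Local Notation leb := (@lebesgue_measure R).

(** The integral of a nonnegative function is a supremum over the simple functions below it, so it
    is monotone for arbitrary integrands, such as the correlations as functions of time. *)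
Lemma ge0_integral_le {d : measure_display} {T : measurableType d}
  (mu : {measure set T -> \bar R}) (f g : T -> \bar R) :
  (forall x, 0 <= f x)%E -> (forall x, f x <= g x)%E ->
  (\int[mu]_x f x <= \int[mu]_x g x)%E.
Proof.
move=> f0 fg; have g0 x : (0 <= g x)%E by exact: le_trans (fg x).
rewrite !ge0_integralTE//; apply: le_ereal_sup => _ [h hf <-]; exists h => //.
by move=> x; exact: le_trans (hf x) (fg x).
Qed.

Variables (N : nat) (a : nat -> R) (I : nat -> set (measurableTypeR R)) (l : R).
Hypothesis a0 : forall n, 0 <= a n.
Hypothesis mI : forall n, measurable (I n).
Hypothesis lI : forall n, leb (I n) = l%:E.

Lemma step_integral :
  (\int[leb]_t (\sum_(n < N) a n * \1_(I n) t)%:E = (l * \sum_(n < N) a n)%:E)%E.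
Proof.
under eq_integral do rewrite -sumEFin.
rewrite ge0_integral_sum//; last 2 first.
- move=> n; apply/measurable_EFinP; apply: measurable_funM; first exact: measurable_cst.
  exact: measurable_indic.
- by move=> n t _; rewrite lee_fin mulr_ge0// indicE.
rewrite mulr_sumr -sumEFin; apply: eq_bigr => n _.
under eq_integral do rewrite EFinM.
rewrite ge0_integralZl//; last 2 first.
- by apply/measurable_EFinP; exact: measurable_indic.
- by rewrite lee_fin.
by rewrite integral_indic// setIT [X in (_ * X)%E](lI n) -EFinM mulrC.
Qed.

Lemma Rintegral_le_step (u : R -> R) (D : set R) : measurable (D : set (measurableTypeR R)) ->
  (forall t, 0 <= u t) ->
  (forall t, D t -> u t <= \sum_(n < N) a n * \1_(I n) t) ->
  \int[leb]_(t in D) u t <= l * \sum_(n < N) a n.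
Proof.
move=> mD u0 h; rewrite /Rintegral integral_mkcond.
have h0 : (0 <= \int[leb]_t ((EFin \o u) \_ D) t)%E.
  by apply: integral_ge0 => t _; rewrite patchE; case: ifP => // _; rewrite lee_fin.
have h1 : (\int[leb]_t ((EFin \o u) \_ D) t <= (l * \sum_(n < N) a n)%:E)%E.
  rewrite -step_integral; apply: ge0_integral_le => t; rewrite patchE; case: ifPn.
  - by rewrite lee_fin.
  - by [].
  - by rewrite inE => /h; rewrite lee_fin.
  - by move=> _; rewrite lee_fin sumr_ge0// => n _; rewrite mulr_ge0// indicE.
have := fine_le _ _ h1; rewrite /= => -> //.
by rewrite ge0_fin_numE// (le_lt_trans h1)// ltry.
Qed.

Lemma step_le_Rintegral (u : R -> R) (a1 b1 B : R) :
  (forall t, 0 <= u t <= B) ->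
  (forall t, \sum_(n < N) a n * \1_(I n) t <= u t * \1_(`[a1, b1]%classic) t) ->
  l * \sum_(n < N) a n <= \int[leb]_(t in `[a1, b1]) u t.
Proof.
move=> uB h; rewrite /Rintegral integral_mkcond.
have E t : ((EFin \o u) \_ `[a1, b1]) t = (u t * \1_(`[a1, b1]%classic) t)%:E.
  by rewrite patchE indicE; case: (t \in _); rewrite /= ?mulr1 ?mulr0.
under eq_integral do rewrite E.
have u0 t : 0 <= u t * \1_(`[a1, b1]%classic) t.
  by have /andP[h1 _] := uB t; rewrite mulr_ge0// indicE.
have B0 : 0 <= B by have /andP[h1 h2] := uB 0; exact: le_trans h2.
(* The bound [B] keeps the integral finite; [fine] would send an infinite one to 0 and spoil the
   comparison. *)
have h2 : (\int[leb]_t (u t * \1_(`[a1, b1]%classic) t)%:E < +oo)%E.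
  apply: (@le_lt_trans _ _ (\int[leb]_t (B%:E * (\1_(`[a1, b1]%classic) t)%:E))%E).
    apply: ge0_integral_le => t; first by rewrite lee_fin.
    by rewrite lee_fin ler_wpM2r ?indicE//; have /andP[] := uB t.
  rewrite ge0_integralZl//; last first.
    by apply/measurable_EFinP; exact: measurable_indic.
  rewrite integral_indic// setIT [X in (_ * X)%E](lebesgue_measure_itv `[a1, b1])/=.
  by case: ifP => _; rewrite ?mule0 ?ltry// -EFinB -EFinM ltry.
have h1 : ((l * \sum_(n < N) a n)%:E <= \int[leb]_t (u t * \1_(`[a1, b1]%classic) t)%:E)%E.
  rewrite -step_integral; apply: ge0_integral_le => t; rewrite lee_fin//.
  by rewrite sumr_ge0// => n _; rewrite mulr_ge0// indicE.
have := fine_le _ _ h1; rewrite /= => -> //.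
rewrite ge0_fin_numE// integral_ge0// => t _; by rewrite lee_fin.
Qed.

End StepIntegrals.

(** * Correlations of the flow in terms of those of the return map *)

Section Mixing.
Context {R : realType} {d : measure_display} {T : measurableType d}.
Variables (mu nu : probability T R) (rho : probability (measurableTypeR R) R).
Variables (Phi : R -> T -> T) (P : R) (tau : T -> R).
Hypothesis su : suspension mu nu rho Phi P tau.
Local Notation base := (base Phi tau).
Local Notation om := (pi *+ 2 / P : R).
Local Notation Dperp := (orthocompl mu (flow_discrete mu Phi)).
Local Notation hn := (hnorm (inner mu)).
Local Notation zeta := (zeta P tau).
Local Notation product_fun := (product_fun Phi tau).
Hypothesis freq : forall w, eigenfrequency mu Phi w -> exists k : int, w = k%:~R * om.

Let P0 : 0 < P := su_P su.
Let sh := semi_hilbert_L2 mu.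
Let iS n := isometry_koopman (preserving_iter (su_nu su) n).

(** By independence the inner product with [zeta k] factors, and one of the factors is the mean of
    [f]. *)
Lemma product_Dperp E f : measurable E -> mean_zero nu f -> Dperp (product_fun E f).
Proof.
move=> mE /mean_zeroP[Lf f0]; apply: (Dperp_in su freq); first exact: (product_L2 su).
move=> k; rewrite innerE.
pose th (s : measurableTypeR R) : R[i] := (\1_E s)%:C%C * cis (- (k%:~R * om * s)).
have := product_cint su (th := th) (h := f) (B := 1).
rewrite f0 mulr0 => <-.
- by congr cint; apply/funext => x; rewrite /product_fun /th /zeta cisN mulrAC.
- apply: cmeasM; first exact: cmeas_indic.
  apply: cmeas_cis; apply: measurableT_comp => //; apply: measurable_funM => //.
- by move=> s; rewrite normcM normc_cis mulr1; exact: normc_indic.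
- exact: in_L2_cmeas Lf.
- exact: cintegrable_L2.
Qed.

Lemma DperpB F G : Dperp F -> Dperp G -> Dperp (fun x => F x - G x).
Proof.
move=> [LF hF] [LG hG]; split=> [|g Eg]; first exact: in_L2B.
have Lg : in_L2 mu g by case: Eg.
have := ipDl sh LF (shN sh LG) Lg; rewrite (ipNl sh LG Lg) hF// hG// subr0.
by move=> <-.
Qed.

Lemma DperpD F G : Dperp F -> Dperp G -> Dperp (fun x => F x + G x).
Proof.
move=> [LF hF] [LG hG]; split=> [|g Eg]; first exact: in_L2D.
have Lg : in_L2 mu g by case: Eg.
by have := ipDl sh LF LG Lg; rewrite hF// hG// addr0.
Qed.

Lemma DperpZ a F : Dperp F -> Dperp (fun x => a * F x).
Proof.
move=> [LF hF]; split=> [|g Eg]; first exact: in_L2Z.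
have Lg : in_L2 mu g by case: Eg.
by have := ipZl sh a LF Lg; rewrite hF// mulr0.
Qed.

Lemma measurable_translate (E : set (measurableTypeR R)) (r : R) : measurable E ->
  measurable [set s : measurableTypeR R | E (s + r)].
Proof.
by move=> mE; rewrite -[X in measurable X]setTI; exact: measurable_shift.
Qed.

(* Starting at height [s] above the base, the orbit of length [n P + r] crosses
   the base [n] times if [s + r < P] and [n + 1] times otherwise. *)
Lemma inner_products E E' f g (n : nat) (r : R) : measurable E -> measurable E' ->
  in_L2 nu f -> in_L2 nu g -> 0 <= r < P ->
  exists A0 A1 : set (measurableTypeR R), [/\ measurable A0, measurable A1,
    A0 = [set s | s + r < P /\ (E (s + r) /\ E' s)],
    A1 = [set s | P <= s + r /\ (E (s + (r - P)) /\ E' s)] &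
    inner mu (product_fun E f \o Phi (n%:R * P + r)) (product_fun E' g) =
      (fine (rho A0))%:C%C * inner nu (f \o iter n (Phi P)) g +
      (fine (rho A1))%:C%C * inner nu (f \o iter n.+1 (Phi P)) g].
Proof.
move=> mE mE' Lf Lg /andP[r0 rP].
pose A0 := [set s : measurableTypeR R | s + r < P /\ (E (s + r) /\ E' s)].
pose A1 := [set s : measurableTypeR R | P <= s + r /\ (E (s + (r - P)) /\ E' s)].
have mlt : measurable [set s : measurableTypeR R | s + r < P].
  rewrite (_ : [set s | _] = `]-oo, P - r[%classic); first exact: measurable_itv.
  by apply/seteqP; split=> s /=; rewrite in_itv/= ltrBrDr.
have mA0 : measurable A0.
  by apply: measurableI => //; apply: measurableI => //; exact: measurable_translate.
have mA1 : measurable A1.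
  apply: (@measurableI _ _ [set s : measurableTypeR R | P <= s + r]).
    rewrite (_ : [set s | _] = ~` [set s : measurableTypeR R | s + r < P]).
      exact: measurableC.
    by apply/seteqP; split=> s /=; rewrite leNgt => /negP.
  by apply: measurableI => //; exact: measurable_translate.
exists A0, A1; split=> //.
have Lfn j : in_L2 nu (f \o iter j (Phi P)) by exact: (isoH (iS j)).
have mi (A : set (measurableTypeR R)) : measurable A -> cmeas (fun s => (\1_A s)%:C%C : R[i]).
  by move=> mA; exact: cmeas_indic.
have bi (A : set (measurableTypeR R)) s : normc ((\1_A s)%:C%C : R[i]) <= 1 by exact: normc_indic.
rewrite -!cint_indic// -!(product_inner su _ (bi _))//; try exact: mi.
have cb j : cintegrable nu (fun x => (f \o iter j (Phi P)) x * (g x)^*%C).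
  exact: cintegrable_inner.
have ci (A : set (measurableTypeR R)) j : measurable A -> in_L2 mu (product_fun A (f \o iter j (Phi P))).
  by move=> mA; exact: (product_L2 su).
have Lgb : in_L2 mu (fun x => g (base x)) by exact: (preserving_in_L2 (mu_base su) (in_L2_cmeas Lg)).1.
have cc (A : set (measurableTypeR R)) j : measurable A ->
    cintegrable mu (fun x => (\1_A (tau x))%:C%C * ((f \o iter j (Phi P)) (base x) * (g (base x))^*%C)).
  move=> mA; have := cintegrable_inner (ci A j mA) Lgb.
  by under eq_fun do rewrite /product_fun -mulrA.
rewrite -cintD ?innerE; try exact: cc.
have Lpt := comp_L2 (mu_Phi su (n%:R * P + r)) (product_L2 su mE Lf).
have cmc h : cintegrable mu h -> cmeas h.
  by move=> [/integrableP[/measurable_EFinP h1 _] /integrableP[/measurable_EFinP h2 _]].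
have cj (a : R) (c : R[i]) : ((a%:C * c)^*)%C = (a%:C * c^*)%C by apply: eq_complexP; rewrite !ReImE/= mul0r; ring.
apply: cint_ae.
- apply: cmeasM; first exact: in_L2_cmeas Lpt.
  by apply/cmeasJ/in_L2_cmeas; exact: (product_L2 su).
- by apply: cmeasD; apply: cmc; exact: cc.
apply: filterS (su_flow su (n%:R * P + r)) => x [k e].
have /andP[t0 tP] := su_itv su x; have /andP[] := su_itv su (Phi (n%:R * P + r) x).
rewrite {1 2}e => k1 k2.
(* The number [k] of crossings is pinned down by the height after the flow lying between 0 and [P]:
   only [k = n] and [k = n + 1] remain. *)
have kr : k%:~R * P <= tau x + r + n%:R * P < (k + 1)%:~R * P.
  by rewrite rmorphD/= mulrDl mul1r; apply/andP; split; lra.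
have [lt|ge] := ltP (tau x + r) P.
  have kn : k = n :> int.
    apply/eqP; rewrite eq_le; apply/andP; split.
      rewrite -ltzD1 -(ltr_int R) -(ltr_pM2r P0); case/andP: kr => h _.
      by apply: le_lt_trans h _; rewrite rmorphD/= mulrDl mul1r; lra.
    rewrite -ltzD1 -(ltr_int R) -(ltr_pM2r P0); case/andP: kr => _ h.
    by apply: le_lt_trans h; lra.
  have te : tau (Phi (n%:R * P + r) x) = tau x + r by rewrite e kn; ring.
  have -> : \1_A1 (tau x) = 0 :> R.
    by rewrite indicE memNset// => -[+ _]; rewrite leNgt lt.
  have -> : \1_A0 (tau x) = \1_E (tau x + r) * \1_E' (tau x) :> R.
    rewrite !indicE -natrM mulnb; congr ((_ : bool)%:R).
    by apply/idP/andP => [|[]]; rewrite !inE// => -[_ []].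
  rewrite /= /product_fun te (base_flow su e) kn -(iter_Phi su) cj.
  by rewrite rmorphM/=; ring.
have n1 : (n.+1%:Z)%:~R = n%:R + 1 :> R by rewrite natr1.
have kn : k = n.+1 :> int.
  apply/eqP; rewrite eq_le; apply/andP; split.
    rewrite -ltzD1 -(ltr_int R) -(ltr_pM2r P0); case/andP: kr => h _.
    by apply: le_lt_trans h _; rewrite rmorphD/= n1 !mulrDl mul1r; lra.
  rewrite -ltzD1 -(ltr_int R) -(ltr_pM2r P0); case/andP: kr => _ h.
  by apply: le_lt_trans h; rewrite n1 mulrDl mul1r; lra.
have te : tau (Phi (n%:R * P + r) x) = tau x + (r - P).
  by rewrite e kn n1; ring.
have -> : \1_A0 (tau x) = 0 :> R.
  by rewrite indicE memNset// => -[+ _]; rewrite ltNge ge.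
have -> : \1_A1 (tau x) = \1_E (tau x + (r - P)) * \1_E' (tau x) :> R.
  rewrite !indicE -natrM mulnb; congr ((_ : bool)%:R).
  by apply/idP/andP => [|[]]; rewrite !inE// => -[_ []].
rewrite /product_fun [LHS]/= /product_fun te (base_flow su e) kn -(iter_Phi su) cj.
by rewrite rmorphM/=; ring.
Qed.

Lemma corr_product_le E E' f g (n : nat) (r : R) : measurable E -> measurable E' ->
  in_L2 nu f -> in_L2 nu g -> 0 <= r < P ->
  corr mu (Phi (n%:R * P + r)) (product_fun E f) (product_fun E' g) <=
    corr nu (iter n (Phi P)) f g + corr nu (iter n.+1 (Phi P)) f g.
Proof.
move=> mE mE' Lf Lg hr.
have [A0 [A1 [mA0 mA1 _ _ e]]] := inner_products n mE mE' Lf Lg hr.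
have fin A : measurable A -> normc ((fine (rho A))%:C%C : R[i]) <= 1.
  move=> mA; rewrite normc_real ger0_norm ?fine_ge0//.
  by rewrite -[leRHS]/(fine 1%:E) fine_le// ?fin_num_measure// probability_le1.
rewrite /corr e (le_trans (normcD _ _))// !normcM.
by apply: lerD; rewrite ler_piMl ?normc_ge0// fin.
Qed.

(** Starting heights below [P / 2] followed by less than [P / 2] never cause an extra crossing, so a
    single correlation of the map appears, weighted by the law of the half period. This exact
    formula carries information from the flow back to the map. *)
Lemma corr_half f g (n : nat) (r : R) : in_L2 nu f -> in_L2 nu g -> 0 <= r < P / 2 ->
  corr mu (Phi (n%:R * P + r)) (product_fun setT f) (product_fun `[0, P / 2[%classic g) =
    corr nu (iter n (Phi P)) f g / 2.
Proof.
move=> Lf Lg /andP[r0 r2].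
have rP : 0 <= r < P by rewrite r0/=; lra.
have mI : measurable (`[0, P / 2[%classic : set (measurableTypeR R)) by exact: measurable_itv.
have [A0 [A1 [_ _ a0 a1 e]]] := inner_products n measurableT mI Lf Lg rP.
have A0E : A0 = `[0, P / 2[%classic.
  rewrite a0; apply/seteqP; split=> s /= => [[_ [_]]|]//.
  by rewrite in_itv/= => /andP[s0 s1]; split; [lra|rewrite s0 s1].
have A1E : A1 = set0.
  rewrite a1; apply/seteqP; split=> s //= [h [_]].
  by rewrite in_itv/= => /andP[s0 s1]; lra.
rewrite /corr e A0E A1E measure0 [X in _ + X]mul0r addr0 normcM normc_real (su_half su).
have -> : fine (1 / 2 : R)%:E = 2^-1 by rewrite /= mul1r.
by rewrite ger0_norm ?invr_ge0// mulrC.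
Qed.

Section Transfer.
(** A class of negligible sequences. It will be the sequences tending to 0 for strong mixing, the
    nonnegative sequences whose Cesaro means tend to 0 for weak mixing, and the zero sequence for
    the rates. *)
Variable good : (nat -> R) -> Prop.
Hypothesis goodD : forall a b, good a -> good b -> good (fun n => a n + b n).
Hypothesis goodZ : forall c a, 0 <= c -> good a -> good (fun n => c * a n).
Hypothesis goodS : forall a, good a -> good (fun n => a n.+1).
Hypothesis good_corr : forall f g, mean_zero nu f -> in_L2 nu g ->
  good (fun n => corr nu (iter n (Phi P)) f g).

(** The bound depends on the number of full periods only, uniformly in the remainder [r]; the slack
    [e] makes the notion stable under L^2 limits. *)
Definition dominated F G := forall e : R, 0 < e -> exists2 b, good b &
  forall (n : nat) (r : R), 0 <= r < P -> corr mu (Phi (n%:R * P + r)) F G <= e + b n.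

Lemma dominated_product E E' f g : measurable E -> measurable E' ->
  mean_zero nu f -> in_L2 nu g -> dominated (product_fun E f) (product_fun E' g).
Proof.
move=> mE mE' f0 Lg e e0.
exists (fun n => corr nu (iter n (Phi P)) f g + corr nu (iter n.+1 (Phi P)) f g).
  by apply: goodD; [exact: good_corr|apply: (@goodS (fun n => corr nu (iter n (Phi P)) f g)); exact: good_corr].
move=> n r hr; apply: (@le_trans _ _ (0 + (corr nu (iter n (Phi P)) f g + corr nu (iter n.+1 (Phi P)) f g))).
  by rewrite add0r; apply: corr_product_le => //; case/mean_zeroP: f0.
by rewrite lerD2r ltW.
Qed.

Lemma dominated_closed F : in_L2 mu F ->
  closed_subspace mu [set G | in_L2 mu G /\ dominated F G].
Proof.
move=> LF; split=> [f []//|G G' [LG hG] [LG' hG']|a G [LG hG]|G LG h].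
- split=> [|e e0]; first exact: in_L2D.
  have e2 : 0 < e / 2 by rewrite divr_gt0.
  have [b gb hb] := hG _ e2; have [b' gb' hb'] := hG' _ e2.
  exists (fun n => b n + b' n); first exact: goodD.
  move=> n r hr; apply: le_trans (corrDr (mu_Phi su _) LF LG LG') _.
  by apply: le_trans (lerD (hb n r hr) (hb' n r hr)) _; lra.
- split=> [|e e0]; first exact: in_L2Z.
  pose c := normc a + 1; have c0 : 0 < c by rewrite ltr_wpDl// normc_ge0.
  have [b gb hb] := hG _ (divr_gt0 e0 c0).
  exists (fun n => c * b n); first by apply: goodZ => //; exact: ltW.
  move=> n r hr; rewrite (corrZr (mu_Phi su _))//.
  apply: (@le_trans _ _ (c * corr mu (Phi (n%:R * P + r)) F G)).
    by rewrite ler_wpM2r ?corr_ge0// lerDl.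
  apply: le_trans (ler_wpM2l (ltW c0) (hb n r hr)) _.
  by rewrite mulrDr mulrCA divff ?mulr1// gt_eqF.
- split=> // e e0; pose B := hn F + 1; have B0 : 0 < B by rewrite ltr_wpDl// hnorm_ge0.
  have [G' [[LG' hG'] he]] := h (e / 2 / B) (divr_gt0 (divr_gt0 e0 (ltr0Sn _ 1)) B0).
  have [b gb hb] := hG' (e / 2) (divr_gt0 e0 (ltr0Sn _ 1)).
  exists b => // n r hr; apply: le_trans (corr_distr (mu_Phi su _) LF LG LG') _.
  have h1 : hn (fun x => G' x - G x) * hn F <= e / 2.
    apply: (@le_trans _ _ (e / 2 / B * B)); last by rewrite divfK// gt_eqF.
    by rewrite ler_pM ?hnorm_ge0// lerDl.
  by apply: le_trans (lerD (hb n r hr) h1) _; lra.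
Qed.

Lemma dominated_productl E f G : measurable E -> mean_zero nu f -> in_L2 mu G ->
  dominated (product_fun E f) G.
Proof.
move=> mE f0 LG; have Lf : in_L2 nu f by case/mean_zeroP: f0.
have := product_density su (dominated_closed (product_L2 su mE Lf)).
move=> /(_ _ _ LG)[]// E' g mE' Lg; split; first exact: (product_L2 su).
exact: dominated_product.
Qed.

Let addfE (u v : T -> R[i]) x : (u + v) x = u x + v x. Proof. by []. Qed.
Let scalefE a (u : T -> R[i]) x : (a *: u) x = a * u x. Proof. by []. Qed.

(* Orthogonality makes the [Dperp] component [F1] alone close to [F] when [F] is
   itself in [Dperp]. *)
Definition near_dominated F := forall e : R, 0 < e -> exists H F1,
  [/\ in_L2 mu H, forall K, Dperp K -> inner mu K H = 0, Dperp F1,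
     forall G, in_L2 mu G -> dominated F1 G & hn (fun x => H x + F1 x - F x) <= e].

Lemma near_dominated_closed : closed_subspace mu [set F | in_L2 mu F /\ near_dominated F].
Proof.
split=> [f []//|F F' [LF hF] [LF' hF']|a F [LF hF]|F LF h].
- split=> [|e e0]; first exact: in_L2D.
  have e2 : 0 < e / 2 by rewrite divr_gt0.
  have [H [K [LH oH DK dK he]]] := hF _ e2; have [H' [K' [LH' oH' DK' dK' he']]] := hF' _ e2.
  have LK : in_L2 mu K by case: DK.
  have LK' : in_L2 mu K' by case: DK'.
  exists (fun x => H x + H' x), (fun x => K x + K' x); split.
  + exact: in_L2D.
  + move=> J DJ; have LJ : in_L2 mu J by case: DJ.
    by have := ipDr sh LH LH' LJ; rewrite oH// oH'// addr0.
  + exact: DperpD.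
  + move=> G LG e1 e10; have e12 : 0 < e1 / 2 by rewrite divr_gt0.
    have [b gb hb] := dK _ LG _ e12; have [b' gb' hb'] := dK' _ LG _ e12.
    exists (fun n => b n + b' n); first exact: goodD.
    move=> n r hr; apply: le_trans (corrDl (mu_Phi su _) LK LK' LG) _.
    by apply: le_trans (lerD (hb n r hr) (hb' n r hr)) _; lra.
  + have L1 : in_L2 mu (fun x => H x + K x - F x) by apply: in_L2B => //; exact: in_L2D.
    have L2 : in_L2 mu (fun x => H' x + K' x - F' x) by apply: in_L2B => //; exact: in_L2D.
    have := le_trans (ler_hnormD sh L1 L2) (lerD he he'); rewrite -mulrDr.
    rewrite (_ : _ + _ = (fun x => H x + H' x + (K x + K' x) - (F x + F' x))); last first.
      by apply/funext => x; rewrite addfE; ring.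
    by move=> h; apply: le_trans h _; lra.
- split=> [|e e0]; first exact: in_L2Z.
  pose c := normc a + 1; have c0 : 0 < c by rewrite ltr_wpDl// normc_ge0.
  have [H [K [LH oH DK dK he]]] := hF _ (divr_gt0 e0 c0).
  have LK : in_L2 mu K by case: DK.
  exists (fun x => a * H x), (fun x => a * K x); split.
  + exact: in_L2Z.
  + move=> J DJ; have LJ : in_L2 mu J by case: DJ.
    by have := ipZr sh a LH LJ; rewrite oH// mulr0.
  + exact: DperpZ.
  + move=> G LG e1 e10; have [b gb hb] := dK _ LG _ (divr_gt0 e10 c0).
    exists (fun n => c * b n); first by apply: goodZ => //; exact: ltW.
    move=> n r hr; rewrite (corrZl (mu_Phi su _))//.
    apply: (@le_trans _ _ (c * corr mu (Phi (n%:R * P + r)) K G)).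
      by rewrite ler_wpM2r ?corr_ge0// lerDl.
    apply: le_trans (ler_wpM2l (ltW c0) (hb n r hr)) _.
    by rewrite mulrDr mulrCA divff ?mulr1// gt_eqF.
  + have L1 : in_L2 mu (fun x => H x + K x - F x) by apply: in_L2B => //; exact: in_L2D.
    rewrite (_ : (fun x => _) = a *: (fun x => H x + K x - F x)); last first.
      by apply/funext => x; rewrite scalefE; ring.
    rewrite (hnormZ sh)// (le_trans (ler_wpM2l (normc_ge0 _) he))//.
    apply: (@le_trans _ _ (c * (e / c))); last by rewrite mulrCA divff ?mulr1// gt_eqF.
    by rewrite ler_wpM2r ?divr_ge0 ?(ltW e0) ?(ltW c0)// lerDl.
- split=> // e e0; have e2 : 0 < e / 2 by rewrite divr_gt0.
  have [F' [[LF' hF'] he']] := h _ e2.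
  have [H [K [LH oH DK dK he]]] := hF' _ e2.
  exists H, K; split=> //; have LK : in_L2 mu K by case: DK.
  have L1 : in_L2 mu (fun x => H x + K x - F' x) by apply: in_L2B => //; exact: in_L2D.
  have L2 : in_L2 mu (fun x => F' x - F x) by exact: in_L2B.
  have := le_trans (ler_hnormD sh L1 L2) (lerD he he').
  rewrite (_ : _ + _ = (fun x => H x + K x - F x)); last first.
    by apply/funext => x; rewrite addfE; ring.
  by move=> h'; apply: le_trans h' _; lra.
Qed.

Theorem dominated_Dperp F G : Dperp F -> in_L2 mu G -> dominated F G.
Proof.
move=> DF LG e e0; have LF : in_L2 mu F by case: DF.
have [_ nF] : [set F | in_L2 mu F /\ near_dominated F] F.
  apply: (product_density su near_dominated_closed _ LF) => E f mE Lf.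
  split; first exact: (product_L2 su).
  (* Splitting off the mean of [f] leaves a function of the height, orthogonal to [Dperp] by
     [Dperp_fourier], and a product whose base factor has mean zero. *)
  move=> e1 e10; pose c := cint nu f.
  have f0 : mean_zero nu (fun x => f x - c).
    apply/mean_zeroP; split; first by apply: in_L2B => //; exact: in_L2_cst.
    have := cintD (cintegrable_L2 Lf) (cintegrable_L2 (in_L2_cst nu (- c))).
    by rewrite cint_cst subrr => <-.
  have L1 : in_L2 mu (fun x => (\1_E (tau x))%:C%C).
    rewrite (_ : (fun x => _) = product_fun E (fun=> 1)).
      by apply: (product_L2 su) => //; exact: in_L2_cst.
    by apply/funext => x; rewrite /product_fun mulr1.
  exists (fun x => c * (\1_E (tau x))%:C%C), (product_fun E (fun x => f x - c)); split.
  - exact: in_L2Z.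
  - move=> K DK; have LK : in_L2 mu K by case: DK.
    by have := ipZr sh c L1 LK; rewrite (Dperp_fourier su DK mE) mulr0.
  - exact: product_Dperp.
  - by move=> G' LG'; exact: dominated_productl.
  - rewrite (_ : (fun x => _) = 0) ?(hnorm0 sh) ?ltW//.
    by apply/funext => x; rewrite /product_fun [RHS]/(0 : R[i]); ring.
pose B := hn G + 1; have B0 : 0 < B by rewrite ltr_wpDl// hnorm_ge0.
have [H [K [LH oH DK dK he]]] := nF (e / 2 / B) (divr_gt0 (divr_gt0 e0 (ltr0Sn _ 1)) B0).
have LK : in_L2 mu K by case: DK.
have DJ := DperpB DK DF; set J := fun x => K x - F x in DJ.
have LJ : in_L2 mu J by case: DJ.
(* Pythagoras: [J] lies in [Dperp], hence is orthogonal to [H], and [J + H] is small. *)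
have hJ : hn J <= e / 2 / B.
  apply: le_trans he; rewrite (_ : (fun x => _) = J + H); last first.
    by apply/funext => x; rewrite addfE /J; ring.
  rewrite -(ler_pXn2r (n := 2)) ?nnegrE ?hnorm_ge0// (hnorm_sqrD sh LJ LH) oH//= mulr0 addr0.
  by rewrite lerDl sqr_ge0.
have [b gb hb] := dK _ LG (e / 2) (divr_gt0 e0 (ltr0Sn _ 1)).
exists b => // n r hr; apply: le_trans (corr_distl (mu_Phi su _) LF LK LG) _.
have h1 : hn J * hn G <= e / 2.
  apply: (@le_trans _ _ (e / 2 / B * B)); last by rewrite divfK// gt_eqF.
  by rewrite ler_pM ?hnorm_ge0// lerDl.
by apply: le_trans (lerD (hb n r hr) h1) _; lra.
Qed.

End Transfer.

End Mixing.

(** * Cesaro means *)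

Section Cesaro.
Context {R : realType}.

Lemma eventually_sum_le (u v : nat -> R) (C : R) : 0 <= C -> (forall n, 0 <= u n) ->
  (forall n, 0 <= v n) -> (\forall n \near \oo, u n <= C * v n) ->
  exists K, forall N, \sum_(n < N) u n <= K + C * \sum_(n < N) v n.
Proof.
move=> C0 u0 v0 [n0 _ h]; exists (\sum_(n < n0) u n) => N.
elim: N => [|N ih]; first by rewrite !big_ord0 mulr0 addr0 sumr_ge0.
have [n0N|Nn0] := leqP n0 N.
  by rewrite !big_ord_recr/= mulrDr addrA lerD// h.
apply: (@le_trans _ _ (\sum_(n < n0) u n)).
  rewrite -!(big_mkord xpredT u) (big_cat_nat _ (n := N.+1) (p := n0))//=.
  by rewrite lerDl sumr_ge0.
by rewrite lerDl mulr_ge0// sumr_ge0.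
Qed.

Lemma inv_nat_cvg0 (K : R) : K * (N%:R)^-1 @[N --> \oo] --> (0 : R).
Proof.
have h : (fun n => K * harmonic n) @ \oo --> K * 0 by exact: cvgM (cvg_cst K) cvg_harmonic.
rewrite mulr0 in h; have /cvg0P h0 := h.
by apply/cvg0P => e /h0[n0 hn]; exists n0.+1 => -[|n] //; exact: hn.
Qed.

Lemma cesaro_cvg0 (u : nat -> R) : u n @[n --> \oo] --> (0 : R) ->
  N%:R^-1 * \sum_(n < N) u n @[N --> \oo] --> (0 : R).
Proof.
move=> /cesaro/cvg0P hu; apply/cvg0P => e /hu[n0 hn]; exists n0.+1 => -[|n] // /hn.
by rewrite /arithmetic_mean /series/= big_mkord.
Qed.

End Cesaro.

(** * Rates of mixing of a map and triviality *)

Section Rates.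
Context {R : realType} {d : measure_display} {T : measurableType d}.
Variables (nu : probability T R) (S : T -> T).
Hypothesis pS : preserving nu nu S.

Definition trivial_mean_zero := forall f, mean_zero nu f -> hnorm (inner nu) f = 0.

Let corrE f g N : map_average nu S f g N = corr_avg (inner nu) (koopman S) f g N.
Proof. by rewrite /map_average /corr_avg; under [in RHS]eq_bigr do rewrite iter_koopman. Qed.

Lemma trivial_of_weak_rate (beta : nat -> R) : beta n @[n --> \oo] --> (0 : R) ->
  map_weak_rate nu S beta -> trivial_mean_zero.
Proof.
move=> b0 h f hf.
apply: (no_uniform_rate (semi_hilbert_mean_zero nu) (isometry_koopman_mean_zero pS) b0) hf.
move=> g hg; have [C hC] := h g g hg hg; exists C.
by apply: filterS hC => N; rewrite corrE.
Qed.

(** Averaging a strong rate gives a weak one. The summand 1 in [beta'] absorbs the finitely many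
    initial correlations, on which the strong bound says nothing. *)
Lemma trivial_of_strong_rate (beta : nat -> R) : (forall n, 0 <= beta n) ->
  beta n @[n --> \oo] --> (0 : R) -> map_strong_rate nu S beta -> trivial_mean_zero.
Proof.
move=> b0 bc h; pose beta' N := N%:R^-1 * (1 + \sum_(n < N) beta n) : R.
apply: (@trivial_of_weak_rate beta').
  have h0 : (fun N => 1 / N%:R + N%:R^-1 * \sum_(n < N) beta n) @ \oo --> 0 + 0.
    exact: cvgD (inv_nat_cvg0 1) (cesaro_cvg0 bc).
  rewrite addr0 in h0; have e : beta' = (fun N => 1 / N%:R + N%:R^-1 * \sum_(n < N) beta n).
    by apply/funext => N; rewrite /beta' mulrDr mul1r mulr1.
  by rewrite e.
move=> f g hf hg; have [C hC] := h f g hf hg.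
have h1 : \forall n \near \oo, corr nu (iter n S) f g <= `|C| * beta n.
  by apply: filterS hC => n hn; apply: le_trans hn _; rewrite ler_wpM2r// ler_norm.
have [K hK] := eventually_sum_le (normr_ge0 C) (fun n => corr_ge0 nu (iter n S) f g) b0 h1.
exists (`|K| + `|C|); apply: nearW => N; rewrite /map_average /beta' mulrCA.
rewrite ler_wpM2l ?invr_ge0//; apply: le_trans (hK N) _.
have s0 : 0 <= \sum_(n < N) beta n by rewrite sumr_ge0.
rewrite mulrDr mulr1 mulrDl -addrA lerD ?ler_norm//.
by rewrite -[leLHS]add0r lerD// -[leLHS]add0r lerD// mulr_ge0.
Qed.

Lemma trivial_corr : trivial_mean_zero ->
  forall n f g, mean_zero nu f -> in_L2 nu g -> corr nu (iter n S) f g = 0.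
Proof.
move=> h n f g hf Lg; have [Lf _] := (mean_zeroP nu f).1 hf.
apply/eqP; rewrite eq_le corr_ge0 andbT.
by have := corr_le (preserving_iter pS n) Lf Lg; rewrite h// mul0r.
Qed.

Lemma trivial_strong_rate beta : trivial_mean_zero -> map_strong_rate nu S beta.
Proof.
move=> h f g hf /mean_zeroP[Lg _]; exists 0; apply: nearW => n.
by rewrite (trivial_corr h)// mul0r.
Qed.

Lemma trivial_weak_rate beta : trivial_mean_zero -> map_weak_rate nu S beta.
Proof.
move=> h f g hf /mean_zeroP[Lg _]; exists 0; apply: nearW => n.
by rewrite /map_average big1 ?mulr0 ?mul0r// => i _; rewrite (trivial_corr h).
Qed.

End Rates.

(** * Equivalence of mixing for the flow and for the return map *)

Section FlowMixing.
Context {R : realType} {d : measure_display} {T : measurableType d}.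
Variables (mu nu : probability T R) (rho : probability (measurableTypeR R) R).
Variables (Phi : R -> T -> T) (P : R) (tau : T -> R).
Hypothesis su : suspension mu nu rho Phi P tau.
Local Notation om := (pi *+ 2 / P : R).
Local Notation Dperp := (orthocompl mu (flow_discrete mu Phi)).
Local Notation hn := (hnorm (inner mu)).
Local Notation leb := (@lebesgue_measure R).
Local Notation product_fun := (product_fun Phi tau).
Hypothesis freq : forall w, eigenfrequency mu Phi w -> exists k : int, w = k%:~R * om.

Let P0 : 0 < P := su_P su.
Local Notation lap t := (Num.truncn (t / P)).

Lemma lap_itv t : 0 <= t -> (lap t)%:R * P <= t < (lap t)%:R * P + P.
Proof.
move=> t0; have := truncn_itv (divr_ge0 t0 (ltW P0)).
by rewrite ler_pdivlMr// ltr_pdivrMr// -natr1 mulrDl mul1r.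
Qed.

Lemma lap_eq (n : nat) t : n%:R * P <= t < n%:R * P + P -> lap t = n.
Proof.
move=> /andP[h1 h2]; apply: truncn_def.
by rewrite ler_pdivlMr// ltr_pdivrMr// h1 -natr1 mulrDl mul1r.
Qed.

Lemma lap_ge (n : nat) t : n%:R * P <= t -> (n <= lap t)%N.
Proof.
move=> h; have t0 : 0 <= t by rewrite (le_trans _ h)// mulr_ge0// ltW.
by rewrite -ltnS -(ltr_nat R) -(ltr_pM2r P0) (le_lt_trans h)//;
   have /andP[_] := lap_itv t0; rewrite -natr1 mulrDl mul1r.
Qed.

Let corr_lap F G (e : R) (b : nat -> R) :
  (forall (n : nat) (r : R), 0 <= r < P -> corr mu (Phi (n%:R * P + r)) F G <= e + b n) ->
  forall t, 0 <= t -> corr mu (Phi t) F G <= e + b (lap t).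
Proof.
move=> h t /lap_itv/andP[h1 h2].
have := h (lap t) (t - (lap t)%:R * P); rewrite [(lap t)%:R * P + _]addrC subrK; apply.
by rewrite subr_ge0 h1 ltrBlDl.
Qed.

Theorem flow_strongly_mixing_of_map :
  map_strongly_mixing nu (Phi P) -> flow_strongly_mixing mu Phi Dperp.
Proof.
move=> hm F G DF LG; apply/cvgrPdist_le => e e0.
have e2 : 0 < e / 2 by rewrite divr_gt0.
have [] := @dominated_Dperp _ _ _ _ _ _ _ _ _ su freq (fun b => b n @[n --> \oo] --> (0 : R))
  _ _ _ hm F G DF LG _ e2.
- by move=> a b ha hb; rewrite -[X in _ --> X]addr0; exact: cvgD.
- by move=> c a _ ha; rewrite -[X in _ --> X](mulr0 c); apply: cvgM => //; exact: cvg_cst.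
- by move=> a; rewrite -cvg_shiftS.
move=> b /cvg0P hb /corr_lap hF; have [n0 hn0] := hb _ e2.
exists (n0%:R * P); split=> [|t ht]; first exact: num_real.
have t0 : 0 <= t by rewrite (le_trans _ (ltW ht))// mulr_ge0// ltW.
rewrite sub0r normrN ger0_norm ?corr_ge0//; apply: le_trans (hF _ t0) _.
have := le_trans (ler_norm _) (hn0 _ (lap_ge (ltW ht))); lra.
Qed.

(** The flow is tested at the times [n P] on the pair of products of [corr_half], whose correlation
    is half that of the map. *)
Theorem map_strongly_mixing_of_flow :
  flow_strongly_mixing mu Phi Dperp -> map_strongly_mixing nu (Phi P).
Proof.
move=> hf f g f0 Lg; apply/cvg0P => e e0.
have Lf : in_L2 nu f by case/mean_zeroP: f0.
have mI : measurable (`[0, P / 2[%classic : set (measurableTypeR R)) by exact: measurable_itv.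
have /cvgrPdist_le/(_ (e / 2) (divr_gt0 e0 (ltr0Sn _ 1)))[M [_ hM]] :=
  hf _ _ (product_Dperp su freq measurableT f0) (product_L2 su mI Lg).
exists (lap `|M|).+1 => n hn; have := hM (n%:R * P).
rewrite sub0r normrN !ger0_norm ?corr_ge0// -[n%:R * P]addr0 (corr_half su)//; last first.
  by rewrite lexx/= divr_gt0.
move=> h; have := h _; rewrite ler_pM2r ?invr_gt0//; apply.
rewrite addr0 (le_lt_trans (ler_norm _))//.
have /andP[_ h2] := lap_itv (normr_ge0 M); apply: lt_le_trans h2 _.
by rewrite -[X in _ + X]mul1r -mulrDl natr1 ler_pM2r// ler_nat.
Qed.

(** The intervals start at multiples of [P] and have length at most [P], so only the one of the
    current lap can contain [t]. *)
Lemma step_sum (N : nat) (a : nat -> R) (q t : R) : q <= P -> 0 <= t ->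
  \sum_(n < N) a n * \1_(`[n%:R * P, n%:R * P + q[%classic) t =
  if (lap t < N)%N then a (lap t) * \1_(`[(lap t)%:R * P, (lap t)%:R * P + q[%classic) t else 0.
Proof.
move=> qP t0; have z (n : nat) : n != lap t -> a n * \1_(`[n%:R * P, n%:R * P + q[%classic) t = 0.
  move=> nl; rewrite indicE memNset ?mulr0//= in_itv/= => /andP[h1 h2].
  move/eqP: nl; apply; apply/esym/lap_eq; rewrite h1 (lt_le_trans h2)//.
  by rewrite lerD2l.
case: ifPn => [h|h].
  rewrite (bigD1 (Ordinal h))//= big1 ?addr0// => i hi; apply: z.
  by apply: contra hi => /eqP hi; apply/eqP/val_inj.
rewrite big1// => i _; apply: z; apply: contra h => /eqP <-; exact: ltn_ord.
Qed.

Let leb_step (n : nat) (q : R) : 0 < q -> leb (`[n%:R * P, n%:R * P + q[%classic) = q%:E.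
Proof.
move=> q0; rewrite lebesgue_measure_itv/= lte_fin ltrDl q0 -EFinB.
by congr EFin; ring.
Qed.

Theorem flow_weakly_mixing_of_map :
  map_weakly_mixing nu (Phi P) -> flow_weakly_mixing mu Phi Dperp.
Proof.
move=> hm F G DF LG; apply/cvgrPdist_le => e e0.
pose avg (b : nat -> R) N := N%:R^-1 * \sum_(n < N) b n.
pose good b := (forall n, 0 <= b n) /\ avg b N @[N --> \oo] --> (0 : R).
have e4 : 0 < e / 4 by rewrite divr_gt0.
have [] := @dominated_Dperp _ _ _ _ _ _ _ _ _ su freq good _ _ _ _ F G DF LG _ e4.
- move=> a b [a0 /cvg0P ha] [b0 /cvg0P hb]; split=> [n|]; first exact: addr_ge0.
  apply/cvg0P => e' e'0; have e'2 : 0 < e' / 2 by rewrite divr_gt0.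
  have [n1 h1] := ha _ e'2; have [n2 h2] := hb _ e'2.
  exists (maxn n1 n2) => N; rewrite geq_max => /andP[/h1 k1 /h2 k2].
  rewrite /avg big_split/= mulrDr (le_trans (ler_normD _ _))//.
  by apply: le_trans (lerD k1 k2) _; lra.
- move=> c a c0 [a0 ha]; split=> [n|]; first exact: mulr_ge0.
  have h0 : (fun N => c * avg a N) @ \oo --> c * 0 by exact: cvgM (cvg_cst c) ha.
  rewrite mulr0 in h0.
  by rewrite (_ : avg _ = (fun N => c * avg a N))//; apply/funext => N; rewrite /avg -mulr_sumr mulrCA.
(* Shifting drops the first term and divides by [N.+1] instead of [N.+2], which costs at most a
   factor 2. *)
- move=> a [a0 /cvg0P ha]; split=> //; apply/cvg0P => e' e'0.
  have [n1 h1] := ha _ (divr_gt0 e'0 (ltr0Sn _ 1)).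
  exists n1.+1 => -[//|N] hN; have := h1 N.+2 (leq_trans (ltnW hN) (leqnSn _)).
  have s0 M (b : nat -> R) : (forall n, 0 <= b n) -> 0 <= avg b M.
    by move=> b0; rewrite mulr_ge0 ?invr_ge0// sumr_ge0.
  rewrite !ger0_norm ?s0// => h.
  have : avg (fun n => a n.+1) N.+1 <= 2 * avg a N.+2; last by lra.
  rewrite /avg [in leRHS]big_ord_recl mulrA.
  have h2 : N.+1%:R^-1 <= 2 * N.+2%:R^-1 :> R.
    by rewrite ler_pdivlMr ?ltr0n// mulrC ler_pdivrMr ?ltr0n// -natrM ler_nat mulnS mul2n -addnn addnA leq_addr.
  apply: ler_pM; rewrite ?invr_ge0 ?sumr_ge0//.
  by rewrite lerDr.
- move=> f g hf hg; split; last exact: hm.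
  by move=> n; exact: corr_ge0.
move=> b [b0 /cvg0P hb] /corr_lap hF; have [n0 hn0] := hb _ e4.
(* The successor guarantees that [t] is at least one full period. *)
exists (n0.+1%:R * P); split=> [|t ht]; first exact: num_real.
have tP : P <= t by rewrite (le_trans _ (ltW ht))// ler_peMl ?ler1n// ltW.
have t0 : 0 < t by exact: lt_le_trans tP.
rewrite sub0r normrN ger0_norm; last first.
  by rewrite mulr_ge0 ?invr_ge0 ?(ltW t0)// Rintegral_ge0// => s _; exact: corr_ge0.
pose N := (lap t).+1.
have h : \int[leb]_(s in `[0, t]) corr mu (Phi s) F G <= P * \sum_(n < N) (e / 4 + b n).
  apply: (@Rintegral_le_step _ N (fun n => e / 4 + b n) (fun n => `[n%:R * P, n%:R * P + P[%classic)).
  - by move=> n; rewrite addr_ge0// ltW.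
  - by move=> n; exact: measurable_itv.
  - by move=> n; exact: leb_step.
  - exact: measurable_itv.
  - by move=> s; exact: corr_ge0.
  - move=> s /=; rewrite in_itv/= => /andP[s0 st]; rewrite (step_sum N (fun n => e / 4 + b n) (lexx P) s0) ifT; last first.
      by rewrite ltnS; apply: lap_ge; apply: le_trans st; have /andP[] := lap_itv s0.
    by rewrite indicE mem_set ?mulr1 ?hF//= in_itv/=; exact: lap_itv.
have N0 : 0 < (N%:R : R) by rewrite ltr0n.
(* Rounding up to whole periods at most doubles the time; with the errors [e / 4] of the domination
   and of the mean this gives [e]. *)
have NP : N%:R * P <= 2 * t.
  have /andP[h1 _] := lap_itv (ltW t0).
  by rewrite /N -natr1 mulrDl mul1r; lra.
have hN : avg b N <= e / 4.
  apply: le_trans (ler_norm _) (hn0 _ _); apply: leq_trans (leqnSn _).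
  by apply: lap_ge; rewrite (le_trans _ (ltW ht))// ler_wpM2r ?ler_nat// ltW.
rewrite /flow_average mulrC ler_pdivrMr// (le_trans h)//.
have -> : \sum_(n < N) (e / 4 + b n) = N%:R * (e / 4 + avg b N).
  rewrite big_split/= sumr_const card_ord -[X in X + _]mulr_natl mulrDr /avg mulVKf ?gt_eqF//.
rewrite mulrA [P * _]mulrC; apply: (@le_trans _ _ (N%:R * P * (e / 2))).
  by rewrite ler_wpM2l ?mulr_ge0 ?(ltW N0) ?(ltW P0)//; lra.
apply: (@le_trans _ _ (2 * t * (e / 2))); last by lra.
by rewrite ler_wpM2r// ltW// divr_gt0.
Qed.

End FlowMixing.

(** * Rates of mixing of the flow *)

Section FlowRates.
Context {R : realType} {d : measure_display} {T : measurableType d}.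
Variables (mu nu : probability T R) (rho : probability (measurableTypeR R) R).
Variables (Phi : R -> T -> T) (P : R) (tau : T -> R).
Hypothesis su : suspension mu nu rho Phi P tau.
Local Notation om := (pi *+ 2 / P : R).
Local Notation Dperp := (orthocompl mu (flow_discrete mu Phi)).
Local Notation hn := (hnorm (inner mu)).
Local Notation leb := (@lebesgue_measure R).
Local Notation product_fun := (product_fun Phi tau).
Hypothesis freq : forall w, eigenfrequency mu Phi w -> exists k : int, w = k%:~R * om.

Let P0 : 0 < P := su_P su.
Local Notation lap t := (Num.truncn (t / P)).

Lemma trivial_flow_corr : trivial_mean_zero nu ->
  forall F G t, Dperp F -> in_L2 mu G -> 0 <= t -> corr mu (Phi t) F G = 0.
Proof.
move=> h F G t DF LG t0; apply/eqP; rewrite eq_le corr_ge0 andbT.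
apply/ler_addgt0Pr => e e0; rewrite add0r.
have [] := @dominated_Dperp _ _ _ _ _ _ _ _ _ su freq (fun b => forall n, b n = 0)
  _ _ _ _ F G DF LG _ e0.
- by move=> a b ha hb n; rewrite ha hb addr0.
- by move=> c a _ ha n; rewrite ha mulr0.
- by move=> a ha n; rewrite ha.
- by move=> f g hf Lg n; exact: (trivial_corr (su_nu su) h).
move=> b b0 /(_ (lap t) (t - (lap t)%:R * P)).
rewrite b0 addr0 [_ * P + _]addrC subrK; apply.
by have /andP[h1 h2] := lap_itv su t0; rewrite subr_ge0 h1 ltrBlDl.
Qed.

Lemma map_strong_rate_of_flow alpha : flow_strong_rate mu Phi Dperp alpha ->
  map_strong_rate nu (Phi P) (fun k => alpha (k%:R * P)).
Proof.
move=> h f g f0 g0.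
have Lf : in_L2 nu f by case/mean_zeroP: f0.
have Lg : in_L2 nu g by case/mean_zeroP: g0.
have mI : measurable (`[0, P / 2[%classic : set (measurableTypeR R)) by exact: measurable_itv.
have [C [M [_ hM]]] := h _ _ (product_Dperp su freq measurableT f0) (product_Dperp su freq mI g0).
(* The factor 2 undoes the one half in [corr_half]. *)
exists (2 * C); exists (lap `|M|).+1 => // n /= hn; have := hM (n%:R * P).
rewrite -{2}[n%:R * P]addr0 (corr_half su)//; last by rewrite lexx/= divr_gt0.
move=> k; rewrite -mulrA -ler_pdivrMl// mulrC k//.
rewrite (le_lt_trans (ler_norm _))//.
have /andP[_ h2] := lap_itv su (normr_ge0 M); apply: lt_le_trans h2 _.
by rewrite -[X in _ + X]mul1r -mulrDl natr1 ler_pM2r// ler_nat.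
Qed.

(** On the first half of each period the correlation of the flow is known exactly from [corr_half].
    The integral over the first [N] periods is bounded below by these halves alone. *)
Lemma map_weak_rate_of_flow alpha : flow_weak_rate mu Phi Dperp alpha ->
  map_weak_rate nu (Phi P) (fun k => alpha (k%:R * P)).
Proof.
move=> h f g f0 g0.
have Lf : in_L2 nu f by case/mean_zeroP: f0.
have Lg : in_L2 nu g by case/mean_zeroP: g0.
have mI : measurable (`[0, P / 2[%classic : set (measurableTypeR R)) by exact: measurable_itv.
set F := product_fun setT f; set G := product_fun `[0, P / 2[%classic g.
have DF : Dperp F by exact: (product_Dperp su freq).
have DG : Dperp G by exact: (product_Dperp su freq).
have LF : in_L2 mu F by case: DF.
have LG : in_L2 mu G by case: DG.
have [C [M [_ hM]]] := h _ _ DF DG.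
(* A factor 2 for using half of each period, another for the one half in [corr_half]. *)
exists (4 * C); exists (lap `|M|).+1 => // N /= hN.
have MN : M < N%:R * P.
  rewrite (le_lt_trans (ler_norm _))//.
  have /andP[_ h2] := lap_itv su (normr_ge0 M); apply: lt_le_trans h2 _.
  by rewrite -[X in _ + X]mul1r -mulrDl natr1 ler_pM2r// ler_nat.
have N0 : 0 < (N%:R : R) by rewrite ltr0n (leq_trans _ hN).
have P2 : 0 < P / 2 by rewrite divr_gt0.
have P2P : P / 2 <= P by lra.
pose c n := corr nu (iter n (Phi P)) f g.
have key : P / 2 * \sum_(n < N) (c n / 2) <= \int[leb]_(t in `[0, N%:R * P]) corr mu (Phi t) F G.
  apply: (@step_le_Rintegral _ N (fun n => c n / 2) (fun n => `[n%:R * P, n%:R * P + P / 2[%classic)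
      _ _ _ _ _ _ _ (hn F * hn G)).
  - by move=> n; rewrite divr_ge0// corr_ge0.
  - by move=> n; exact: measurable_itv.
  - move=> n; rewrite lebesgue_measure_itv/= lte_fin ltrDl P2 -EFinB.
    by congr EFin; ring.
  - by move=> t; rewrite corr_ge0/=; exact: (corr_le (mu_Phi su t)).
  - move=> t; have u0 : 0 <= corr mu (Phi t) F G * \1_(`[0, N%:R * P]%classic) t.
      by rewrite mulr_ge0 ?corr_ge0// indicE.
    have [t0|t0] := leP 0 t; last first.
      rewrite big1// => i _; rewrite indicE memNset ?mulr0//= in_itv/= => /andP[h1 _].
      have : 0 <= t by rewrite (le_trans _ h1)// mulr_ge0// ltW.
      by rewrite leNgt t0.
    rewrite (step_sum su N (fun n => c n / 2) P2P t0); case: ifPn => // lN.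
    have [h1|h1] := pselect (`[(lap t)%:R * P, (lap t)%:R * P + P / 2[%classic t); last first.
      by rewrite indicE memNset// mulr0.
    rewrite [X in _ * X <= _]indicE mem_set// mulr1 [X in _ <= _ * X]indicE mem_set; last first.
      move: h1; rewrite /= !in_itv/= t0/= => /andP[_ h2]; apply: le_trans (ltW h2) _.
      apply: (@le_trans _ _ ((lap t)%:R * P + P)); first by rewrite lerD2l.
      by rewrite -[X in _ + X]mul1r -mulrDl natr1 ler_pM2r// ler_nat.
    rewrite mulr1; move: h1; rewrite /= in_itv/= => /andP[h1 h2].
    have := corr_half su (lap t) (r := t - (lap t)%:R * P) Lf Lg.
    by rewrite [_ * P + _]addrC subrK -/F -/G => -> //; rewrite subr_ge0 h1 ltrBlDl.
have := hM _ MN; rewrite /flow_average => hC.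
have : (N%:R * P)^-1 * (P / 2 * \sum_(n < N) (c n / 2)) <= C * alpha (N%:R * P).
  by apply: le_trans hC; rewrite ler_wpM2l// invr_ge0 mulr_ge0// ltW.
rewrite -mulr_suml => h2; rewrite -mulrA -ler_pdivrMl//; apply: le_trans h2.
rewrite le_eqVlt; apply/orP; left; apply/eqP; rewrite /map_average -/c; field.
by rewrite !gt_eqF.
Qed.

Variable alpha : R -> R.
Hypothesis ra : rate_function alpha.
(** In the application [S] is [Phi P] or its inverse, according to the sign of [omega]. *)
Variable S : T -> T.
Hypothesis pS : preserving nu nu S.

Lemma rate_lap : alpha (k%:R * P) @[k --> \oo] --> (0 : R).
Proof.
apply/cvg0P => e e0; have [_ /cvgrPdist_le/(_ _ e0)[M [_ hM]]] := ra.
exists (lap `|M|).+1 => n hn; have := hM (n%:R * P); rewrite sub0r normrN; apply.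
rewrite (le_lt_trans (ler_norm _))//.
have /andP[_ h2] := lap_itv su (normr_ge0 M); apply: lt_le_trans h2 _.
by rewrite -[X in _ + X]mul1r -mulrDl natr1 ler_pM2r// ler_nat.
Qed.

(* Either side forces [L^2(nu)] to consist of the constants only. *)
Theorem strong_rates : flow_strong_rate mu Phi Dperp alpha <->
  map_strong_rate nu S (fun k => alpha (k%:R * P)).
Proof.
have a0 k : 0 <= alpha (k%:R * P) by apply: ltW; case: ra.
split=> [/map_strong_rate_of_flow h|h].
  apply: (trivial_strong_rate pS).
  exact: (trivial_of_strong_rate (su_nu su) a0 rate_lap h).
have h0 := trivial_of_strong_rate pS a0 rate_lap h.
move=> F G DF [LG _]; exists 0; exists 0; split=> // t /ltW t0.
by rewrite mul0r (trivial_flow_corr h0).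
Qed.

Theorem weak_rates : flow_weak_rate mu Phi Dperp alpha <->
  map_weak_rate nu S (fun k => alpha (k%:R * P)).
Proof.
split=> [/map_weak_rate_of_flow h|h].
  apply: (trivial_weak_rate pS).
  exact: (trivial_of_weak_rate (su_nu su) rate_lap h).
have h0 := trivial_of_weak_rate pS rate_lap h.
move=> F G DF [LG _]; exists 0; exists 0; split=> // t t0.
rewrite mul0r /flow_average.
rewrite (_ : \int[_]_(s in _) _ = 0) ?mulr0//.
transitivity (\int[leb]_(s in `[0, t]) (0 : R)).
  apply: eq_Rintegral => s; rewrite inE/= in_itv/= => /andP[s0 _].
  exact: trivial_flow_corr.
by rewrite /Rintegral integral0.
Qed.

End FlowRates.

(** * Passage to the inverse of the return map *)

Section InverseMap.
Context {R : realType} {d : measure_display} {T : measurableType d}.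
Variables (nu : probability T R) (S S' : T -> T).
Hypothesis pS : preserving nu nu S.
Hypothesis pS' : preserving nu nu S'.
Hypothesis SK : cancel S S'.

Lemma mean_zero_center g : in_L2 nu g -> mean_zero nu (fun x => g x - cint nu g).
Proof.
move=> Lg; apply/mean_zeroP; split; first by apply: in_L2B => //; exact: in_L2_cst.
have := cintD (cintegrable_L2 Lg) (cintegrable_L2 (in_L2_cst nu (- cint nu g))).
by rewrite cint_cst subrr => <-.
Qed.

(** Composition with [S] is adjoint to composition with [S'], so the two functions exchange roles.
    As the first argument must have mean zero, [g] is centred, at no cost since [f] has mean
    zero. *)
Lemma corr_inverse n f g : mean_zero nu f -> in_L2 nu g ->
  corr nu (iter n S') f g = corr nu (iter n S) (fun x => g x - cint nu g) f.
Proof.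
move=> /mean_zeroP[Lf f0] Lg; pose c := cint nu g; rewrite -/c.
have sh := semi_hilbert_L2 nu.
have Lg0 : in_L2 nu (fun x => g x - c) by apply: in_L2B => //; exact: in_L2_cst.
have Lc := in_L2_cst nu c.
have Lg0n := comp_L2 (preserving_iter pS n) Lg0.
have K x : iter n S' (iter n S x) = x.
  elim: n x {Lg0n} => // n ih x; rewrite iterSr iterS SK; exact: ih.
have e1 : inner nu (f \o iter n S') g = inner nu f (g \o iter n S).
  rewrite -(preserving_inner (preserving_iter pS n) (comp_L2 (preserving_iter pS' n) Lf) Lg).
  by congr inner; apply/funext => x /=; rewrite K.
have e2 : inner nu f (g \o iter n S) = inner nu f ((fun x => g x - c) \o iter n S).
  rewrite [in RHS](_ : _ \o _ = (g \o iter n S) - cst c)//.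
  have Lgn := comp_L2 (preserving_iter pS n) Lg.
  rewrite (ipDr sh Lgn (shN sh Lc) Lf) (ipNr sh Lc Lf) (inner_cst c Lf) f0 mul0r.
  by rewrite subr0.
by rewrite /corr e1 e2 (ipC sh Lg0n Lf) normcJ.
Qed.

End InverseMap.

Section InverseEigen.
Context {R : realType} {d : measure_display} {T : measurableType d}.
Variables (nu : probability T R) (S S' : T -> T).
Hypothesis pS : preserving nu nu S.
Hypothesis pS' : preserving nu nu S'.
Hypothesis SK : cancel S S'.

Lemma map_eigenfunction_inverse c f : map_eigenfunction nu S' c f ->
  c != 0 /\ map_eigenfunction nu S c^-1 f.
Proof.
move=> [Lf f0 eq]; have eq' := preserving_ae pS eq.
have c0 : c != 0.
  apply/eqP => c0; apply: f0; apply: filterS eq' => x.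
  by rewrite SK c0 mul0r.
split=> //; split=> //; apply: filterS eq' => x; rewrite SK => ->.
by rewrite mulKf.
Qed.

Lemma map_strongly_mixing_inverse : map_strongly_mixing nu S -> map_strongly_mixing nu S'.
Proof.
move=> h f g f0 Lg; have Lf : in_L2 nu f by case/mean_zeroP: f0.
have h1 := h _ f (mean_zero_center Lg) Lf.
have e n : corr nu (iter n S') f g = corr nu (iter n S) (fun x => g x - cint nu g) f.
  exact: corr_inverse.
by move: h1; rewrite (_ : (fun n => corr nu (iter n S) _ f) = (fun n => corr nu (iter n S') f g))//;
   apply/funext => n; rewrite e.
Qed.

Lemma map_weakly_mixing_inverse : map_weakly_mixing nu S -> map_weakly_mixing nu S'.
Proof.
move=> h f g f0 Lg; have Lf : in_L2 nu f by case/mean_zeroP: f0.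
have h1 := h _ f (mean_zero_center Lg) Lf.
rewrite (_ : map_average nu S' f g = map_average nu S (fun x => g x - cint nu g) f)//.
apply/funext => N; rewrite /map_average; congr (_ * _).
by apply: eq_bigr => i _; exact: corr_inverse.
Qed.

End InverseEigen.

(** * The conclusions for a suspension, for either sign of the frequency *)

Section SuspensionConclusion.
Context {R : realType} {d : measure_display} {T : measurableType d}.
Variables (mu nu : probability T R) (rho : probability (measurableTypeR R) R).
Variables (Phi : R -> T -> T) (P : R) (tau : T -> R).
Hypothesis su : suspension mu nu rho Phi P tau.
Local Notation Dperp := (orthocompl mu (flow_discrete mu Phi)).

Let P0 : 0 < P := su_P su.

Lemma PhiPK : cancel (Phi P) (Phi (- P)). Proof. exact: (PhiK su). Qed.
Lemma PhiPNK : cancel (Phi (- P)) (Phi P). Proof. exact: (PhiNK su). Qed.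

Variables (omega : R) (m : nat) (w : 'I_m -> R) (zs : 'I_m -> T -> R[i]).
Hypothesis m_ge1 : (1 <= m)%N.
Hypothesis omega0 : omega != 0.
Hypothesis PE : P = 2 * pi / `|omega|.
Hypothesis eig : eigenfrequency mu Phi omega.
Hypothesis prim : primitive_frequency mu Phi omega.
Hypothesis gen : generated_by_independent mu Phi w zs.

Let cisP : cis (omega * P) = 1 :> R[i].
Proof.
rewrite PE; have [om0|om0] := leP 0 omega.
  rewrite ger0_norm// (_ : _ * _ = pi *+ 2) ?cis2pi//.
  by rewrite mulrCA divff// mulr1 mulr_natl.
rewrite ltr0_norm// (_ : _ * _ = (-1)%:~R * (pi *+ 2)) ?cis_2piz//.
by rewrite invrN mulrN mulrN mulrCA divff// mulr1 mulr_natl mulN1r.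
Qed.

Lemma period_cases : 2 * pi / omega = P \/ 2 * pi / omega = - P.
Proof.
rewrite PE; have [om0|om0] := leP 0 omega; first by left; rewrite ger0_norm.
by right; rewrite ltr0_norm// invrN mulrN opprK.
Qed.

Lemma norm_period : `|2 * pi / omega| = P.
Proof. by case: period_cases => ->; rewrite ?normrN gtr0_norm. Qed.

Lemma preserving_period : preserving nu nu (Phi (2 * pi / omega)).
Proof. by case: period_cases => ->; [exact: su_nu su|exact: nu_PhiN su]. Qed.

Lemma generated_period : map_generated_by nu (Phi (2 * pi / omega)) m.-1.
Proof.
have h : map_generated_by nu (Phi P) m.-1.
  case: m m_ge1 w zs gen => // k _ w' zs' gen'.
  exact: (map_generated_suspension su cisP eig prim gen').
case: period_cases => -> //; have [lam [v [ev hv]]] := h.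
exists (fun i => (lam i)^-1), v; split=> [i|c f].
  exact: (map_eigenfunction_inverse (nu_PhiN su) PhiPNK (ev i)).2.
move=> /(map_eigenfunction_inverse (su_nu su) PhiPK)[c0 /hv[a ca]]; exists a.
rewrite -[c]invrK ca -prodfV; apply: eq_bigr => i _.
by rewrite exprz_inv invr_expz.
Qed.

Section OneDimensional.
Hypothesis m1 : m = 1%N.

Let w0 : exists2 w0 : R, eigenfrequency mu Phi w0 &
  forall w', eigenfrequency mu Phi w' -> exists a : int, w' = a%:~R * w0.
Proof.
case: gen => hz _ hw; move: w zs hz hw; rewrite m1 => w' zs' hz hw.
exists (w' ord0); first by exists (zs' ord0).
by move=> v /hw[a ->]; exists (a ord0); rewrite big_ord1.
Qed.

(** By primitivity the generator of the frequencies is [omega] up to sign, and [2 pi / P] is the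
    absolute value of [omega]. *)
Lemma one_dim_frequency v : eigenfrequency mu Phi v ->
  exists k : int, v = k%:~R * (pi *+ 2 / P).
Proof.
have [v0 ev0 h] := w0; have [a oa] := h _ eig; have a1 := prim ev0 oa.
have om : pi *+ 2 / P = `|omega|.
  have pn : (pi : R) != 0 by rewrite gt_eqF ?pi_gt0.
  by rewrite PE -[pi *+ 2]mulr_natl invf_div mulrCA divff ?mulr1 ?mulf_neq0 ?pnatr_eq0//.
rewrite om => /h[b ->].
have [s sE] : exists s : int, v0 = s%:~R * `|omega|.
  have [e|e] : a = 1 \/ a = - 1.
    by case: a a1 {oa} => [n|n] /= => [->|[->]]; [left|right].
  - move: oa; rewrite e mul1r => ->; have [om0|om0] := leP 0 v0.
      by exists 1; rewrite mul1r ger0_norm.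
    by exists (-1); rewrite ltr0_norm// mulN1r opprK.
  - move: oa; rewrite e mulN1r => ->; rewrite normrN; have [om0|om0] := leP 0 v0.
      by exists 1; rewrite mul1r ger0_norm.
    by exists (-1); rewrite ltr0_norm// mulN1r opprK.
by exists (b * s); rewrite rmorphM/= -mulrA -sE.
Qed.

Lemma constant_eigenfunctions : forall c f,
  map_eigenfunction nu (Phi (2 * pi / omega)) c f -> ae_constant nu f.
Proof.
have [v0 ev0 h] := w0.
have hc := map_eigenfunction_constant su cisP eig prim ev0 h.
case: period_cases => -> // c f.
by move=> /(map_eigenfunction_inverse (su_nu su) PhiPK)[_ /hc].
Qed.

Lemma weakly_mixing_P : map_weakly_mixing nu (Phi P).
Proof.
have [v0 ev0 h] := w0; apply: (map_weakly_mixing_of_constant su).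
exact: (map_eigenfunction_constant su cisP eig prim ev0 h).
Qed.

Lemma weakly_mixing_period : map_weakly_mixing nu (Phi (2 * pi / omega)).
Proof.
case: period_cases => ->; first exact: weakly_mixing_P.
exact: (map_weakly_mixing_inverse (su_nu su) (nu_PhiN su) PhiPK weakly_mixing_P).
Qed.

Lemma strongly_mixing_period :
  map_strongly_mixing nu (Phi (2 * pi / omega)) <-> map_strongly_mixing nu (Phi P).
Proof.
case: period_cases => -> //; split.
  exact: (map_strongly_mixing_inverse (nu_PhiN su) (su_nu su) PhiPNK).
exact: (map_strongly_mixing_inverse (su_nu su) (nu_PhiN su) PhiPK).
Qed.

End OneDimensional.

Theorem suspension_theorem :
  map_generated_by nu (Phi (2 * pi / omega)) m.-1 /\
  (m = 1%N ->
    ((forall c f, map_eigenfunction nu (Phi (2 * pi / omega)) c f -> ae_constant nu f) /\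
     map_weakly_mixing nu (Phi (2 * pi / omega))) /\
    ((flow_strongly_mixing mu Phi Dperp <-> map_strongly_mixing nu (Phi (2 * pi / omega))) /\
     (map_strongly_mixing nu (Phi (2 * pi / omega)) ->
        forall alpha : R -> R, rate_function alpha ->
          (flow_strong_rate mu Phi Dperp alpha <->
           map_strong_rate nu (Phi (2 * pi / omega)) (fun k => alpha (k%:R * `|2 * pi / omega|))))) /\
    ((flow_weakly_mixing mu Phi Dperp <-> map_weakly_mixing nu (Phi (2 * pi / omega))) /\
     (map_weakly_mixing nu (Phi (2 * pi / omega)) ->
        forall alpha : R -> R, rate_function alpha ->
          (flow_weak_rate mu Phi Dperp alpha <->
           map_weak_rate nu (Phi (2 * pi / omega)) (fun k => alpha (k%:R * `|2 * pi / omega|)))))).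
Proof.
split; first exact: generated_period.
move=> m1; have freq := one_dim_frequency m1.
rewrite norm_period; split; first by split; [exact: constant_eigenfunctions|exact: weakly_mixing_period].
split; split.
- rewrite strongly_mixing_period; split; first exact: (map_strongly_mixing_of_flow su freq).
  exact: (flow_strongly_mixing_of_map su freq).
- by move=> _ alpha ra; exact: (strong_rates su freq ra preserving_period).
(* In dimension one both sides of the equivalence hold. *)
- split=> _; first exact: weakly_mixing_period.
  exact: (flow_weakly_mixing_of_map su freq (weakly_mixing_P m1)).
- by move=> _ alpha ra; exact: (weak_rates su freq ra preserving_period).
Qed.

End SuspensionConclusion.

(** * The cross-section of an eigenfunction *)

Section Angle.
Context {R : realType}.

Definition angle (c : R[i]) : R :=
  if 0 <= complex.Im c then acos (complex.Re c) else pi *+ 2 - acos (complex.Re c).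

Lemma angleP c : normc c = 1 -> 0 <= angle c < pi *+ 2 /\ cis (angle c) = c.
Proof.
move=> c1; have e : complex.Re c ^+ 2 + complex.Im c ^+ 2 = 1 by rewrite -normc_sqr c1 expr1n.
have h : -1 <= complex.Re c <= 1 by have := normc_Re c; rewrite c1 ler_norml.
have hi : complex.Re c \in `[-1, 1] by rewrite in_itv.
have p0 : 0 < (pi : R) by exact: pi_gt0.
have s2 : sin (acos (complex.Re c)) = `|complex.Im c|.
  by rewrite sin_acos// -sqrtr_sqr; congr Num.sqrt; rewrite -e addrC addKr.
rewrite /angle; case: ifPn => [i0|]; last rewrite -ltNge => i0; split.
- rewrite acos_ge0//= (le_lt_trans (acos_lepi h))// mulr2n; lra.
- by apply: eq_complexP; rewrite /= ?acosK// s2 ger0_norm.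
- have h1 : complex.Re c < 1.
    rewrite lt_neqAle; case/andP: h => _ ->; rewrite andbT; apply/eqP => c1'.
    have /eqP : complex.Im c ^+ 2 = 0 by move: e; rewrite c1' expr1n; lra.
    by rewrite sqrf_eq0 => /eqP i1; rewrite i1 ltxx in i0.
  rewrite subr_ge0 ltrBlDr ltrDl acos_gt0 ?h1 ?andbT; last by case/andP: h.
  by rewrite (le_trans (acos_lepi h))// mulr2n; lra.
- apply: eq_complexP; rewrite /= ?cosB ?sinB cos2pi sin2pi.
    by rewrite mul1r mul0r addr0 acosK.
  by rewrite mul0r mul1r sub0r s2 ltr0_norm// opprK.
Qed.

Lemma cis_inj a b : 0 <= a < pi *+ 2 -> 0 <= b < pi *+ 2 -> cis a = cis b :> R[i] -> a = b.
Proof.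
wlog ab : a b / a <= b => [h ha hb e|/andP[a0 a2] /andP[b0 b2] e].
  by have [ab|/ltW ba] := leP a b; [exact: h|exact/esym/h].
apply/eqP; rewrite eq_le ab leNgt; apply/negP => ab'.
have : cis (b - a) != 1 :> R[i] by apply: cis_eq1; rewrite subr_gt0 ab'/=; lra.
by rewrite cisD -e -cisD subrr cis0 eqxx.
Qed.

Lemma cis1_int (a : R) : cis a = 1 -> exists k : int, a = k%:~R * (pi *+ 2).
Proof.
move=> e; exists (Num.floor (a / (pi *+ 2))).
have p0 : 0 < (pi *+ 2 : R) by rewrite pmulrn_rgt0 ?pi_gt0.
have := floor_itv (a / (pi *+ 2)); rewrite ler_pdivlMr// ltr_pdivrMr// rmorphD/= mulrDl mul1r.
set k := Num.floor _ => /andP[h1 h2].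
have : cis (a - k%:~R * (pi *+ 2)) = cis (0 : R).
  by rewrite -mulNr -rmorphN cisD cis_2piz e cis0 mulr1.
move=> /cis_inj h; apply/eqP; rewrite -subr_eq0; apply/eqP/h.
  by rewrite subr_ge0 h1 ltrBlDl.
by rewrite lexx.
Qed.

(** As [acos] is decreasing on [-1, 1], the preimage of a ray under it is a ray for [v]. *)
Lemma measurable_acos {d : measure_display} {T : measurableType d} (v : T -> R) :
  measurable_fun setT v -> (forall x, -1 <= v x <= 1) ->
  measurable_fun setT (fun x => acos (v x)).
Proof.
move=> mv hv; apply: (measurability _ (@RGenInftyO.measurableE R)).
move=> _ [_ [a ->] <-]; rewrite setTI.
have mlt b : measurable [set x | b < v x].
  rewrite -[X in measurable X]setTI (_ : [set x | b < v x] = v @^-1` `]b, +oo[%classic); first exact: mv.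
  by apply/seteqP; split=> x; rewrite /= in_itv/= andbT.
have [a0|a0] := ltP a 0.
  rewrite (_ : _ @^-1` _ = set0)//; apply/seteqP; split=> x //=; rewrite in_itv/=.
  by move=> /lt_trans/(_ a0); rewrite ltNge acos_ge0.
have [pa|ap] := ltP pi a.
  rewrite (_ : _ @^-1` _ = setT)//; apply/seteqP; split=> x //= _; rewrite in_itv/=.
  exact: le_lt_trans (acos_lepi (hv x)) pa.
rewrite (_ : _ @^-1` _ = [set x | cos a < v x])//; apply/seteqP.
have e x : (acos (v x) < a) = (cos a < v x).
  rewrite -[v x in RHS]acosK ?in_itv//= ltr_cos// in_itv/= ?a0//.
  by rewrite acos_ge0// acos_lepi.
by split=> x /=; rewrite in_itv/= e.
Qed.

Lemma measurable_angle {d : measure_display} {T : measurableType d} (u : T -> R[i]) :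
  cmeas u -> (forall x, normc (u x) = 1) -> measurable_fun setT (fun x => angle (u x)).
Proof.
move=> [m1 m2] u1; rewrite /angle.
have ma : measurable_fun setT (fun x => acos (complex.Re (u x))).
  apply: measurable_acos => // x; have := normc_Re (u x).
  by rewrite u1 ler_norml.
apply: measurable_fun_ifT => //.
- by apply: measurable_fun_ler => //; exact: measurable_cst.
- by apply: measurable_funB => //; exact: measurable_cst.
Qed.

End Angle.

Section CrossSection.
Context {R : realType} {d : measure_display} {T : measurableType d}.
Variables (mu : probability T R) (Phi : R -> T -> T).
Hypothesis mPhi : flow_measurable Phi.
Hypothesis Phi0 : forall x, Phi 0 x = x.
Hypothesis PhiD : forall s t x, Phi (s + t) x = Phi s (Phi t x).
Hypothesis erg : ergodic_invariant mu Phi.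
Variables (omega : R) (u : T -> R[i]).
Hypothesis omega0 : omega != 0.
Hypothesis mu_ : cmeas u.
Hypothesis u1 : forall x, normc (u x) = 1.
Hypothesis u_flow : forall t, {ae mu, forall x, u (Phi t x) = cis (omega * t) * u x}.
Variable kap : R[i] -> probability T R.
Hypothesis kap_meas : forall A, measurable A -> measurable_fun setT (fun theta : R => kap (cis theta) A).
Hypothesis kap_int : forall A, measurable A -> mu A = (\int[mu]_x kap (u x) A)%E.
Hypothesis kap_level : {ae mu, forall x, {ae kap (u x), forall y, u y = u x}}.
Hypothesis kap_flow : forall t A, measurable A -> kap (cis (omega * t)) A = kap 1 (Phi t @^-1` A).

Definition roof : R := 2 * pi / `|omega|.

(** For negative [omega] the conjugate is taken, so that the height grows at unit speed along the
    flow in both cases. *)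
Definition height (x : T) : R :=
  angle (if 0 < omega then u x else (u x)^*%C) / `|omega|.

Let aom0 : 0 < `|omega|. Proof. by rewrite normr_gt0. Qed.

Let omroof : `|omega| * roof = pi *+ 2.
Proof. by rewrite /roof mulrCA divff ?gt_eqF// mulr1 mulr_natl. Qed.

Let v x := if 0 < omega then u x else (u x)^*%C.
Let v1 x : normc (v x) = 1.
Proof. by rewrite /v; case: ifP => _; rewrite ?normcJ. Qed.

Lemma roof_gt0 : 0 < roof.
Proof. by rewrite divr_gt0 ?mulr_gt0 ?pi_gt0. Qed.

Lemma height_itv x : 0 <= height x < roof.
Proof.
have [/andP[h1 h2] _] := angleP (v1 x).
rewrite /height -/(v x) divr_ge0//= ltr_pdivrMr// mulrC omroof//.
Qed.

Lemma cis_abs_height x : cis (`|omega| * height x) = v x.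
Proof.
have [_ e] := angleP (v1 x).
by rewrite /height -/(v x) mulrC divfK// gt_eqF.
Qed.

Lemma cis_height x : cis (omega * height x) = u x.
Proof.
have := cis_abs_height x; rewrite /v; case: ifPn => [om|]; first by rewrite gtr0_norm.
by rewrite -leNgt => om; rewrite ler0_norm// mulNr cisN => /(can_inj (@conjcK R)).
Qed.

Lemma height_unique x y : u x = u y -> height x = height y.
Proof. by rewrite /height => ->. Qed.

Lemma measurable_height : measurable_fun setT (height : T -> measurableTypeR R).
Proof.
apply: measurable_funM; last exact: measurable_cst.
apply: (measurable_angle (u := v)) => //; rewrite /v; case: (0 < omega) => //.
exact: cmeasJ.
Qed.

Definition height_fun : {mfun T >-> measurableTypeR R} :=
  @mfun_Sub _ _ T (measurableTypeR R) height (mem_set measurable_height).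

(* Nothing more than [height_half] is needed about this law, which spares the
   identification with the uniform law on [0, roof]. *)
Definition height_law : probability (measurableTypeR R) R := distribution mu height_fun.

Lemma height_lawE E : height_law E = mu (height @^-1` E).
Proof. by []. Qed.

Lemma height_flow t : {ae mu, forall x, exists k : int,
  height (Phi t x) = height x + t - k%:~R * roof}.
Proof.
apply: filterS (u_flow t) => x e.
have : cis (`|omega| * (height x + t - height (Phi t x))) = 1.
  suff : cis (omega * (height x + t - height (Phi t x))) = 1.
    have [om|om] := leP 0 omega; first by rewrite ger0_norm.
    by rewrite ltr0_norm// mulNr cisN => ->; apply: eq_complexP; rewrite ReImE//= oppr0.
  rewrite mulrBr mulrDr !cisD cisN !cis_height e [_ * cis (omega * t)]mulrC mulcJ.
  by rewrite normcM normc_cis u1 mul1r expr1n.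
move=> /cis1_int[k hk]; exists k; rewrite -omroof in hk.
have : height x + t - height (Phi t x) = k%:~R * roof.
  by apply: (mulfI (lt0r_neq0 aom0)); rewrite hk mulrCA.
by move=> <-; ring.
Qed.

(** The flow for half a period exchanges the lower and upper halves of the heights and preserves
    [mu]. *)
Lemma height_half : height_law `[0, roof / 2[%classic = (1 / 2)%:E.
Proof.
have P0 := roof_gt0.
pose A := height @^-1` `[0, roof / 2[%classic.
have mA : measurable A.
  by rewrite -[A]setTI; apply: measurable_height => //; exact: measurable_itv.
have mA' : measurable (Phi (roof / 2) @^-1` A).
  by rewrite -[X in measurable X]setTI; exact: (flow_measurable_at mPhi).
have e : mu (~` A) = mu A.
  rewrite -(erg.1 (roof / 2) _ mA); apply: ae_measure_eq => //; first exact: measurableC.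
  apply: filterS (height_flow (roof / 2)) => x [k e].
  have /andP[h1 h2] := height_itv x; have /andP[] := height_itv (Phi (roof / 2) x).
  rewrite /A /= !in_itv/= h1/= {1 2}e => k1 k2.
  have hk0 : -1 < k%:~R :> R by rewrite -(ltr_pM2r P0); lra.
  have hk2 : k%:~R < 2 :> R by rewrite -(ltr_pM2r P0); lra.
  have k01 : k = 0 \/ k = 1.
    move: hk0 hk2; rewrite -[-1]/((-1)%:~R) -[2]/(2%:~R) !ltr_int.
    by case: k {e k1 k2} => [[|[|n]]|n] //; [left|right].
  have ef : (0 <= height (Phi (roof / 2) x)) by case/andP: (height_itv (Phi (roof / 2) x)).
  rewrite ef /=; split.
    move=> /negP; rewrite -leNgt => h; case: k01 => k01; move: e k1 k2; rewrite k01.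
      by rewrite mul0r subr0 => -> _; lra.
    by rewrite mul1r => -> _ _; lra.
  move=> h; apply/negP; rewrite -leNgt; case: k01 => k01; move: e k1 k2 h; rewrite k01.
    by rewrite mul0r subr0 => -> _ _; lra.
  by rewrite mul1r => -> k1 _ _; lra.
have : (mu A + mu (~` A) = 1)%E.
  have mC := measurableC mA.
  by rewrite -measureU ?setICr// setUv; exact: probability_setT.
rewrite e height_lawE -/A.
have : mu A \is a fin_num by exact: fin_num_measure.
case: (mu A) => // r _; rewrite -EFinD => -[h]; congr EFin; lra.
Qed.

(** For independence: [kap (u x)] is the image of [kap 1] under [Phi (height x)] and sits on a level
    set of [u], where the height is constantly [height x]. It therefore gives the set with height in
    [E] and base in [B] the mass [kap 1 B] or 0 according to whether [height x] lies in [E];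
    integrating over [x] gives the product. *)
Theorem cross_section_suspension : suspension mu (kap 1) height_law Phi roof height.
Proof.
have mPt t : measurable_fun setT (Phi t) by exact: flow_measurable_at.
have cisr : cis (omega * roof) = 1.
  have : cis (`|omega| * roof) = 1 by rewrite omroof cis2pi.
  have [om|om] := leP 0 omega; first by rewrite ger0_norm.
  rewrite ltr0_norm// mulNr cisN => h; rewrite -[LHS]conjcK h.
  by apply: eq_complexP; rewrite ReImE//= oppr0.
split=> //.
- exact: roof_gt0.
- by split=> // A mA; rewrite -kap_flow// cisr.
- exact: measurable_height.
- exact: height_itv.
- exact: height_flow.
- move=> E B mE mB; set A := _ `&` _.
  have mbase : measurable_fun setT (base Phi height).
    have -> : base Phi height = (fun p : measurableTypeR R * T => Phi p.1 p.2) \o (fun x => (- height x : measurableTypeR R, x)).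
      by [].
    apply: measurableT_comp; first exact: mPhi.
    by apply/measurable_fun_pair => //; apply: measurableT_comp => //; exact: measurable_height.
  have mhE : measurable (height @^-1` E).
    by rewrite -[X in measurable X]setTI; exact: measurable_height.
  have mA : measurable A.
    by apply: measurableI => //; rewrite -[X in measurable X]setTI; exact: mbase.
  have e : {ae mu, forall x, kap (u x) A = ((\1_E (height x))%:E * kap 1%R B)%E}.
    apply: filterS kap_level => x; rewrite -{1}(cis_height x) => h.
    have mAx : measurable (Phi (height x) @^-1` A) by rewrite -[X in measurable X]setTI; exact: mPt.
    rewrite -[in LHS](cis_height x) kap_flow//.
    have h' : {ae kap 1, forall y, height (Phi (height x) y) = height x}.
      have [N [mN N0 sub]] := h.
      exists (Phi (height x) @^-1` N); split.
      + by rewrite -[X in measurable X]setTI; exact: mPt.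
      + by rewrite -kap_flow.
      + by move=> y hy; apply: sub => hu; apply: hy; exact: height_unique.
    have [Ex|nEx] := pselect (E (height x)).
      rewrite indicE mem_set// mul1e; apply: ae_measure_eq => //.
      apply: filterS h' => y hy; rewrite /A /= /base hy -PhiD addNr Phi0.
      by split=> [[]|].
    rewrite indicE memNset// mul0e -(measure0 (kap 1)); apply: ae_measure_eq => //.
    by apply: filterS h' => y hy; rewrite /A /= hy; split=> // -[].
  rewrite kap_int// height_lawE.
  transitivity (\int[mu]_x ((\1_(height @^-1` E) x)%:E * kap 1%R B))%E.
    apply: ae_eq_integral => //.
    + under eq_fun do rewrite -cis_height.
      apply: (measurableT_comp (kap_meas mA)); apply: measurable_funM => //.
      exact: measurable_height.
    + by apply: emeasurable_funM => //; apply/measurable_EFinP; exact: measurable_indic.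
    + by apply: filterS e => x ->.
  rewrite ge0_integralZr//; last by apply/measurable_EFinP; exact: measurable_indic.
  by rewrite integral_indic// setIT.
- exact: height_half.
Qed.

End CrossSection.

(** * Borel sets of a second countable space and the support *)

Section Borel.
Context {R : realType} {M : ptopologicalType}.

Lemma second_countable_seq : @second_countable M -> exists V : nat -> set M,
  (forall n, open (V n)) /\
  forall x U, open U -> U x -> exists2 n, V n x & V n `<=` U.
Proof.
move=> [B /countable_injP[f finj] [Bo Bb]].
(* By injectivity of [f] this union has at most one member; it is empty at the indices that are not
   attained. *)
exists (fun n => \bigcup_(W in B `&` f @^-1` [set n]) W); split.
  by move=> n; apply: bigcup_open => W [BW _]; exact: Bo.
move=> x U oU Ux; have /Bb[W [BW Wx] WU] : nbhs x U by rewrite nbhsE/=; exists U.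
exists (f W); first by exists W.
by move=> y [W' [BW' /= e] W'y]; apply: WU; rewrite /= -(finj _ _ _ _ e) ?inE.
Qed.

Lemma open_measurable_borel (U : set M) : open U -> measurable (U : set (borel M)).
Proof. exact: sub_sigma_algebra. Qed.

Hypothesis sc : @second_countable M.

(** Second countability makes [W] a countable union of products of rational intervals and basic open
    sets. It provides the joint measurability of the flow for the product of the Borel
    sigma-algebras. *)
Lemma open_prod_measurable (W : set (R * M)) : open W ->
  measurable (W : set (measurableTypeR R * borel M)).
Proof.
move=> oW; have [V [oV bV]] := second_countable_seq sc.
pose D (p : rat * rat * nat) : set (measurableTypeR R * borel M) :=
  `]ratr p.1.1, ratr p.1.2[%classic `*` V p.2.
pose D' p := if `[< D p `<=` W >] then D p else set0.
have -> : W = \bigcup_p D' p.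
  apply/seteqP; split=> [[t x] Wtx|x [p _]]; last first.
    by rewrite /D'; case: asboolP => // h; exact: h.
  have [[I U] /= [nI nU] IU] := oW _ Wtx.
  move: nU; rewrite nbhsE/= => -[U' [oU' U'x] U'U].
  have [n Vx VU] := bV _ _ oU' U'x.
  move: nI => /nbhs_ballP[e /= e0 eI].
  have [a /itvP ha] : exists q : rat, ratr q \in `]t - e, t[ by apply: rat_in_itvoo; rewrite ltrBlDr ltrDl.
  have [b /itvP hb] : exists q : rat, ratr q \in `]t, t + e[ by apply: rat_in_itvoo; rewrite ltrDl.
  exists (a, b, n) => //; rewrite /D' asboolT.
    by split=> //=; rewrite in_itv/= ha hb.
  move=> [s y] [/= + Vy]; rewrite in_itv/= => /andP[h1 h2]; apply: IU; split=> /=.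
    apply: eI; rewrite /ball/= ltr_norml; apply/andP; split.
      have : ratr b < t + e by rewrite hb.
      lra.
    have : t - e < ratr a by rewrite ha.
    lra.
  by apply: U'U; exact: VU.
apply: countable_bigcupT_measurable => // p; rewrite /D'; case: ifP => // _.
by apply: measurableX; [exact: measurable_itv|exact: open_measurable_borel].
Qed.

Lemma continuous_flow_measurable (Phi : R -> borel M -> borel M) :
  continuous (fun p : R * M => (Phi p.1 p.2 : M)) -> flow_measurable Phi.
Proof.
move=> /continuousP c; rewrite /flow_measurable; apply: (measurability (@open M : set (set (borel M)))) => [//|_ [U oU <-]].
by rewrite setTI; apply: open_prod_measurable; exact: c.
Qed.

Variable mu : probability (borel M) R.
Local Notation X := (measure_support mu).

(** The complement of the support is the union of the basic open sets of measure 0, of which there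
    are countably many. *)
Lemma support_conull : measurable (X : set (borel M)) /\ mu (~` X) = 0%E.
Proof.
have [V [oV bV]] := second_countable_seq sc.
pose F n : set (borel M) := if mu (V n) == 0%E then V n else set0.
have e : ~` X = \bigcup_n F n.
  apply/seteqP; split=> [x nX|x [n _]].
    have [U [oU Ux U0]] : exists U : set M, [/\ open U, U x & ~ (0 < mu U)%E].
      apply: contrapT => h; apply: nX => U oU Ux; apply: contrapT => h0.
      by apply: h; exists U.
    have [n Vx VU] := bV _ _ oU Ux; exists n => //; rewrite /F ifT//.
    rewrite eq_le measure_ge0 andbT; move/negP: U0; rewrite -leNgt; apply: le_trans.
    by apply: le_measure => //; rewrite inE; exact: open_measurable_borel.
  rewrite /F; case: eqP => // V0 Vx Xx.
  by have := Xx _ (oV n) Vx; rewrite V0 ltxx.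
have mF n : measurable (F n) by rewrite /F; case: ifP => // _; exact: open_measurable_borel.
have mX : measurable (~` X : set (borel M)) by rewrite e; exact: bigcupT_measurable.
split; first by rewrite -[X]setCK; exact: measurableC.
apply/(negligibleP mu mX); rewrite e; apply: negligible_bigcup => n.
by apply/(negligibleP mu (mF n)); rewrite /F; case: eqP => // _; rewrite measure0.
Qed.

Lemma ae_support : {ae mu, forall x, X x}.
Proof. by have [mX X0] := support_conull; exact: ae_of_null. Qed.

Lemma within_continuous_measurable (D : set (borel M)) (f : M -> R) : measurable D ->
  {within (D : set M), continuous f} -> measurable_fun D (f : borel M -> R).
Proof.
move=> mD /continuousP c; apply: (measurability _ (@RGenOpens.measurableE R)).
move=> _ [_ [a [b ->]] <-].
have /open_subspaceP[V oV VE] := c _ (itv_open a b).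
rewrite setIC -[X in measurable X]VE; apply: measurableI => //.
exact: open_measurable_borel.
Qed.

End Borel.

(** * The flow as a suspension over the level set *)

Section LevelSetSuspension.
Context {R : realType} {M : ptopologicalType}.
Hypothesis sc : @second_countable M.
Variables (mu : probability (borel M) R) (Phi : R -> borel M -> borel M).
Hypothesis Phi0 : forall x, Phi 0 x = x.
Hypothesis PhiD : forall s t x, Phi (s + t) x = Phi s (Phi t x).
Hypothesis Phi_cont : continuous (fun p : R * M => (Phi p.1 p.2 : M)).
Hypothesis erg : ergodic_invariant mu Phi.
Variables (z : M -> R[i]) (omega : R).
Hypothesis z_eigen : nonconstant_koopman_eigenfunction mu Phi omega z.
Variable kappa : R[i] -> probability (borel M) R.
Hypothesis kappa_dis : flow_disintegration mu Phi omega z kappa.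
Hypothesis omega0 : omega != 0.
Local Notation X := (measure_support mu).

Let mPhi : flow_measurable Phi.
Proof. exact: continuous_flow_measurable. Qed.

Let mX : measurable (X : set (borel M)).
Proof. by have [] := support_conull sc mu. Qed.

(** The function [z] is controlled on the support only. The value 1 elsewhere gives modulus 1 at
    every point, and the change is invisible almost everywhere. *)
Definition extend_by_one (x : borel M) : R[i] := if x \in X then z x else 1.
Local Notation u := extend_by_one.

Lemma extend_by_oneE x : X x -> u x = z x.
Proof. by move=> Xx; rewrite /u mem_set. Qed.

Let u1 x : normc (u x) = 1.
Proof.
rewrite /u; case: ifPn => [|_]; last exact: normc1.
by rewrite inE; exact: z_eigen.1.
Qed.

Let u_meas : cmeas u.
Proof.
have mi (f : M -> R) (c : R) : measurable_fun (X : set (borel M)) (f : borel M -> R) ->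
    measurable_fun setT (fun x : borel M => if x \in X then f x else c).
  move=> mf; apply: measurable_fun_if => //.
  - apply: (@measurable_fun_bool _ _ _ _ true).
    rewrite setTI (_ : _ @^-1` _ = X)//.
    by apply/seteqP; split=> x /= h; [exact: set_mem h|exact: mem_set h].
  - rewrite setTI (_ : _ @^-1` _ = X)//.
    by apply/seteqP; split=> x /= h; [exact: set_mem h|exact: mem_set h].
have e (g : R[i] -> R) : (fun x => g (u x)) = (fun x => if x \in X then g (z x) else g 1).
  by apply/funext => x; rewrite /u; case: ifP.
case: z_eigen.2 => [[[c1 c2 _] _]|[[Lz _ _] _]].
  by split; rewrite e; apply: mi; apply: within_continuous_measurable.
by have [m1 m2] := in_L2_cmeas Lz; split; rewrite e; apply: mi; exact: measurable_funTS.
Qed.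

Let u_flow t : {ae mu, forall x, u (Phi t x) = cis (omega * t) * u x}.
Proof.
have h1 := ae_support sc mu.
have h2 := preserving_ae (flow_preserving mPhi erg t) h1.
have h12 : {ae mu, forall x, X x /\ X (Phi t x)}.
  by apply: (@filterS2 _ _ (ae_filter_ringOfSetsType mu)) h1 h2 => x; split.
case: z_eigen.2 => [[[_ _ h] _]|[[_ _ h] _]].
  by apply: (@filterS _ _ (ae_filter_ringOfSetsType mu) _ _ _ h12) => x [x1 x2]; rewrite !extend_by_oneE// h.
by apply: (@filterS2 _ _ (ae_filter_ringOfSetsType mu)) h12 (h t) => x [x1 x2]; rewrite !extend_by_oneE.
Qed.

Theorem level_set_suspension :
  suspension mu (kappa 1) (height_law mu omega u_meas u1) Phi (roof omega) (height omega u).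
Proof.
have [k1 k2 k3 k4 _] := kappa_dis.
have mk A : measurable A -> measurable_fun setT (fun x => kappa (u x) A).
  move=> mA; have cu x : cis (angle (u x)) = u x by have [] := angleP (u1 x).
  under eq_fun do rewrite -cu.
  by apply: (measurableT_comp (k1 A mA)); exact: measurable_angle.
apply: cross_section_suspension => //.
- move=> A mA; rewrite (k2 A mA).
  transitivity (\int[mu]_(x in X) kappa (u x) A)%E.
    by apply: eq_integral => x; rewrite inE => Xx; rewrite extend_by_oneE.
  have [_ X0] := support_conull sc mu.
  rewrite -[in RHS](setUv X) ge0_integral_setU//; last 3 first.
  - exact: measurableC.
  - by rewrite setUv; exact: mk.
  - by apply/disj_set2P; rewrite setICr.
  rewrite [X in (_ + X)%E]null_set_integral ?adde0//; first exact: measurableC.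
  exact: measurable_funTS (mk A mA).
- apply: (@filterS2 _ _ (ae_filter_ringOfSetsType mu)) k3 (ae_support sc mu) => x h Xx; rewrite extend_by_oneE//.
  have ml : measurable (level_set mu z (z x) : set (borel M)).
    rewrite (_ : level_set _ _ _ = X `&` [set y | u y = z x]); last first.
      by apply/seteqP; split=> y [Xy] /=; rewrite /level_set/= extend_by_oneE.
    apply: measurableI => //; rewrite (_ : [set y | _] =
        (fun y => complex.Re (u y)) @^-1` [set complex.Re (z x)] `&`
        (fun y => complex.Im (u y)) @^-1` [set complex.Im (z x)]).
      have [m1 m2] := u_meas.
      by apply: measurableI; rewrite -[X in measurable X]setTI; [exact: m1|exact: m2].
    by apply/seteqP; split=> y /= [] ; [move=> ->|exact: eq_complexP].
  by apply: (@filterS _ _ (ae_filter_ringOfSetsType (kappa (z x))) _ _ _ (ae_measure1 ml h)) => y [Xy] /= <-; rewrite extend_by_oneE.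
- by move=> t A mA; rewrite -[cis _]mulr1; apply: k4 => //; exact: normc1.
Qed.

Lemma eigenfrequency_omega : eigenfrequency mu Phi omega.
Proof.
exists u; apply: (ueig_eigen (u := u)); split=> //.
- by move=> x; rewrite u1.
- by apply: aeW => x; rewrite u1.
Qed.

End LevelSetSuspension.

(** Primitivity excludes the frequency 0, which is 0 times itself. *)
Lemma primitive_neq0 {R : realType} {d : measure_display} {T : measurableType d}
  (mu : probability T R) (Phi : R -> T -> T) (omega : R) :
  eigenfrequency mu Phi 0 -> primitive_frequency mu Phi omega -> omega != 0.
Proof.
by move=> h0 h; apply/eqP => o0; have := h 0 0 h0; rewrite o0 mul0r => /(_ erefl).
Qed.

Theorem theorem5 (R : realType) (M : ptopologicalType) (n : nat)
  (A : @C1_atlas R M n) (M_manifold : C1_manifold A)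
  (V : vector_field A) (Phi : R -> borel M -> borel M)
  (Phi_flow : C1_flow A Phi) (Phi_gen : generated_by Phi V)
  (mu : probability (borel M) R)
  (mu_erg : ergodic_invariant mu Phi)
  (X_compact : compact (measure_support mu))
  (z : M -> R[i]) (omega : R)
  (z_eigen : nonconstant_koopman_eigenfunction mu Phi omega z)
  (kappa : R[i] -> probability (borel M) R)
  (kappa_dis : flow_disintegration mu Phi omega z kappa)
  (m : nat) (m_ge1 : (1 <= m)%N)
  (w : 'I_m -> R) (zs : 'I_m -> borel M -> R[i])
  (D_gen : generated_by_independent mu Phi w zs)
  (omega_prim : primitive_frequency mu Phi omega) :
  let period := 2 * pi / omega in
  let Rmap := Phi period in
  let mu_L1 := kappa 1 in
  let Dperp := orthocompl mu (flow_discrete mu Phi) in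
  map_generated_by mu_L1 Rmap m.-1 /\
  (m = 1%N ->
    ((forall c f, map_eigenfunction mu_L1 Rmap c f -> ae_constant mu_L1 f) /\
     map_weakly_mixing mu_L1 Rmap) /\
    ((flow_strongly_mixing mu Phi Dperp <-> map_strongly_mixing mu_L1 Rmap) /\
     (map_strongly_mixing mu_L1 Rmap ->
        forall alpha : R -> R, rate_function alpha ->
          (flow_strong_rate mu Phi Dperp alpha <->
           map_strong_rate mu_L1 Rmap (fun k => alpha (k%:R * `|period|))))) /\
    ((flow_weakly_mixing mu Phi Dperp <-> map_weakly_mixing mu_L1 Rmap) /\
     (map_weakly_mixing mu_L1 Rmap ->
        forall alpha : R -> R, rate_function alpha ->
          (flow_weak_rate mu Phi Dperp alpha <->
           map_weak_rate mu_L1 Rmap (fun k => alpha (k%:R * `|period|)))))).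
Proof.
have sc : @second_countable M by case: M_manifold.
have [Phi0 PhiD Phi_cont _] := Phi_flow.
have omega0 : omega != 0 by apply: primitive_neq0 omega_prim; exact: (eigenfrequency0 (continuous_flow_measurable sc Phi_cont) PhiD mu_erg).
have eig := eigenfrequency_omega sc Phi_cont mu_erg z_eigen.
have su := level_set_suspension sc Phi0 PhiD Phi_cont mu_erg z_eigen kappa_dis omega0.
exact: (suspension_theorem su m_ge1 omega0 erefl eig omega_prim D_gen).
Qed.
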